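(* Let $d\in\mathbb N$, let $\mathbb Q$ be an arbitrary probability measure on the space $V_d$ of variograms on $\mathbb R^d$, and let $\xi_{\mathbb Q}=\{\xi_{\mathbb Q}(t),\,t\in\mathbb R^d\}$ be the max-mixture of Brown–Resnick processes with respect to $\mathbb Q$ (defined in the context). Then $\xi_{\mathbb Q}$ is max-stable and stationary, and its finite-dimensional distributions are as follows: for all $m\in\mathbb N$, $t_1,\dots,t_m\in\mathbb R^d$ and $x_1,\dots,x_m\in\mathbb R$, $$\mathbb P\left(\xi_{\mathbb Q}(t_1)\le x_1,\dots,\xi_{\mathbb Q}(t_m)\le x_m\right)=\exp\left(\int_{[0,\infty)^{m\times m}}\log H_\Lambda(x_1,\dots,x_m)\,\eta(d\Lambda)\right),$$ where $\eta$ is the probability measure on $[0,\infty)^{m\times m}$ induced by $\mathbb Q$, i.e. the image of $\mathbb Q$ under the map $\gamma\mapsto\left(\sqrt{\gamma(t_j-t_k)}\right)_{1\le j,k\le m}$, and $H_\Lambda$ is defined in the context.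
   Context: **Max-mixture process.** $V_d$ is the measurable space of all variograms on $\mathbb R^d$, i.e. (symmetric, real-valued) conditionally negative definite functions $\gamma$ on $\mathbb R^d$ with $\gamma(0)=0$, equipped with the product $\sigma$-algebra. Let $\gamma_i$, $i\in\mathbb N$, be i.i.d. with distribution $\mathbb Q$. Let $(\gamma_i,W_i)$, $i\in\mathbb N$, be i.i.d. such that, conditionally on $\gamma_i$, $W_i$ is a zero-mean Gaussian process on $\mathbb R^d$ with stationary increments, variogram $4\gamma_i$ (i.e. $\mathbb E[(W_i(t)-W_i(s))^2\mid\gamma_i]=4\gamma_i(t-s)$) and $W_i(0)=0$ a.s. Let $\sum_{i=1}^\infty\delta_{U_i}$ be a Poisson point process on $\mathbb R$ with intensity $e^{-u}\,du$, independent of the $(\gamma_i,W_i)$. Then $$\xi_{\mathbb Q}(t)=\max_{i\in\mathbb N}\left(U_i+W_i(t)-2\gamma_i(t)\right),\qquad t\in\mathbb R^d.$$ **Max-stability** (Gumbel margins): for every $n\in\mathbb N$, if $\xi^{(1)},\dots,\xi^{(n)}$ are i.i.d. copies of the process $\xi$, then $\max_{i\le n}\xi^{(i)}-\log n$ has the same finite-dimensional distributions as $\xi$. Stationarity means invariance of the finite-dimensional distributions under translations of $\mathbb R^d$. **Hüsler–Reiss distribution $H_\Lambda$.** For $\Lambda=(\lambda_{j,k})_{1\le j,k\le m}\in[0,\infty)^{m\times m}$, $2\le l\le m$ and $q=(q_1,\dots,q_l)$ with $1\le q_1<\dots<q_l\le m$, put $$\Gamma_{l,q}(\Lambda)=2\left(\lambda_{q_j,q_l}^2+\lambda_{q_k,q_l}^2-\lambda_{q_j,q_k}^2\right)_{1\le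 j,k\le l-1}.$$ $S(\mathbf x|\Psi)=\mathbb P(Y_1>x_1,\dots,Y_r>x_r)$ for $\mathbf Y\sim N(\mathbf 0,\Psi)$ in $\mathbb R^r$ (possibly degenerate); if $\Psi$ is not a covariance matrix, $S(\mathbf x|\Psi)=0$. Then $$H_\Lambda(\mathbf x)=\exp\left(\sum_{l=1}^m(-1)^l\sum_{q:\,1\le q_1<\dots<q_l\le m}h_{l,q,\Lambda}(x_{q_1},\dots,x_{q_l})\right),$$ where $h_{1,q,\Lambda}(y)=e^{-y}$ and, for $2\le l\le m$, $$h_{l,q,\Lambda}(y_1,\dots,y_l)=\int_{y_l}^\infty S\left(\left(y_i-z+2\lambda_{q_i,q_l}^2\right)_{i=1,\dots,l-1}\,\middle|\,\Gamma_{l,q}(\Lambda)\right)e^{-z}\,dz.$$ *)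

(* Defs.v *)
From HB Require Import structures.
From mathcomp Require Import all_boot all_order all_algebra.
From mathcomp Require Import all_classical all_reals all_analysis.
(* [all_analysis] does not export the measurable structure of [\bar R]. *)
From mathcomp Require Import measurable_realfun.
Set Implicit Arguments.
Unset Strict Implicit.
Unset Printing Implicit Defensive.
Import Order.TTheory GRing.Theory Num.Theory.
Import numFieldNormedType.Exports.
Local Open Scope classical_set_scope.
Local Open Scope ring_scope.

Definition gen_family d (V : measurableType d) (I T : Type)
    (f : I -> T -> V) : set_system T :=
  \bigcup_i preimage_set_system setT (f i) measurable.

(* [fun_space I R] is R^I with the product sigma-algebra. *)
Definition fun_space (I : Type) (R : realType) :=
  g_sigma_algebraType (gen_family (fun (i : I) (w : I -> R) => w i)).

Definition mx_space (m : nat) (R : realType) :=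
  g_sigma_algebraType
    (gen_family (fun (jk : 'I_m * 'I_m) (L : 'M[R]_m) => L jk.1 jk.2)).

Definition cond_neg_def (R : realType) d (g : 'rV[R]_d -> R) : Prop :=
  forall n (t : 'I_n -> 'rV[R]_d) (a : 'I_n -> R), \sum_i a i = 0 ->
    \sum_i \sum_j a i * a j * g (t i - t j) <= 0.

Record variogram (R : realType) (d : nat) := Variogram {
  variogram_fun :> 'rV[R]_d -> R;
  variogram0 : variogram_fun 0 = 0;
  variogramN : forall t, variogram_fun (- t) = variogram_fun t;
  variogram_cnd : cond_neg_def variogram_fun }.

Section variogram_pointed.
Context (R : realType) (d : nat).

Let zero_cnd : @cond_neg_def R d (fun=> 0).
Proof.
by move=> n t a _; rewrite big1 // => i _; rewrite big1 // => j _; rewrite mulr0.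
Qed.

HB.instance Definition _ := gen_eqMixin (variogram R d).
HB.instance Definition _ := gen_choiceMixin (variogram R d).
HB.instance Definition _ := isPointed.Build (variogram R d)
  (@Variogram R d (fun=> 0) erefl (fun=> erefl) zero_cnd).
End variogram_pointed.

(* V_d with the product sigma-algebra, generated by the evaluations. *)
Definition variogram_space (R : realType) (d : nat) :=
  g_sigma_algebraType (gen_family (fun t (g : variogram R d) => g t)).

Section independence.
Context d (Omega : measurableType d) (R : realType).
Variable P : probability Omega R.
Local Open Scope ereal_scope.

Definition mutually_independent (I : eqType) (F : I -> set_system Omega) :=
  forall (s : seq I) (A : I -> set Omega), uniq s ->
    (forall i, i \in s -> F i (A i)) ->
    P (\bigcap_(i in [set` s]) A i) = \prod_(i <- s) P (A i).

Definition independent2 (F G : set_system Omega) :=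
  forall A B, F A -> G B -> P (A `&` B) = P A * P B.

End independence.

Section gaussian.
Context (R : realType).

(* [normal_prob m 0] is not the Dirac mass at m. *)
Definition gaussian_law (m s : R) : set R -> \bar R :=
  if s == 0 then \d_m else normal_prob m s.

Context (I : Type).
Variable mu : {measure set (fun_space I R) -> \bar R}.

Definition gaussian_process := forall n (t : 'I_n -> I) (a : 'I_n -> R),
  exists m s : R, forall B : set R, measurable B ->
    mu [set w | B (\sum_i a i * w (t i))] = gaussian_law m s B.

Definition zero_mean := forall t, (\int[mu]_w (w t)%:E = 0)%E.

End gaussian.

Section gaussian_variogram.
Context (R : realType) (d : nat).
Variable mu : {measure set (fun_space 'rV[R]_d R) -> \bar R}.

Definition stationary_increments :=
  forall (h : 'rV[R]_d) (A : set (fun_space 'rV[R]_d R)), measurable A ->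
    mu [set w | A (fun t => w (t + h) - w h)] =
    mu [set w | A (fun t => w t - w 0)].

Definition has_variogram (g : 'rV[R]_d -> R) := forall s t,
  (\int[mu]_w ((w t - w s) ^+ 2)%:E = (g (t - s))%:E)%E.

Definition gaussian_with_variogram (g : 'rV[R]_d -> R) := [/\
  gaussian_process mu, zero_mean mu, stationary_increments, has_variogram g &
  {ae mu, forall w, w 0 = 0}].

End gaussian_variogram.

Section poisson.
Context (R : realType).
Local Open Scope ereal_scope.

Definition exp_intensity (B : set R) : \bar R :=
  \int[lebesgue_measure]_(u in B) (expR (- u))%:E.

Context d (Omega : measurableType d).
Variables (P : probability Omega R) (U : nat -> Omega -> R).

Definition point_count (B : set R) (omega : Omega) : \bar R :=
  mseries (fun i => \d_(U i omega)) 0 B.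

(* The mass function is written out because the library's [poisson_pmf 0 k]
   equals 1 for every k. *)
Definition poisson_process (lambda : set R -> \bar R) :=
  (forall B, measurable B -> lambda B < +oo -> forall k : nat,
     P [set omega | point_count B omega = k%:R%:E] =
     (expR (- fine (lambda B)) * fine (lambda B) ^+ k / k`!%:R)%:E) /\
  (forall n (B : 'I_n -> set R), (forall j, measurable (B j)) ->
     trivIset setT B ->
     mutually_independent P
       (fun j => g_sigma_algebra_preimage (point_count (B j)))).

End poisson.

Section max_mixture.
Context (R : realType) (d : nat) (dO : measure_display).
Context (Omega : measurableType dO) (P : probability Omega R).
Variable Q : probability (variogram_space R d) R.
Variables (g : nat -> {RV P >-> variogram_space R d})
  (W : nat -> {RV P >-> fun_space 'rV[R]_d R}) (U : nat -> {RV P >-> R}).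

Definition mark (i : nat) (omega : Omega) :
    (variogram_space R d * fun_space 'rV[R]_d R)%type :=
  (g i omega, W i omega).

(* The regular conditional law of [W i] given [g i] is a probability kernel. *)
Definition cond_gaussian (i : nat) :=
  exists kappa : R.-pker (variogram_space R d) ~> (fun_space 'rV[R]_d R),
    (forall A B, measurable A -> measurable B ->
      P (g i @^-1` A `&` W i @^-1` B) = (\int[Q]_(v in A) kappa v B)%E) /\
    {ae Q, forall v, gaussian_with_variogram (kappa v) (fun t => 4 * v t)}.

(* The labelled sequence (U_i), and not only the random measure it induces, is
   independent of the marks: an enumeration of the points depending on the marks
   could bias which mark is attached to which point. *)
Record max_mixture_data : Prop := {
  g_law : forall i A, measurable A -> P (g i @^-1` A) = Q A;
  mark_ident : forall i A, measurable A ->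
    P (mark i @^-1` A) = P (mark 0%N @^-1` A);
  mark_indep : mutually_independent P
    (fun i => g_sigma_algebra_preimage (mark i));
  mark_gaussian : forall i, cond_gaussian i;
  U_poisson : poisson_process P U (@exp_intensity R);
  U_indep : independent2 P <<s gen_family U >> <<s gen_family mark >> }.

(* The maximum over infinitely many indices is the supremum in [\bar R]. *)
Definition max_mixture (omega : Omega) (t : 'rV[R]_d) : \bar R :=
  ereal_sup (range (fun i => (U i omega + W i omega t - 2 * g i omega t)%:E)).

End max_mixture.

Section processes.
Context (R : realType) (E : zmodType).
Local Open Scope ereal_scope.

Definition fdd d (Omega : measurableType d) (P : probability Omega R)
    (X : Omega -> E -> \bar R) m (t : 'I_m -> E) :
    set (m.-tuple (\bar R)) -> \bar R :=
  pushforward P (fun omega => [tuple X omega (t j) | j < m]).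

Definition eq_fdd d (Omega : measurableType d) (P : probability Omega R)
    (X : Omega -> E -> \bar R)
    d' (Omega' : measurableType d') (P' : probability Omega' R)
    (Y : Omega' -> E -> \bar R) :=
  forall m (t : 'I_m -> E) A, measurable A -> fdd P X t A = fdd P' Y t A.

Context d (Omega : measurableType d) (P : probability Omega R).
Variable X : Omega -> E -> \bar R.

Definition stationary :=
  forall h : E, eq_fdd P X P (fun omega t => X omega (t + h)%R).

Definition max_stable := forall n : nat, (0 < n)%N ->
  forall d' (Omega' : measurableType d') (P' : probability Omega' R)
    (Y : 'I_n -> Omega' -> E -> \bar R),
    (forall i t, measurable_fun setT (fun omega => Y i omega t)) ->
    mutually_independent P'
      (fun i => <<s gen_family (fun t omega => Y i omega t) >>) ->
    (forall i, eq_fdd P' (Y i) P X) ->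
    eq_fdd P'
      (fun omega t => (\big[maxe/-oo]_(i < n) Y i omega t) - (ln n%:R)%:E) P X.

End processes.

Section husler_reiss.
Context (R : realType).

Definition normal_vector r (mu : {measure set (fun_space 'I_r R) -> \bar R})
    (Psi : 'M[R]_r) := [/\
  gaussian_process mu, zero_mean mu &
  forall j k, (\int[mu]_y (y j * y k)%:E = (Psi j k)%:E)%E].

(* S(x | Psi); the value is 0 when no law N(0, Psi) exists, that is, when Psi is
   not a covariance matrix. *)
Definition normal_survival r (x : 'I_r -> R) (Psi : 'M[R]_r) : R :=
  xget 0 [set p : R | exists mu : probability (fun_space 'I_r R) R,
    normal_vector mu Psi /\ p%:E = mu [set y | forall i, x i < y i]].

Context (m : nat).

(* An l-tuple q_1 < ... < q_l is indexed by 'I_r.+1 with l = r.+1, so that q_l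
   is [q ord_max] and q_1, ..., q_(l-1) are [q (lift ord_max j)], j : 'I_r. *)
Definition HR_Gamma r (q : 'I_r.+1 -> 'I_m) (L : 'M[R]_m) : 'M[R]_r :=
  \matrix_(j, k) (2 * (L (q (lift ord_max j)) (q ord_max) ^+ 2
                       + L (q (lift ord_max k)) (q ord_max) ^+ 2
                       - L (q (lift ord_max j)) (q (lift ord_max k)) ^+ 2)).

Definition HR_h r (q : 'I_r.+1 -> 'I_m) (L : 'M[R]_m) (y : 'I_r.+1 -> R) : R :=
  if r == 0%N then expR (- y ord_max) else
  \int[lebesgue_measure]_(z in `[y ord_max, +oo[)
    (normal_survival
       (fun i => y (lift ord_max i) - z
                 + 2 * L (q (lift ord_max i)) (q ord_max) ^+ 2)
       (HR_Gamma q L) * expR (- z)).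

Definition strictly_increasing r (q : {ffun 'I_r -> 'I_m}) : bool :=
  [forall i : 'I_r, forall j : 'I_r, (i < j)%N ==> (q i < q j)%N].

Definition husler_reiss (L : 'M[R]_m) (x : 'I_m -> R) : R :=
  expR (\sum_(r < m) (-1) ^+ r.+1 *
    \sum_(q : {ffun 'I_r.+1 -> 'I_m} | strictly_increasing q) HR_h q L (x \o q)).

End husler_reiss.

Section mixing_measure.
Context (R : realType) (d m : nat).

Definition nonneg_mx : set (mx_space m R) := [set L | forall j k, 0 <= L j k].

Variable t : 'I_m -> 'rV[R]_d.

Definition sqrt_variogram_mx (v : variogram_space R d) : mx_space m R :=
  \matrix_(j, k) Num.sqrt (v (t j - t k)).

Let measurable_sqrt_variogram_mx : measurable_fun setT sqrt_variogram_mx.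
Proof.
apply: measurability => // _ [_ [[j k] _ [B mB <-]]] <-.
have mev : measurable_fun setT (fun v : variogram_space R d => v (t j - t k)).
  move=> _ C mC; apply: sub_sigma_algebra.
  by exists (t j - t k) => //; exists C.
have msq : measurable_fun setT (@Num.sqrt R).
  by apply: continuous_measurable_fun; exact: sqrt_continuous.
rewrite [X in measurable X](_ : _ = setT `&`
    (Num.sqrt \o (fun v : variogram_space R d => v (t j - t k))) @^-1` B).
  exact: (measurableT_comp msq mev).
by apply/seteqP; split => v /= [_]; rewrite /sqrt_variogram_mx /= ?setTI /= mxE.
Qed.

HB.instance Definition _ := isMeasurableFun.Build _ _ _ _ sqrt_variogram_mx
  measurable_sqrt_variogram_mx.

End mixing_measure.

(* Main.v *)
Require Import Defs.
From HB Require Import structures.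
From mathcomp Require Import all_boot all_order all_algebra.
From mathcomp Require Import all_classical all_reals all_analysis.
From mathcomp Require Import measurable_realfun ring lra.
Set Implicit Arguments.
Unset Strict Implicit.
Unset Printing Implicit Defensive.
Import Order.TTheory GRing.Theory Num.Theory.
Import numFieldNormedType.Exports.
Local Open Scope classical_set_scope.
Local Open Scope ring_scope.

(** The event [xi (t_j) <= x_j] for all [j] says that every
    Poisson point satisfies [U_i <= V_i], where [expR (- V_i)] is the maximum
    over [j] of [expR (W_i (t_j) - 2 g_i (t_j) - x_j)].  The number of points
    above their mark is Poisson, so the probability is [expR (- E expR (- V_0))];
    this is obtained by discretizing [U] on a grid, where it reduces to the
    generating function of independent Poisson counts.  Replacing [x_j] by
    [x_j + ln n] divides the exponent by [n], which is max-stability.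

    Conditionally on the variogram, [W] is Gaussian at [t_1, ..., t_m].  The
    maximum of nonnegative numbers is the alternating sum of their minima over
    increasing tuples [q], and the Cameron-Martin shift along the last
    coordinate of [q] identifies the expected minimum with [h_{l,q}]; hence the
    conditional exponent is [- ln H_Lambda].  It depends on the variogram only
    through its values at the differences [t_j - t_k], which gives stationarity.
    Uniqueness of Gaussian laws is proved by smoothing half-space indicators
    with normal peaks, and their existence by the Cholesky factorization. *)

(** * Integration *)

(** Two definitions shape the work. [normal_survival] picks its value by [xget], so it cannot be
    computed before the law N(0, Psi) is known to be unique. Existence then serves twice: every
    Gaussian vector becomes a linear image of independent normals, where the shift formula is a
    product computation, and the exponent becomes a visibly measurable function of the matrix. The
    latter matters because the mixing integral runs over all nonnegative matrices, including those
    that come from no variogram; there [ln (husler_reiss L x)] is replaced, off a null set, by a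
    measurable function. Transforms are kept real: cosines with a phase take the place of complex
    exponentials. The Poisson part uses only counts in finitely many disjoint cells and the
    independence of the labelled points from the marks; no point process of pairs is built. A grid
    cell tests the mark against its left end only, so that point and mark conditions stay in product
    form; the error disappears as the mesh shrinks and the window grows. *)

Lemma bounded_measurable_integrable d (T : measurableType d) (R : realType)
    (mu : {finite_measure set T -> \bar R}) (f : T -> R) (M : R) :
  measurable_fun setT f -> (forall x, `|f x| <= M) ->
  mu.-integrable setT (EFin \o f).
Proof.
move=> mf fM; apply: measurable_bounded_integrable => //.
  by rewrite ltey_eq fin_num_measure.
exists M; split; first exact: num_real.
by move=> x Mx y _ /=; exact: le_trans (fM y) (ltW Mx).
Qed.

Definition to_mfun d d' (T : measurableType d) (T' : measurableType d')
    (f : T -> T') (mf : measurable_fun setT f) : {mfun T >-> T'} :=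
  MeasurableFun.Pack (MeasurableFun.Class (isMeasurableFun.Build d d' T T' f mf)).

Definition image_measure d d' (T : measurableType d) (T' : measurableType d')
    (R : realType) (mu : {measure set T -> \bar R}) (f : T -> T')
    (mf : measurable_fun setT f) : {measure set T' -> \bar R} :=
  measure_function_pushforward__canonical__measure_function_Measure mu mf.

(** By uniqueness of Lebesgue measure it is enough to compare both sides on half-open intervals; a
    negative [a] reverses the preimage, whence the two cases. *)
Lemma lebesgue_measure_affine (R : realType) (a b : R) (A : set R) :
  a != 0 -> measurable A ->
  lebesgue_measure A =
  (`|a|%:E * lebesgue_measure ((fun x : R => (a * x + b)%R) @^-1` A))%E.
Proof.
move=> a0 mA.
have mphi : measurable_fun setT ((fun x => a * x + b) : measurableTypeR R -> measurableTypeR R).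
  by apply: measurable_funD => //; exact: measurable_funM.
pose nu : {measure set (measurableTypeR R) -> \bar R} :=
  mscale (NngNum (normr_ge0 a)) (image_measure (@lebesgue_measure R) mphi).
have nuE X : ocitv X -> lebesgue_measure X = nu X; last first.
  exact: (@lebesgue_measure_unique R nu nuE).
case=> -[u v] _ <- /=.
rewrite /nu /mscale/= /pushforward.
have [a_lt0|a_gt0] : a < 0 \/ 0 < a by apply/orP; rewrite -neq_lt.
- rewrite [X in (_ * lebesgue_measure X)%E](_ : _ = `[(v - b) / a, (u - b) / a[%classic); last first.
    apply/seteqP; split => x /=; rewrite !in_itv/= ltr_ndivlMr// ler_ndivrMr// (mulrC x) ltrBlDr lerBrDr.
      by case/andP => -> ->.
    by case/andP => -> ->.
  rewrite !lebesgue_measure_itv/= !lte_fin ltr_nM2r ?invr_lt0// ltrD2r.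
  case: ifPn => _; rewrite ?mule0// -?EFinD -EFinM ltr0_norm//; congr EFin.
  by field.
- rewrite [X in (_ * lebesgue_measure X)%E](_ : _ = `](u - b) / a, (v - b) / a]%classic); last first.
    by apply/seteqP; split => x /=; rewrite !in_itv/= ltr_pdivrMr// ler_pdivlMr// (mulrC x) ltrBlDr lerBrDr.
  rewrite !lebesgue_measure_itv/= !lte_fin ltr_pM2r ?invr_gt0// ltrD2r.
  case: ifPn => _; rewrite ?mule0// -?EFinD -EFinM gtr0_norm//; congr EFin.
  by field.
Qed.

Lemma ge0_integral_lebesgue_affine (R : realType) (a b : R) (f : R -> \bar R) :
  a != 0 -> measurable_fun setT f -> (forall x, 0 <= f x)%E ->
  (\int[lebesgue_measure]_x f x =
   `|a|%:E * \int[lebesgue_measure]_x f (a * x + b)%R)%E.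
Proof.
move=> a0 mf f0.
have mphi : measurable_fun setT ((fun x => a * x + b) : measurableTypeR R -> measurableTypeR R).
  by apply: measurable_funD => //; exact: measurable_funM.
rewrite (eq_measure_integral (mscale (NngNum (normr_ge0 a)) (image_measure (@lebesgue_measure R) mphi))); last first.
  by move=> A mA _; exact: lebesgue_measure_affine.
rewrite ge0_integral_mscale//; congr (_ * _)%E.
by rewrite ge0_integral_pushforward.
Qed.

(** Change of variables yields the abstract Radon-Nikodym density, which equals [normal_pdf] almost
    everywhere because both have the same integral over every measurable set. *)
Lemma ge0_integral_normal_prob (R : realType) (m s : R) (f : R -> \bar R) :
  measurable_fun setT f -> (forall x, 0 <= f x)%E ->
  (\int[normal_prob m s]_x f x =
   \int[lebesgue_measure]_x (f x * (normal_pdf m s x)%:E))%E.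
Proof.
move=> mf f0; have dom := normal_prob_dominates m s.
rewrite -(@Radon_Nikodym_SigmaFinite.change_of_variables _ _ _ (normal_prob m s)
  lebesgue_measure dom f setT f0 measurableT mf).
have iRN : lebesgue_measure.-integrable setT
    (Radon_Nikodym_SigmaFinite.f (normal_prob m s) lebesgue_measure).
  exact: Radon_Nikodym_SigmaFinite.f_integrable.
have mpdf : measurable_fun setT (fun x : R => (normal_pdf m s x)%:E).
  by apply/measurable_EFinP; exact: measurable_normal_pdf.
apply: ge0_ae_eq_integral => //=.
- by apply: emeasurable_funM => //; exact: (measurable_int lebesgue_measure).
- exact: emeasurable_funM.
- by move=> x _; rewrite mule_ge0// Radon_Nikodym_SigmaFinite.f_ge0.
- by move=> x _; rewrite mule_ge0// lee_fin normal_pdf_ge0.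
suff H : ae_eq lebesgue_measure setT
    (Radon_Nikodym_SigmaFinite.f (normal_prob m s) lebesgue_measure)
    (fun x : R => (normal_pdf m s x)%:E) by move: H; apply: filterS => x /= + ? => ->.
apply: integral_ae_eq => // E _ mE.
by rewrite -Radon_Nikodym_SigmaFinite.f_integral.
Qed.

Lemma integrable_scale d (T : measurableType d) (R : realType)
    (mu : {measure set T -> \bar R}) (k : R) (f : T -> R) :
  mu.-integrable setT (EFin \o f) ->
  mu.-integrable setT (EFin \o (fun x => k * f x)).
Proof.
move=> intf; rewrite (_ : EFin \o _ = (fun x => k%:E * (EFin \o f) x)%E).
  exact: (integrableZl measurableT).
by apply/funext => x.
Qed.

Lemma integrable_add d (T : measurableType d) (R : realType)
    (mu : {measure set T -> \bar R}) (f g : T -> R) :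
  mu.-integrable setT (EFin \o f) -> mu.-integrable setT (EFin \o g) ->
  mu.-integrable setT (EFin \o (fun x => f x + g x)).
Proof.
move=> intf intg; rewrite (_ : EFin \o _ = (EFin \o f) \+ (EFin \o g))%E.
  exact: (integrableD measurableT).
by apply/funext => x.
Qed.

Lemma integrable_bigsum d (T : measurableType d) (R : realType)
    (mu : {measure set T -> \bar R}) (I : finType) (f : I -> T -> R) :
  (forall i, mu.-integrable setT (EFin \o f i)) ->
  mu.-integrable setT (EFin \o (fun x => \sum_i f i x)).
Proof.
move=> intf; rewrite (_ : EFin \o _ = fun x => (\sum_i (f i x)%:E)%E).
  by apply: integrable_sum => // i _; exact: intf.
by apply/funext => x; rewrite sumEFin.
Qed.

Lemma Rintegral_probability_cst d (T : measurableType d) (R : realType)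
    (P : probability T R) (r : R) : \int[P]_x r = r.
Proof. by rewrite /Rintegral integral_cst//= probability_setT mule1. Qed.

Lemma is_derive_differentiation_under_integral (R : realType)
    d (Y : measurableType d) (mu : {measure set Y -> \bar R})
    (f df : R -> Y -> R) (a : R) (G : Y -> R) :
  (forall x, mu.-integrable setT (EFin \o f x)) ->
  (forall (x : R) y, is_derive x (1 : R) (f^~ y : R -> R) (df x y)) ->
  (forall y, 0 <= G y) -> mu.-integrable setT (EFin \o G) ->
  (forall x y, x \in `]a - 1, a + 1[ -> `|df x y| <= G y) ->
  is_derive a (1 : R) (fun x : R => \int[mu]_y f x y) (\int[mu]_y df a y).
Proof.
move=> intf dfE G0 intG dfG.
have Ia : `]a - 1, a + 1[%classic a by rewrite /= in_itv/= ltrBlDr !ltrDl ltr01.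
have p x y : partial1of2 f x y = df x y.
  by rewrite partial1of2E; exact: derive_val.
have der x y : `]a - 1, a + 1[%classic x -> setT y -> derivable (f^~ y) x 1.
  by move=> _ _; exact: ex_derive.
have bd x y : `]a - 1, a + 1[%classic x -> setT y -> `|partial1of2 f x y| <= G y.
  by move=> xa _; rewrite p dfG.
have := @differentiation_under_integral _ _ _ mu f setT measurableT a _ _ Ia
  (fun x _ => intf x) der G G0 intG bd.
have := @derivable_under_integral _ _ _ mu f setT measurableT a _ _ Ia
  (fun x _ => intf x) der G G0 intG bd.
move=> h1 h2; apply: DeriveDef => //.
by rewrite -derive1E h2; apply: eq_Rintegral => y _; rewrite p.
Qed.

(** * One-dimensional normal laws *)

Section normal.
Context (R : realType).
Implicit Types (m s b t c : R).
Local Notation N01 := (@normal_prob R 0 1).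

Lemma normal_pdf_affine m s x : s != 0 ->
  `|s| * normal_pdf m s (s * x + m) = normal_pdf 0 1 x.
Proof.
move=> s0; rewrite !normal_pdfE ?oner_eq0// /normal_peak /normal_fun.
rewrite expr1n -mulrnAr (sqrtrM _ (sqr_ge0 s)) sqrtr_sqr mul1r invfM.
rewrite !mulrA divff ?normr_eq0// mul1r; congr (_ * expR _).
by rewrite addrK subr0; field.
Qed.

Lemma ge0_integral_normal_affine m s (f : R -> \bar R) : s != 0 ->
  measurable_fun setT f -> (forall x, 0 <= f x)%E ->
  (\int[normal_prob m s]_x f x = \int[N01]_x f (s * x + m)%R)%E.
Proof.
move=> s0 mf f0.
have maff : measurable_fun setT (fun x : R => s * x + m).
  by apply: measurable_funD => //; exact: measurable_funM.
rewrite (@ge0_integral_normal_prob _ _ _ _ mf f0).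
rewrite (ge0_integral_lebesgue_affine m s0); first last.
- by move=> x; rewrite mule_ge0// lee_fin normal_pdf_ge0.
- apply: emeasurable_funM => //; apply/measurable_EFinP.
  exact: measurable_normal_pdf.
rewrite -ge0_integralZl//; first last.
- by move=> x _; rewrite mule_ge0// lee_fin normal_pdf_ge0.
- apply: emeasurable_funM; first exact: (measurableT_comp mf).
  by apply/measurable_EFinP/measurableT_comp => //; exact: measurable_normal_pdf.
rewrite ge0_integral_normal_prob//; last exact: (measurableT_comp mf).
apply: eq_integral => x _.
by rewrite muleCA -EFinM normal_pdf_affine.
Qed.

Lemma normal_prob_affine m s (A : set R) : s != 0 -> measurable A ->
  normal_prob m s A = N01 ((fun x => s * x + m) @^-1` A).
Proof.
move=> s0 mA.
have maff : measurable_fun setT (fun x : R => s * x + m).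
  by apply: measurable_funD => //; exact: measurable_funM.
rewrite -[X in normal_prob m s X]setIT -integral_indic//.
rewrite ge0_integral_normal_affine//; last exact/measurable_EFinP.
rewrite -[X in N01 X]setIT -integral_indic//.
by rewrite -[X in measurable X]setTI; exact: maff.
Qed.

(** One-dimensional Cameron-Martin formula: [expR (b * x - b ^+ 2 / 2)] is the density of the normal
    law of mean [b] with respect to the standard one. *)
Lemma ge0_integral_normal_shift b (F : R -> \bar R) :
  measurable_fun setT F -> (forall x, 0 <= F x)%E ->
  (\int[N01]_x (F x * (expR (b * x - b ^+ 2 / 2))%:E) =
   \int[N01]_x F (x + b)%R)%E.
Proof.
move=> mF F0.
have mexp : measurable_fun setT (fun x : R => (expR (b * x - b ^+ 2 / 2))%:E).
  apply/measurable_EFinP/measurableT_comp => //.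
  by apply: measurable_funB => //; exact: measurable_funM.
transitivity (\int[normal_prob b 1]_x F x)%E; last first.
  rewrite (@ge0_integral_normal_affine b 1 F (oner_neq0 _) mF F0).
  by under eq_integral do rewrite mul1r.
have mFexp := emeasurable_funM mF mexp.
have Fexp0 x : (0 <= F x * (expR (b * x - b ^+ 2 / 2))%:E)%E.
  by rewrite mule_ge0// lee_fin expR_ge0.
rewrite (@ge0_integral_normal_prob _ _ _ _ mFexp Fexp0).
rewrite (@ge0_integral_normal_prob _ _ _ _ mF F0).
apply: eq_integral => x _; rewrite -muleA; congr (_ * _)%E.
rewrite -EFinM !normal_pdfE ?oner_eq0// /normal_fun mulrCA -expRD.
by congr ((_ * expR _)%:E); field.
Qed.

(** The density is positive, so multiplication by it commutes with taking positive and negative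
    parts. *)
Lemma integral_normal_shift b (F : R -> \bar R) : measurable_fun setT F ->
  (\int[N01]_x (F x * (expR (b * x - b ^+ 2 / 2))%:E) =
   \int[N01]_x F (x + b)%R)%E.
Proof.
move=> mF; rewrite integralE [RHS]integralE; congr (_ - _)%E.
- transitivity (\int[N01]_x F^\+ (x + b)%R)%E;
    last by apply: eq_integral => x _; rewrite !funeposE.
  rewrite -(ge0_integral_normal_shift b (measurable_funepos mF) (funepos_ge0 F)).
  by apply: eq_integral => x _; rewrite !funeposE maxe_pMl// ?mul0e// lee_fin expR_ge0.
- transitivity (\int[N01]_x F^\- (x + b)%R)%E;
    last by apply: eq_integral => x _; rewrite !funenegE.
  rewrite -(ge0_integral_normal_shift b (measurable_funeneg mF) (funeneg_ge0 F)).
  apply: eq_integral => x _; rewrite !funenegE -mulNe.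
  by rewrite maxe_pMl// ?mul0e// lee_fin expR_ge0.
Qed.

(** The shift identity for the constant [expR (b ^+ 2 / 2)], which cancels the normalization of the
    density. *)
Lemma integral_normal_expR b : (\int[N01]_x (expR (b * x))%:E = (expR (b ^+ 2 / 2))%:E)%E.
Proof.
have h := @ge0_integral_normal_shift b (cst (expR (b ^+ 2 / 2))%:E).
have : (\int[N01]_x cst (expR (b ^+ 2 / 2))%:E x = (expR (b ^+ 2 / 2))%:E)%E.
  by rewrite integral_cst//= probability_setT mule1.
move <-; rewrite -h//; last by move=> x; rewrite lee_fin expR_ge0.
by apply: eq_integral => x _; rewrite /= -EFinM -expRD addrC subrK.
Qed.

End normal.

Section normal_moments.
Context (R : realType).
Implicit Types (b t c x : R).
Local Notation N01 := (@normal_prob R 0 1).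

Lemma integrable_normal_expR c : N01.-integrable setT (fun x => (expR (c * x))%:E).
Proof.
apply/integrableP; split.
  by apply/measurable_EFinP/measurableT_comp => //; exact: measurable_funM.
under eq_integral do rewrite gee0_abs ?lee_fin ?expR_ge0//.
by rewrite integral_normal_expR ltry.
Qed.

Lemma integrable_normal_expR_abs c :
  N01.-integrable setT (fun x => (expR (c * `|x|))%:E).
Proof.
apply: (@le_integrable _ _ _ N01 setT measurableT _
  (fun x : R => (expR (c * x) + expR (- c * x))%:E)).
- apply/measurable_EFinP/measurableT_comp => //; apply: measurable_funM => //.
- move=> x _; rewrite /= lee_fin (ger0_norm (expR_ge0 _)) (@ger0_norm _ (_ + _)) ?addr_ge0 ?expR_ge0//.
  have [x0|x0] := leP 0 x.
    by rewrite ger0_norm// lerDl expR_ge0.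
  by rewrite ltr0_norm// mulrN mulNr lerDr expR_ge0.
- under eq_fun do rewrite EFinD.
  by apply: integrableD => //; exact: integrable_normal_expR.
Qed.

Lemma integrable_normal_growth (f : R -> R) c : measurable_fun setT f ->
  (forall x, `|f x| <= expR (c * `|x|)) -> N01.-integrable setT (EFin \o f).
Proof.
move=> mf fc.
apply: (@le_integrable _ _ _ N01 setT measurableT _ _ _ _ (integrable_normal_expR_abs c)).
  exact/measurable_EFinP.
by move=> x _; rewrite /= lee_fin (ger0_norm (expR_ge0 _)).
Qed.

Lemma ler_expR_abs x : `|x| <= expR `|x|.
Proof. by apply: le_trans (expR_ge1Dx _); rewrite lerDr. Qed.

Lemma Rintegral_normal_shift b (f : R -> R) : measurable_fun setT f ->
  \int[N01]_x (f x * expR (b * x - b ^+ 2 / 2)) = \int[N01]_x f (x + b).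
Proof.
move=> mf; rewrite /Rintegral; congr fine.
rewrite -(@integral_normal_shift _ b (EFin \o f))//; last exact/measurable_EFinP.
Qed.

(** Stein's identity without smoothness of [f]: the shift is moved from [f] to the density, whose
    derivative in [b] at 0 is x. The moments and the cosine transform below are obtained from it. *)
Lemma is_derive_normal_stein (f : R -> R) : measurable_fun setT f ->
  (forall x, `|f x| <= expR `|x|) ->
  is_derive (0 : R) (1 : R) (fun b : R => \int[N01]_x f (x + b)) (\int[N01]_x (x * f x)).
Proof.
move=> mf fe.
rewrite (_ : (fun b : R => _) =
  fun b => \int[N01]_x (f x * expR (b * x - b ^+ 2 / 2))); last first.
  by apply/funext => b; rewrite Rintegral_normal_shift.
rewrite (_ : \int[N01]_x (x * f x) =
  \int[N01]_x (f x * ((x - 0) * expR (0 * x - 0 ^+ 2 / 2)))); last first.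
  apply: eq_Rintegral => x _.
  by rewrite expr0n/= mul0r mul0r subrr subr0 expR0 mulr1 mulrC.
have expb b x : `|b| <= 1 -> expR (b * x - b ^+ 2 / 2) <= expR `|x|.
  move=> b1; rewrite ler_expR lerBlDr (le_trans (ler_norm _))// normrM.
  rewrite (@le_trans _ _ `|x|)//; first by rewrite ler_piMl.
  by rewrite lerDl divr_ge0// sqr_ge0.
(* Origin of the exponent 3: for b in the window, [f], the factor x - b and the exponential are each
   at most exp |x| in absolute value. *)
apply: (@is_derive_differentiation_under_integral _ _ _ N01
  (fun b x => f x * expR (b * x - b ^+ 2 / 2))
  (fun b x => f x * ((x - b) * expR (b * x - b ^+ 2 / 2))) 0
  (fun x => expR (3 * `|x|))).
- move=> b; apply: (@integrable_normal_growth _ (1 + `|b|)).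
    apply: measurable_funM => //; apply: measurableT_comp => //.
    by apply: measurable_funB => //; exact: measurable_funM.
  move=> x; rewrite normrM [leRHS](_ : _ = expR `|x| * expR (`|b| * `|x|)); last first.
    by rewrite -expRD mulrDl mul1r.
  rewrite ler_pM//.
  rewrite ger0_norm ?expR_ge0// ler_expR lerBlDr (le_trans (ler_norm _))//.
  by rewrite normrM lerDl divr_ge0// sqr_ge0.
- move=> b x; apply: is_derive_eq.
  by rewrite /GRing.scale/= ?mulr0 ?mulr1 ?add0r ?addr0 ?subr0; field.
- by move=> x; exact: expR_ge0.
- exact: integrable_normal_expR_abs.
- move=> b x; rewrite sub0r add0r in_itv/= => /andP[b0 b1].
  have b1' : `|b| <= 1 by rewrite ler_norml !ltW.
  rewrite [leRHS](_ : _ = expR `|x| * (expR `|x| * expR `|x|)); last first.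
    by rewrite -!expRD; congr expR; ring.
  rewrite normrM.
  rewrite ler_pM// normrM ler_pM//; last by rewrite ger0_norm ?expR_ge0 ?expb.
  rewrite (le_trans (ler_normB _ _))// addrC (le_trans _ (expR_ge1Dx _))//.
  by rewrite lerD2r.
Qed.

(** Stein's identity at the constant 1, whose shifts have a constant integral. *)
Lemma normal_mean0 : \int[N01]_x x = 0.
Proof.
have m1 : measurable_fun setT (cst 1 : R -> R) by [].
have := @is_derive_normal_stein (cst 1) m1.
case=> [x|_ h]; first by rewrite normr1 -[leLHS]expR0 ler_expR.
have <- : \int[N01]_x (x * cst 1 x) = \int[N01]_x x.
  by apply: eq_Rintegral => x _; rewrite mulr1.
by rewrite -h /= derive_cst.
Qed.

Lemma integrable_normal_id : N01.-integrable setT (EFin \o (fun x => x)).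
Proof.
apply: (@integrable_normal_growth _ 1) => // x.
by rewrite mul1r ler_expR_abs.
Qed.

(** Stein's identity at the identity function: its shifted integral is [b], of derivative 1. *)
Lemma normal_second_moment : \int[N01]_x (x ^+ 2) = 1.
Proof.
have mid : measurable_fun setT (fun x : R => x) by [].
have [_ h] := is_derive_normal_stein mid ler_expR_abs.
under eq_Rintegral do rewrite expr2.
rewrite -h (_ : (fun b : R => _) = cst 0 + (fun x => x)); last first.
  apply/funext => b; rewrite RintegralD//; last 2 first.
  - exact: integrable_normal_id.
  - exact: finite_measure_integrable_cst.
  by rewrite normal_mean0 Rintegral_probability_cst.
by rewrite deriveD// derive_cst derive_id add0r.
Qed.

(* The transform h(t) = E cos (t N + c) satisfies h' = - t h by Stein's identity. *)
Lemma normal_cos t c : \int[N01]_x cos (t * x + c) = cos c * expR (- (t ^+ 2 / 2)).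
Proof.
have mtc u : measurable_fun setT (fun x : R => u * x + c).
  by apply: measurable_funD => //; exact: measurable_funM.
have mcos u : measurable_fun setT (fun x : R => cos (u * x + c)).
  apply: measurableT_comp (mtc u); apply: continuous_measurable_fun.
  exact: continuous_cos.
have msin u : measurable_fun setT (fun x : R => sin (u * x + c)).
  apply: measurableT_comp (mtc u); apply: continuous_measurable_fun.
  exact: continuous_sin.
have icos u : N01.-integrable setT (EFin \o (fun x : R => cos (u * x + c))).
  exact: (bounded_measurable_integrable N01 (mcos u) (fun x => cos_max _)).
have isin u : N01.-integrable setT (EFin \o (fun x : R => sin (u * x + c))).
  exact: (bounded_measurable_integrable N01 (msin u) (fun x => sin_max _)).
pose h u := \int[N01]_x cos (u * x + c).
have stein u : \int[N01]_x (x * sin (u * x + c)) = u * h u.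
  have [|_ <-] := is_derive_normal_stein (msin u).
    by move=> x; rewrite (le_trans (sin_max _))// -[leLHS]expR0 ler_expR.
  (* The addition formula splits the shifted sine into a part of derivative [u * h u] at 0 and a
     part of derivative 0. *)
  rewrite (_ : (fun b : R => _) = (fun b => sin (u * b) * h u +
      cos (u * b) * \int[N01]_x sin (u * x + c))); last first.
    apply/funext => b; rewrite /h -!RintegralZl// -RintegralD//; last 2 first.
    - exact/integrable_scale/icos.
    - exact/integrable_scale/isin.
    by apply: eq_Rintegral => x _; rewrite mulrDr addrAC addrC sinD.
  rewrite derive_val /GRing.scale/= ?mulr0 ?mulr1 ?oppr0 cos0 sin0 ?mul0r ?mulr0 ?oppr0 ?add0r ?addr0 ?mulr1 ?mul1r; ring.
have dh u : is_derive u (1 : R) h (- (u * h u)).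
  rewrite -stein.
  rewrite (_ : - _ = \int[N01]_x (- (x * sin (u * x + c)))); last first.
    rewrite -mulN1r -RintegralZl//; first by under eq_Rintegral do rewrite mulN1r.
    apply: (@integrable_normal_growth _ 1); first exact: measurable_funM.
    move=> x; rewrite normrM mul1r -[leRHS]mulr1 ler_pM// ?sin_max//.
    exact: ler_expR_abs.
  apply: (@is_derive_differentiation_under_integral _ _ _ N01
    (fun u x => cos (u * x + c)) (fun u x => - (x * sin (u * x + c))) u
    (fun x => expR (1 * `|x|))) => //.
  - move=> v x; apply: is_derive_eq.
    by rewrite /GRing.scale/= ?mulr0; ring.
  - exact: integrable_normal_expR_abs.
  - move=> v x _; rewrite normrN normrM mul1r -[leRHS]mulr1 ler_pM// ?sin_max//.
    exact: ler_expR_abs.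
have : h t * expR (t ^+ 2 / 2) = h 0 * expR (0 ^+ 2 / 2).
  apply: (@is_derive_0_is_cst _ (fun u => h u * expR (u ^+ 2 / 2))) => u.
  apply: is_derive_eq.
  by rewrite /GRing.scale/= ?mulr0 ?addr0 ?add0r; field.
have -> : h 0 = cos c.
  rewrite /h; under eq_Rintegral do rewrite mul0r add0r.
  by rewrite Rintegral_probability_cst.
rewrite expr0n/= mul0r expR0 mulr1 => <-.
by rewrite -mulrA -expRD subrr expR0 mulr1.
Qed.

End normal_moments.

Lemma Rintegral_bounded_cvg d (T : measurableType d) (R : realType)
    (P : probability T R) (f_ : nat -> T -> R) (f : T -> R) (M : R) :
  (forall n, measurable_fun setT (f_ n)) -> (forall n x, `|f_ n x| <= M) ->
  (forall x, f_ ^~ x @ \oo --> f x) ->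
  (\int[P]_x f_ n x) @[n --> \oo] --> \int[P]_x f x.
Proof.
move=> mf_ f_M f_f.
have mf : measurable_fun setT f.
  by apply: (measurable_fun_cvg mf_) => x _; exact: f_f.
have fM x : `|f x| <= M.
  rewrite -(cvg_lim _ (cvg_norm (f_f x)))//; apply: limr_le; first by apply: is_cvg_norm; apply/cvg_ex; exists (f x).
  by apply: nearW => n; exact: f_M.
apply: fine_cvg; rewrite fineK; last first.
  by apply: integrable_fin_num => //; exact: bounded_measurable_integrable fM.
apply: (@dominated_cvg _ _ _ P _ measurableT (fun n x => (f_ n x)%:E) (EFin \o f)
  (cst M%:E)) => //.
- by move=> n; exact/measurable_EFinP.
- by move=> x _; apply: cvg_EFin; [exact: nearW|exact: f_f].
- exact: finite_measure_integrable_cst.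
- by move=> n x _; rewrite lee_fin f_M.
Qed.

Lemma EFin_Rintegral d (T : measurableType d) (R : realType)
    (mu : {measure set T -> \bar R}) (f : T -> R) :
  mu.-integrable setT (EFin \o f) ->
  (\int[mu]_x f x)%:E = (\int[mu]_x (f x)%:E)%E.
Proof. by move=> intf; rewrite fineK// integrable_fin_num. Qed.

Section fubini.
Context d d' (T : measurableType d) (T' : measurableType d') (R : realType).
Variables (m : {sigma_finite_measure set T -> \bar R})
  (m' : {sigma_finite_measure set T' -> \bar R}).

(* Every section has to be integrable, because [fine] gives the inner integral
   of a non-integrable section a junk value. *)
Lemma Rintegral_fubini (f : T -> T' -> R) :
  (m \x m')%E.-integrable setT (EFin \o (fun z => f z.1 z.2)) ->
  (forall x, m'.-integrable setT (EFin \o f x)) ->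
  (forall y, m.-integrable setT (EFin \o f^~ y)) ->
  \int[m]_x \int[m']_y f x y = \int[m']_y \int[m]_x f x y.
Proof.
move=> intf intx inty; rewrite /Rintegral; congr fine.
transitivity (\int[m]_x \int[m']_y (f x y)%:E)%E.
  by apply: eq_integral => x _; exact: EFin_Rintegral.
rewrite (Fubini (f := EFin \o (fun z => f z.1 z.2)))//.
by apply: eq_integral => y _; rewrite -EFin_Rintegral.
Qed.
End fubini.

Lemma bounded_measurable_integrable_prod d d' (T : measurableType d)
    (T' : measurableType d') (R : realType) (P : probability T R)
    (P' : probability T' R) (f : T * T' -> R) (M : R) :
  measurable_fun setT f -> (forall z, `|f z| <= M) ->
  (P \x P')%E.-integrable setT (EFin \o f).
Proof.
move=> mf fM; apply: measurable_bounded_integrable => //.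
  apply: (@le_lt_trans _ _ 1%E); last exact: ltry.
  exact: (@probability_le1 _ _ _ (P \x P')%E).
exists M; split; first exact: num_real.
by move=> u Mu z _ /=; exact: le_trans (fM _) (ltW Mu).
Qed.

Lemma Rintegral_fubini_bounded d d' (T : measurableType d)
    (T' : measurableType d') (R : realType) (P : probability T R)
    (P' : probability T' R) (f : T -> T' -> R) (M : R) :
  measurable_fun setT (fun z : T * T' => f z.1 z.2) ->
  (forall x y, `|f x y| <= M) ->
  \int[P]_x \int[P']_y f x y = \int[P']_y \int[P]_x f x y.
Proof.
move=> mf fM; apply: Rintegral_fubini.
- exact: (bounded_measurable_integrable_prod P P' mf (fun z => fM z.1 z.2)).
- move=> x; apply: (bounded_measurable_integrable P' (M := M)) => //.
  exact: (measurableT_comp mf (measurable_pair1 x)).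
- move=> y; apply: (bounded_measurable_integrable P (M := M)) => //.
  exact: (measurableT_comp mf (measurable_pair2 y)).
Qed.

(** * Finite-dimensional laws are determined by cosine transforms *)

Section normal_tail.
Context (R : realType).
Local Notation N01 := (@normal_prob R 0 1).

Lemma cvg_normal_tail (r_ : nat -> R) :
  ((r_ @ \oo --> +oo -> fine (N01 `]r_ n, +oo[) @[n --> \oo] --> (0 : R)) *
   (r_ @ \oo --> -oo -> fine (N01 `]r_ n, +oo[) @[n --> \oo] --> (1 : R)))%type.
Proof.
pose X : {RV N01 >-> R} := to_mfun
    (@measurable_id _ (measurableTypeR R) setT :
      measurable_fun setT (idfun : measurableTypeR R -> R)).
have XE r : ccdf X r = N01 `]r, +oo[ by [].
split=> rcvg; apply: fine_cvg.
- have := cvg_comp _ _ rcvg (cvg_ccdfy0 X).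
  by apply: cvg_trans; apply: near_eq_cvg; near=> n.
- have := cvg_comp _ _ rcvg (cvg_ccdfNy1 X).
  by apply: cvg_trans; apply: near_eq_cvg; near=> n.
Unshelve. all: by end_near. Qed.

(** The threshold is moved right by 1/(n+1), while the standard deviation is the smaller 1/(n+1)^2.
    In standard units the threshold is [r_ n], which tends to -oo for x < y and to +oo for y <= x;
    the shift decides the case y = x, so the limit is the indicator of the open half-line. *)
Lemma cvg_normal_prob_tail (x y : R) :
  fine (normal_prob y ((n.+1%:R)^-1 ^+ 2) `]x + (n.+1%:R)^-1, +oo[)
    @[n --> \oo] --> (\1_`]x, +oo[%classic y : R).
Proof.
pose r_ n : R := (x - y) * n.+1%:R ^+ 2 + n.+1%:R.
have n0 n : n.+1%:R != 0 :> R by rewrite pnatr_eq0.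
have tailE n : normal_prob y ((n.+1%:R)^-1 ^+ 2) `]x + (n.+1%:R)^-1, +oo[ =
    N01 `]r_ n, +oo[.
  rewrite normal_prob_affine ?expf_neq0 ?invr_eq0//; congr (N01 _).
  apply/funext => z; apply/propext; rewrite /= !in_itv/= !andbT /r_.
  rewrite -subr_gt0 -[in X in _ <-> X]subr_gt0.
  rewrite (_ : _ - _ = (n.+1%:R)^-1 ^+ 2 *
    (z - ((x - y) * n.+1%:R ^+ 2 + n.+1%:R))); last by field.
  by rewrite pmulr_rgt0// exprn_gt0// invr_gt0.
rewrite (_ : (fun n => fine _) = fun n => fine (N01 `]r_ n, +oo[)); last first.
  by apply/funext => n; rewrite tailE.
have cvgS : (n.+1%:R : R) @[n --> \oo] --> +oo.
  by rewrite (cvg_shiftS (fun n => n%:R : R)); exact: cvgr_idn.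
rewrite indicE; have [xy|yx] := ltP x y.
- rewrite mem_set/= ?in_itv/= ?andbT//.
  apply: (cvg_normal_tail r_).2; apply/cvgrNyPle => A.
  have yx0 : 0 < y - x by rewrite subr_gt0.
  near=> n.
  have h1 : - A <= n.+1%:R by near: n; move/cvgryPge : cvgS; exact.
  have h2 : 2 / (y - x) <= n.+1%:R by near: n; move/cvgryPge : cvgS; exact.
  move: h2; rewrite ler_pdivrMr// => h2.
  have h3 : 0 < n.+1%:R :> R by [].
  rewrite /r_; nra.
- rewrite memNset; last by rewrite /= in_itv/= andbT; apply/negP; rewrite -leNgt.
  apply: (cvg_normal_tail r_).1; apply/cvgryPge => A.
  near=> n.
  have h1 : A <= n.+1%:R by near: n; move/cvgryPge : cvgS; exact.
  apply: (le_trans h1); rewrite lerDr mulr_ge0 ?sqr_ge0// subr_ge0//.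
Unshelve. all: by end_near. Qed.
End normal_tail.

Section cos_transform.
Context (R : realType) d (T : measurableType d) (P : probability T R).
Variables Y Z : T -> R.
Hypotheses (mY : measurable_fun setT Y) (mZ : measurable_fun setT Z).
Hypothesis Z1 : forall w, `|Z w| <= 1.
Local Notation N01 := (@normal_prob R 0 1).

Let Phi s c := \int[P]_w (Z w * cos (s * Y w + c)).

(** By [normal_cos], averaging over a frequency s/e with s normal turns cos ((s/e) (Y - b)) into a
    Gaussian bump around [b]. Hence [Phi] determines the [Z]-weighted density of [Y] smoothed at
    scale [e]. *)
Let gauss_smoothing (b e : R) : e != 0 ->
  normal_peak e * \int[N01]_s Phi (s / e) (- (s / e * b)) =
  \int[P]_w (Z w * normal_pdf (Y w) e b).
Proof.
move=> e0.
have mcos : measurable_fun setT (cos : R -> R).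
  by apply: continuous_measurable_fun; exact: continuous_cos.
rewrite (@Rintegral_fubini_bounded _ _ _ _ _ N01 P
  (fun s w => Z w * cos (s / e * Y w + - (s / e * b))) 1); last 2 first.
- apply: measurable_funM; first exact: measurableT_comp.
  apply: measurableT_comp => //; apply: measurable_funD.
    by apply: measurable_funM; [exact: measurable_funM|exact: measurableT_comp].
  by apply: measurableT_comp => //; apply: measurable_funM => //; exact: measurable_funM.
- move=> s w; rewrite normrM -[leRHS]mul1r ler_pM//; exact: cos_max.
have mpdf : measurable_fun setT (fun w => normal_fun (Y w) e b).
  apply: measurableT_comp => //; apply: measurable_funM => //.
  apply: measurableT_comp => //; apply: measurable_funX.
  exact: measurable_funB.
have inner w : \int[N01]_s (Z w * cos (s / e * Y w + - (s / e * b))) =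
    Z w * normal_fun (Y w) e b.
  rewrite RintegralZl//; last first.
    apply: (bounded_measurable_integrable N01 _ (fun s => cos_max _)).
    apply: measurableT_comp => //; apply: measurable_funD => //.
      by apply: measurable_funM => //; exact: measurable_funM.
    by apply: measurableT_comp => //; apply: measurable_funM => //; exact: measurable_funM.
  congr (_ * _); transitivity (\int[N01]_s cos ((Y w - b) / e * s + 0)).
    by apply: eq_Rintegral => s _; congr cos; field.
  rewrite normal_cos cos0 mul1r /normal_fun; congr expR.
  by field.
under eq_Rintegral do rewrite inner.
rewrite -RintegralZl//.
  by apply: eq_Rintegral => w _; rewrite normal_pdfE//= mulrCA.
apply: (bounded_measurable_integrable P (M := 1)); first exact: measurable_funM.
move=> w; rewrite normrM -[leRHS]mul1r ler_pM// ger0_norm ?normal_fun_ge0//.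
rewrite -[leRHS]expR0 ler_expR mulNr oppr_le0 divr_ge0 ?sqr_ge0//.
by rewrite mulrn_wge0 ?sqr_ge0.
Qed.

Let normal_probE (y e : R) (A : set R) : measurable A ->
  normal_prob y e A = (\int[lebesgue_measure]_b (normal_pdf y e b * \1_A b)%:E)%E.
Proof.
move=> mA; rewrite /normal_prob integral_mkcond; apply: eq_integral => b _.
by rewrite patchE indicE; case: ifP; rewrite ?mulr1 ?mulr0.
Qed.

Let measurable_pdf_indic (e : R) (A : set R) : e != 0 -> measurable A ->
  measurable_fun setT (fun z : T * R => normal_pdf (Y z.1) e z.2 * \1_A z.2).
Proof.
move=> e0 mA; apply: measurable_funM; last first.
  apply: (@measurableT_comp _ _ _ _ _ _ (\1_A : R -> R) _ snd) => //.
under eq_fun do rewrite normal_pdfE//.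
apply: measurable_funM => //; apply: measurableT_comp => //.
apply: measurable_funM => //; apply: measurableT_comp => //.
apply: measurable_funX; apply: measurable_funB => //.
exact: measurableT_comp.
Qed.

(** By Fubini, the smoothed density integrates over the half-line to a normal tail centred at [Y].
    Integrability on the product holds since [Z] is bounded by 1 and each density has total mass
    1. *)
Let gauss_smoothed_tail (a e : R) : e != 0 ->
  \int[lebesgue_measure]_(b in `]a, +oo[) (\int[P]_w (Z w * normal_pdf (Y w) e b)) =
  \int[P]_w (Z w * fine (normal_prob (Y w) e `]a, +oo[)).
Proof.
move=> e0; set A := `]a, +oo[%classic.
have mA : measurable A by exact: measurable_itv.
have mf := measurable_pdf_indic e0 mA.
have pdf0 y b : 0 <= normal_pdf y e b * \1_A b by rewrite mulr_ge0// normal_pdf_ge0.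
have ipdf y : lebesgue_measure.-integrable setT
    (EFin \o (fun b => normal_pdf y e b * \1_A b)).
  apply: (@le_integrable _ _ _ lebesgue_measure setT measurableT _ _ _ _
    (integrable_normal_pdf y e)).
    apply/measurable_EFinP/measurable_funM; first exact: measurable_normal_pdf.
    exact: measurable_indic.
  move=> b _; rewrite /= lee_fin !ger0_norm ?normal_pdf_ge0//.
  by rewrite ler_piMr ?normal_pdf_ge0// indicE; case: (_ \in _).
pose f w b := Z w * (normal_pdf (Y w) e b * \1_A b).
have mF : measurable_fun setT (fun z : T * R => f z.1 z.2).
  by apply: measurable_funM => //; exact: measurableT_comp.
transitivity (\int[lebesgue_measure]_b \int[P]_w f w b).
  rewrite Rintegral_mkcond; apply: eq_Rintegral => b _.
  rewrite patchE /f indicE; case: ifP => _.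
    by under [RHS]eq_Rintegral do rewrite mulr1.
  under [RHS]eq_Rintegral do rewrite !mulr0.
  by rewrite Rintegral_probability_cst.
rewrite -[LHS](@Rintegral_fubini _ _ _ _ _ P lebesgue_measure f); last 3 first.
- apply/integrable12ltyP; first exact/measurable_EFinP.
  apply: (@le_lt_trans _ _ (\int[P]_w (cst 1 w))%E); last first.
    by rewrite integral_cst//= probability_setT mule1 ltry.
  apply: ge0_le_integral => //.
  - by move=> w _; exact: integral_ge0.
  - apply: (@measurable_fun_fubini_tonelli_F _ _ _ _ _ lebesgue_measure
      (fun z => `|(f z.1 z.2)%:E|)%E) => //.
    by apply: measurableT_comp => //; exact/measurable_EFinP.
  - move=> w _.
    rewrite -(integral_normal_pdf (Y w) e); apply: ge0_le_integral => //.
    + apply: measurableT_comp => //; apply/measurable_EFinP.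
      exact: (measurableT_comp mF (measurable_pair1 w)).
    + by apply/measurable_EFinP; exact: measurable_normal_pdf.
    + move=> b _; rewrite /= lee_fin normrM -[leRHS]mul1r ler_pM//.
      by rewrite ger0_norm// ler_piMr ?normal_pdf_ge0.
- move=> w; exact/integrable_scale/ipdf.
- move=> b; apply: (bounded_measurable_integrable P (M := normal_peak e)).
    apply: measurable_funM => //.
    exact: (measurableT_comp mf (measurable_pair2 b)).
  move=> w; rewrite normrM -[leRHS]mul1r ler_pM// ger0_norm//.
  by rewrite (le_trans _ (normal_pdf_ub (Y w) b e0))// ler_piMr ?normal_pdf_ge0.
apply: eq_Rintegral => w _; rewrite /f RintegralZl//.
by rewrite normal_probE.
Qed.

(** The left side involves [P] only through the [Z]-weighted transforms of [Y], so these determine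
    the integral of [Z] over the event that [Y] exceeds [x]. The weight [Z] prepares an induction
    over coordinates. *)
Lemma cvg_cos_transform_tail (x : R) :
  \int[lebesgue_measure]_(b in `]x + (n.+1%:R)^-1, +oo[)
     (normal_peak ((n.+1%:R)^-1 ^+ 2) *
      \int[N01]_s \int[P]_w (Z w *
        cos (s / (n.+1%:R)^-1 ^+ 2 * Y w + - (s / (n.+1%:R)^-1 ^+ 2 * b))))
    @[n --> \oo] --> \int[P]_w (Z w * \1_`]x, +oo[%classic (Y w)).
Proof.
have e0 n : (n.+1%:R)^-1 ^+ 2 != 0 :> R by rewrite expf_neq0// invr_eq0 pnatr_eq0.
rewrite (_ : (fun n : nat => _) = fun n => \int[P]_w (Z w *
    fine (normal_prob (Y w) ((n.+1%:R)^-1 ^+ 2) `]x + (n.+1%:R)^-1, +oo[))); last first.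
  apply/funext => n; rewrite -gauss_smoothed_tail//.
  by apply: eq_Rintegral => b _; rewrite gauss_smoothing.
apply: (@Rintegral_bounded_cvg _ _ _ _ _ _ 1).
- move=> n; apply: measurable_funM => //.
  apply: measurableT_comp => //.
  under eq_fun do rewrite normal_probE//.
  have mA : measurable (`]x + (n.+1%:R)^-1, +oo[%classic : set R) by exact: measurable_itv.
  have := measurable_pdf_indic (e0 n) mA => /measurable_EFinP /=.
  move/(@measurable_fun_fubini_tonelli_F _ _ _ _ _ lebesgue_measure); apply.
  by move=> z; rewrite lee_fin mulr_ge0// normal_pdf_ge0.
- move=> n w; rewrite normrM -[leRHS]mul1r ler_pM//.
  rewrite ger0_norm ?fine_ge0// -lee_fin fineK ?fin_num_measure//.
  exact: probability_le1.
- move=> w; apply: cvgM; first exact: cvg_cst.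
  exact: cvg_normal_prob_tail.
Qed.

End cos_transform.

Lemma measurable_eval (I : Type) (R : realType) (i : I) :
  measurable_fun setT (fun w : fun_space I R => w i).
Proof.
move=> _ B mB; apply: sub_sigma_algebra.
by exists i => //; exists B.
Qed.

Lemma measurable_to_fun_space (I : Type) (R : realType) d (T : measurableType d)
    (f : T -> fun_space I R) :
  (forall i, measurable_fun setT (fun x => f x i)) -> measurable_fun setT f.
Proof.
move=> mf; apply: measurability => // _ [_ [i _ [B mB <-]]] <-.
by rewrite setTI; exact: mf.
Qed.

Section fun_space_unique.
Context (R : realType) (r : nat).
Local Notation FS := (fun_space 'I_r R).

Let orthant (x : 'I_r -> R) : set FS := [set w | forall i, x i < w i].

Let orthants : set_system FS := range orthant.

Let orthantE x : orthant x = \bigcap_(i in [set: 'I_r]) ((fun w : FS => w i) @^-1` `]x i, +oo[).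
Proof.
by apply/seteqP; split => w /= h i; [move=> _; rewrite /= in_itv/= h|have := h i I; rewrite /= in_itv/= andbT].
Qed.

Lemma measurable_orthant x : measurable (orthant x).
Proof.
rewrite orthantE; apply: fin_bigcap_measurable => // i _.
rewrite -[X in measurable X]setTI.
by apply: measurable_eval => //; exact: measurable_itv.
Qed.

Lemma measurable_orthants : (measurable : set_system FS) `<=` <<s orthants >>.
Proof.
have mev i : measurable_fun setT (fun w : g_sigma_algebraType orthants => w i).
  move=> mT; apply: (measurability _ (RGenOInfty.measurableE R)) => // _ [_ [x ->]] <-.
  (* The half-space at coordinate [i] is exhausted by orthants whose other bounds go to -oo. *)
  rewrite setTI (_ : _ @^-1` _ =
      \bigcup_n orthant (fun j => if j == i then x else - n%:R)).
    apply: bigcupT_measurable => n; apply: sub_sigma_algebra.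
    by exists (fun j => if j == i then x else - n%:R).
  apply/seteqP; split => w /=; rewrite in_itv/= andbT.
    move=> xw; pose n := (\max_(j < r) (Num.truncn `|w j|).+1)%N.
    exists n => // j; case: eqP => [->//|_].
    rewrite ltrNl; apply: le_lt_trans (ler_norm _) _; rewrite normrN.
    apply: (lt_le_trans (truncnS_gt _)); rewrite ler_nat.
    exact: (leq_bigmax j).
  by move=> [n _] /(_ i); rewrite eqxx.
apply: smallest_sub; first exact: smallest_sigma_algebra.
move=> _ [i _ [B mB <-]].
exact: mev.
Qed.

(** Orthants generate the sigma-algebra and are stable under intersection, by taking the larger
    bounds. *)
Lemma fun_space_measure_unique (mu nu : probability FS R) :
  (forall x, mu [set w | forall i, x i < w i] = nu [set w | forall i, x i < w i]) ->
  forall A, measurable A -> mu A = nu A.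
Proof.
move=> munu A /measurable_orthants.
apply: (@g_sigma_algebra_measure_unique _ _ _ orthants _ (fun n => orthant (fun=> - n%:R))).
- by move=> _ [x _ <-]; exact: measurable_orthant.
- by move=> n; exists (fun=> - n%:R).
- apply/seteqP; split => // w _.
  pose n := (\max_(j < r) (Num.truncn `|w j|).+1)%N.
  exists n => // j.
  rewrite ltrNl; apply: le_lt_trans (ler_norm _) _; rewrite normrN.
  apply: (lt_le_trans (truncnS_gt _)); rewrite ler_nat.
  exact: (leq_bigmax j).
- move=> _ _ [x _ <-] [y _ <-]; exists (fun i => Num.max (x i) (y i)) => //.
  apply/seteqP; split => w /=.
    by move=> h; split => i; have := h i; rewrite gt_max => /andP[].
  by move=> [h1 h2] i; rewrite gt_max h1 h2.
- by move=> _ [x _ <-]; exact: munu.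
- by move=> n; rewrite ltey_eq fin_num_measure//; exact: measurable_orthant.
Qed.

Let lin (a : 'I_r -> R) (w : FS) := \sum_i a i * w i.

Let measurable_lin a : measurable_fun setT (lin a).
Proof.
by apply: measurable_sum => i; apply: measurable_funM => //; exact: measurable_eval.
Qed.

Let box (x : 'I_r -> R) (s : seq 'I_r) (w : FS) : R :=
  \prod_(i <- s) \1_`]x i, +oo[%classic (w i).

Let measurable_box x s : measurable_fun setT (box x s).
Proof.
apply: measurable_prod => i _.
apply: (@measurableT_comp _ _ _ _ _ _ (\1_`]x i, +oo[%classic : R -> R)) => //.
exact: measurable_eval.
Qed.

Let box_01 x s w : 0 <= box x s w <= 1.
Proof.
rewrite /box; elim/big_rec: _ => [|i y _ /andP[y0 y1]]; first by rewrite ler01 lexx.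
by rewrite indicE; case: (_ \in _); rewrite ?mul1r ?mul0r ?y0 ?y1 ?lexx ?ler01.
Qed.

(** The coordinates are treated one at a time: by induction on the list [s], cosines weighted by the
    indicator of the bounds on [s] have the same integral under both measures, for every [a] and
    [c]. The weight absorbs the coordinates already treated. *)
Lemma cos_transform_unique (mu nu : probability FS R) :
  (forall a c, \int[mu]_w cos (\sum_i a i * w i + c) =
               \int[nu]_w cos (\sum_i a i * w i + c)) ->
  forall A, measurable A -> mu A = nu A.
Proof.
move=> munu; apply: fun_space_measure_unique => x.
have mcos a c : measurable_fun setT (fun w => cos (lin a w + c)).
  apply: (measurableT_comp (continuous_measurable_fun (@continuous_cos R))).
  exact: measurable_funD.
have mbc s a c : measurable_fun setT (fun w => box x s w * cos (lin a w + c)).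
  exact: measurable_funM.
have bc1 s a c w : `|box x s w * cos (lin a w + c)| <= 1.
  have /andP[b0 b1] := box_01 x s w.
  by rewrite normrM -[leRHS]mul1r ler_pM ?cos_max// ger0_norm.
have key s : forall a c, \int[mu]_w (box x s w * cos (lin a w + c)) =
                         \int[nu]_w (box x s w * cos (lin a w + c)).
  elim: s => [|j s IH] a c.
    rewrite /box; under eq_Rintegral do rewrite big_nil mul1r.
    by rewrite munu; under [RHS]eq_Rintegral do rewrite big_nil mul1r.
  pose Z w := box x s w * cos (lin a w + c).
  (* Product-to-sum: the transform along coordinate [j] with weight [Z] is a mean of two
     box-weighted cosine integrals, with coefficient a_j + u and a_j - u, to which the induction
     hypothesis applies. *)
  have PhiE (P : probability FS R) u v :
      \int[P]_w (Z w * cos (u * w j + v)) = 2^-1 *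
      (\int[P]_w (box x s w * cos (lin (fun i => a i + u * (i == j)%:R) w + (c + v))) +
       \int[P]_w (box x s w * cos (lin (fun i => a i - u * (i == j)%:R) w + (c - v)))).
    rewrite -RintegralD//; last 2 first.
    - exact: (bounded_measurable_integrable P (mbc _ _ _) (bc1 _ _ _)).
    - exact: (bounded_measurable_integrable P (mbc _ _ _) (bc1 _ _ _)).
    rewrite -RintegralZl//; last first.
      apply: integrable_add.
      - exact: (bounded_measurable_integrable P (mbc _ _ _) (bc1 _ _ _)).
      - exact: (bounded_measurable_integrable P (mbc _ _ _) (bc1 _ _ _)).
    apply: eq_Rintegral => w _.
    have linD e : lin (fun i => a i + e * (i == j)%:R) w = lin a w + e * w j.
      rewrite /lin; under eq_bigr do rewrite mulrDl.
      rewrite big_split/=; congr (_ + _).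
      rewrite (bigD1 j)//= eqxx mulr1 big1 ?addr0// => i /negbTE ->.
      by rewrite mulr0 mul0r.
    rewrite linD (_ : lin (fun i => a i - _) w = lin a w - u * w j); last first.
      rewrite -mulNr -linD; apply: eq_bigr => i _; by rewrite mulNr.
    rewrite (_ : lin a w + u * w j + (c + v) = (lin a w + c) + (u * w j + v)); last by ring.
    rewrite (_ : lin a w - u * w j + (c - v) = (lin a w + c) - (u * w j + v)); last by ring.
    by rewrite (cosD (lin a w + c)) (cosB (lin a w + c)) /Z; field.
  have lhs (P : probability FS R) :
      \int[P]_w (box x (j :: s) w * cos (lin a w + c)) =
      \int[P]_w (Z w * \1_`]x j, +oo[%classic (w j)).
    by apply: eq_Rintegral => w _; rewrite {1}/box big_cons -/(box x s w) -mulrA mulrC.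
  rewrite !lhs.
  pose A (P : probability FS R) (n : nat) : R :=
    \int[lebesgue_measure]_(b in `](x j + n.+1%:R^-1), +oo[)
      (normal_peak (n.+1%:R^-1 ^+ 2) * \int[normal_prob 0 1]_u
        \int[P]_w (Z w * cos (u / n.+1%:R^-1 ^+ 2 * w j +
                             - (u / n.+1%:R^-1 ^+ 2 * b)))).
  have cA (P : probability FS R) :
      A P @ \oo --> \int[P]_w (Z w * \1_`]x j, +oo[%classic (w j)).
    exact: (@cvg_cos_transform_tail _ _ _ P _ _ (@measurable_eval _ R j)
      (mbc s a c) (bc1 s a c) (x j)).
  have Amunu : A mu = A nu.
    apply/funext => n; apply: eq_Rintegral => b _; congr (_ * _).
    by apply: eq_Rintegral => u _; rewrite !PhiE !IH.
  have cmu := cA mu; rewrite Amunu in cmu.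
  exact: cvg_unique cmu (cA nu).
have mO := measurable_orthant x.
(* With all coordinates boxed and the cosine trivialized by a = 0 and c = 0, the integral is the
   mass of the orthant. *)
have PO (P : probability FS R) :
    P (orthant x) = (\int[P]_w (box x (enum 'I_r) w * cos (lin (fun=> 0) w + 0)))%:E.
  rewrite EFin_Rintegral; last first.
    exact: (bounded_measurable_integrable P (mbc _ _ _) (bc1 _ _ _)).
  rewrite -[X in P X]setIT -integral_indic//; apply: eq_integral => w _.
  rewrite /lin; under [X in cos (X + _)]eq_bigr do rewrite mul0r.
  rewrite big1// addr0 cos0 mulr1 /box big_enum/= indicE; congr EFin.
  have [wx|wx] := boolP (w \in orthant x).
    rewrite big1// => i _; rewrite indicE mem_set//= in_itv/= andbT.
    by move: wx; rewrite inE; exact.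
  have [i nwx] : exists i, ~ x i < w i.
    by apply/existsNP; move: wx; rewrite notin_setE.
  rewrite (bigD1 i)//= indicE memNset ?mul0r//= in_itv/= andbT//.
by rewrite !PO key.
Qed.

End fun_space_unique.

Lemma eq_law_integral d d' d'' (T : measurableType d) (T' : measurableType d')
    (V : measurableType d'') (R : realType) (mu : {measure set T -> \bar R})
    (nu : {measure set T' -> \bar R}) (X : T -> V) (Y : T' -> V) :
  measurable_fun setT X -> measurable_fun setT Y ->
  (forall B, measurable B -> mu (X @^-1` B) = nu (Y @^-1` B)) ->
  forall f : V -> \bar R, measurable_fun setT f ->
  (\int[mu]_x f (X x) = \int[nu]_y f (Y y))%E.
Proof.
move=> mX mY XY f mf.
have ge0 (g : V -> \bar R) : measurable_fun setT g -> (forall x, 0 <= g x)%E ->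
    (\int[mu]_x g (X x) = \int[nu]_y g (Y y))%E.
  move=> mg g0.
  rewrite -(ge0_integral_pushforward mX mu (D := setT) (f := g))//.
  rewrite -(ge0_integral_pushforward mY nu (D := setT) (f := g))//.
  apply: (@eq_measure_integral _ V R setT (image_measure nu mY) (image_measure mu mX)).
  by move=> A mA _; exact: XY.
rewrite integralE [RHS]integralE; congr (_ - _)%E.
- have := ge0 _ (measurable_funepos mf) (funepos_ge0 f).
  under eq_integral do rewrite funeposE; under [RHS]eq_integral do rewrite funeposE.
  by move=> E; under eq_integral do rewrite funeposE;
    under [RHS]eq_integral do rewrite funeposE.
- have := ge0 _ (measurable_funeneg mf) (funeneg_ge0 f).
  under eq_integral do rewrite funenegE; under [RHS]eq_integral do rewrite funenegE.
  by move=> E; under eq_integral do rewrite funenegE;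
    under [RHS]eq_integral do rewrite funenegE.
Qed.

(** * Gaussian laws, Gaussian vectors and their cosine transforms *)

Section gaussian_law.
Context (R : realType).
Implicit Types (m s : R).
Local Notation N01 := (@normal_prob R 0 1).

Let measurable_aff m s : measurable_fun setT (fun x : R => s * x + m).
Proof. by apply: measurable_funD => //; exact: measurable_funM. Qed.

(** For s = 0 the affine map is constant, so the degenerate law fits the same formula and later
    arguments are free of the case distinction in [gaussian_law]. *)
Lemma gaussian_lawE m s B : measurable B ->
  gaussian_law m s B = N01 ((fun x => s * x + m) @^-1` B).
Proof.
move=> mB; rewrite /gaussian_law; case: eqVneq => [->|s0].
  under [in RHS]eq_fun do rewrite mul0r add0r.
  rewrite diracE; have [mB'|mB'] := boolP (m \in B).
    rewrite (_ : _ @^-1` _ = setT) ?probability_setT//.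
    by apply/seteqP; split => // x _ /=; rewrite inE in mB'.
  rewrite (_ : _ @^-1` _ = set0) ?measure0//.
  by apply/seteqP; split => // x /= mB2; rewrite notin_setE in mB'.
exact: normal_prob_affine.
Qed.

Lemma normal_affine_mean m s : (\int[N01]_x (s * x + m)%:E = m%:E)%E.
Proof.
rewrite -EFin_Rintegral; last first.
  apply: integrable_add; first exact/integrable_scale/integrable_normal_id.
  exact: finite_measure_integrable_cst.
rewrite RintegralD//; last 2 first.
- exact/integrable_scale/integrable_normal_id.
- exact: finite_measure_integrable_cst.
rewrite RintegralZl//; last exact: integrable_normal_id.
by rewrite normal_mean0 mulr0 add0r Rintegral_probability_cst.
Qed.

Lemma integrable_normal_sqr : N01.-integrable setT (EFin \o (fun x => x ^+ 2)).
Proof.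
apply: (@integrable_normal_growth _ _ 2) => // x.
rewrite normrX (_ : 2 * `|x| = `|x| + `|x|) ?expRD; last by ring.
by rewrite expr2 ler_pM// ler_expR_abs.
Qed.

Lemma normal_scale_second_moment s : (\int[N01]_x ((s * x + 0) ^+ 2)%:E = (s ^+ 2)%:E)%E.
Proof.
under eq_integral do rewrite addr0 exprMn.
rewrite -EFin_Rintegral; last exact/integrable_scale/integrable_normal_sqr.
by rewrite RintegralZl ?normal_second_moment ?mulr1//; exact: integrable_normal_sqr.
Qed.

End gaussian_law.

Section gaussian_vectors.
Context (R : realType) (r : nat).
Local Notation FS := (fun_space 'I_r R).
Local Notation N01 := (@normal_prob R 0 1).
Implicit Types (mu : probability FS R) (C : 'M[R]_r) (a : 'I_r -> R).

Definition quad_form C a : R := \sum_i \sum_j a i * a j * C i j.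

(** The phase [c] makes a real transform carry the whole characteristic function: c = 0 gives its
    real part and c = - pi/2 its imaginary part. *)
Definition gaussian_transform mu C := forall a c,
  \int[mu]_w cos (\sum_i a i * w i + c) = cos c * expR (- (quad_form C a / 2)).

Lemma measurable_linear_form (a : 'I_r -> R) :
  measurable_fun setT (fun w : FS => \sum_i a i * w i).
Proof.
by apply: measurable_sum => i; apply: measurable_funM => //; exact: measurable_eval.
Qed.

Let measurable_aff m s : measurable_fun setT (fun x : R => s * x + m).
Proof. by apply: measurable_funD => //; exact: measurable_funM. Qed.

Let law_gaussian mu (X : FS -> R) m s : measurable_fun setT X ->
  (forall B, measurable B -> mu [set w | B (X w)] = gaussian_law m s B) ->
  forall f : R -> \bar R, measurable_fun setT f ->
  (\int[mu]_w f (X w) = \int[N01]_x f (s * x + m)%R)%E.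
Proof.
move=> mX law.
have maff : measurable_fun (setT : set (measurableTypeR R))
  (fun x : measurableTypeR R => (s * x + m : R)) by exact: measurable_aff.
apply: (@eq_law_integral _ _ _ _ (measurableTypeR R) _ R mu N01 X _ mX maff) => B mB.
transitivity (gaussian_law m s B); [exact: law|exact: gaussian_lawE].
Qed.

(** The value of an integral does not by itself give integrability; the diagonal of the covariance
    makes the squares integrable, and these dominate coordinates and products. *)
Lemma normal_vector_moments mu C : normal_vector mu C ->
  [/\ forall i, mu.-integrable setT (EFin \o (fun w => w i)),
      forall i j, mu.-integrable setT (EFin \o (fun w => w i * w j)),
      forall a, (\int[mu]_w (\sum_i a i * w i)%:E = 0)%E &
      forall a, (\int[mu]_w ((\sum_i a i * w i) ^+ 2)%:E = (quad_form C a)%:E)%E].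
Proof.
move=> [gp zm cov].
have mev i := @measurable_eval 'I_r R i.
have isqr i : mu.-integrable setT (EFin \o (fun w => w i ^+ 2)).
  apply/integrableP; split.
    by apply/measurable_EFinP; exact: measurable_funX.
  rewrite (eq_integral (fun w : FS => (w i * w i)%:E)); last first.
    by move=> w _; rewrite /= ger0_norm ?sqr_ge0// expr2.
  by rewrite cov ltry.
have iev i : mu.-integrable setT (EFin \o (fun w => w i)).
  apply: (@le_integrable _ _ _ mu _ measurableT _
    (EFin \o (fun w => 1 + w i ^+ 2))).
  - exact/measurable_EFinP.
  - move=> w _; rewrite /= lee_fin [leRHS]ger0_norm ?addr_ge0 ?sqr_ge0//.
    rewrite ler_norml; apply/andP; split; nra.
  - by apply: integrable_add => //; exact: finite_measure_integrable_cst.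
have iprod i j : mu.-integrable setT (EFin \o (fun w => w i * w j)).
  apply: (@le_integrable _ _ _ mu _ measurableT _
    (EFin \o (fun w => w i ^+ 2 + w j ^+ 2))).
  - by apply/measurable_EFinP; exact: measurable_funM.
  - move=> w _; rewrite /= lee_fin [leRHS]ger0_norm ?addr_ge0 ?sqr_ge0//.
    rewrite ler_norml; apply/andP; split; nra.
  - exact: integrable_add.
split => // a.
- under eq_integral do rewrite -sumEFin.
  rewrite integral_sum//; last by move=> i; exact: (integrable_scale (a i) (iev i)).
  rewrite big1// => i _; under eq_integral do rewrite EFinM.
  by rewrite integralZl//; [rewrite zm mule0|exact: iev].
- have E w : (\sum_i a i * w i) ^+ 2 = \sum_i \sum_j (a i * a j * (w i * w j)).
    rewrite expr2 mulr_suml; apply: eq_bigr => i _; rewrite mulr_sumr.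
    by apply: eq_bigr => j _; ring.
  under eq_integral do rewrite E -sumEFin.
  rewrite integral_sum//; last first.
    move=> i; apply: integrable_bigsum => j.
    exact: (integrable_scale (a i * a j) (iprod i j)).
  rewrite /quad_form -sumEFin; apply: eq_bigr => i _.
  under eq_integral do rewrite -sumEFin.
  rewrite integral_sum//; last first.
    by move=> j; exact: (integrable_scale (a i * a j) (iprod i j)).
  rewrite -sumEFin; apply: eq_bigr => j _.
  under eq_integral do rewrite EFinM.
  by rewrite integralZl//; [rewrite cov|exact: iprod].
Qed.

(** A linear form follows some [gaussian_law m s]; its first two moments force m = 0 and s^2 =
    [quad_form C a], and [normal_cos] concludes. *)
Lemma normal_vector_transform mu C : normal_vector mu C -> gaussian_transform mu C.
Proof.
move=> nv a c; have [_ _ mean0 second] := normal_vector_moments nv.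
case: nv => gp _ _.
have [m [s law]] := gp r id a.
have mX := measurable_linear_form a.
have L := @law_gaussian mu _ m s mX law.
have m0 : m = 0.
  have := L EFin; rewrite mean0 normal_affine_mean => h.
  by have [] : 0%E = m%:E by apply: h; exact/measurable_EFinP.
have s2 : s ^+ 2 = quad_form C a.
  have := L (fun x => (x ^+ 2)%:E); rewrite second m0 normal_scale_second_moment => h.
  apply/esym; have [] // : (quad_form C a)%:E = (s ^+ 2)%:E.
  by apply: h; apply/measurable_EFinP; exact: measurable_funX.
rewrite -s2 -normal_cos /Rintegral; congr fine.
rewrite (L (fun x => (cos (x + c))%:E)).
  by apply: eq_integral => x _; rewrite m0 addr0.
apply/measurable_EFinP/(measurableT_comp (continuous_measurable_fun (@continuous_cos R))).
exact: measurable_funD.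
Qed.

Lemma gaussian_transform_unique mu nu C : gaussian_transform mu C ->
  gaussian_transform nu C -> forall A, measurable A -> mu A = nu A.
Proof.
by move=> gmu gnu; apply: cos_transform_unique => a c; rewrite gmu gnu.
Qed.

(** A cosine is at most 1, hence so is its mean [expR (- (quad_form C a / 2))]. *)
Lemma gaussian_transform_quad_ge0 mu C : gaussian_transform mu C ->
  forall a, 0 <= quad_form C a.
Proof.
move=> gmu a.
have : \int[mu]_w cos (\sum_i a i * w i + 0) <= \int[mu]_w 1.
  apply: le_Rintegral => //.
  - apply: (@bounded_measurable_integrable _ _ _ mu _ 1); last by move=> x; exact: cos_max.
    apply/(measurableT_comp (continuous_measurable_fun (@continuous_cos R))).
    by apply: measurable_funD => //; exact: measurable_linear_form.
  - exact: finite_measure_integrable_cst.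
rewrite gmu cos0 mul1r Rintegral_probability_cst -[leRHS]expR0 ler_expR oppr_le0.
by rewrite pmulr_lge0.
Qed.

(** One-dimensional case of [cos_transform_unique], with the real line presented as
    [fun_space 'I_1 R]: the linear form and a scaled standard normal have the same transform. *)
Lemma gaussian_transform_law mu C a : gaussian_transform mu C ->
  forall B, measurable B ->
  mu [set w | B (\sum_i a i * w i)] = gaussian_law 0 (Num.sqrt (quad_form C a)) B.
Proof.
move=> gmu B mB; rewrite gaussian_lawE//.
set s := Num.sqrt _; have s2 : s ^+ 2 = quad_form C a.
  by rewrite sqr_sqrtr// (gaussian_transform_quad_ge0 gmu).
have mX : measurable_fun setT (fun w : FS => (fun=> \sum_i a i * w i) : fun_space 'I_1 R).
  by apply: measurable_to_fun_space => i; exact: measurable_linear_form.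
have mY : measurable_fun (setT : set (measurableTypeR R))
    (fun x : measurableTypeR R => (fun=> s * x + 0) : fun_space 'I_1 R).
  by apply: measurable_to_fun_space => i; exact: measurable_aff.
have mB' : measurable [set w : fun_space 'I_1 R | B (w ord0)].
  by rewrite -[X in measurable X]setTI; exact: measurable_eval.
have := @cos_transform_unique R 1 (distribution mu (to_mfun mX))
  (distribution N01 (to_mfun mY)) _ _ mB'; apply => b c.
have mcos : measurable_fun setT (fun w : fun_space 'I_1 R =>
    (cos (\sum_i b i * w i + c))%:E).
  apply/measurable_EFinP.
  apply: (measurableT_comp (continuous_measurable_fun (@continuous_cos R))).
  apply: measurable_funD => //; apply: measurable_sum => i.
  by apply: measurable_funM => //; exact: measurable_eval.
have mcosX : measurable_fun setT (fun w : FS =>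
    cos (\sum_i (b ord0 * a i) * w i + c)).
  apply: (measurableT_comp (continuous_measurable_fun (@continuous_cos R))).
  by apply: measurable_funD => //; exact: measurable_linear_form.
have mcosY : measurable_fun setT (fun x : R => cos (b ord0 * s * x + c)).
  apply: (measurableT_comp (continuous_measurable_fun (@continuous_cos R))).
  exact: measurable_aff.
have EX w : \sum_i b i * (\sum_j a j * w j) = \sum_i (b ord0 * a i) * w i.
  by rewrite big_ord1 mulr_sumr; apply: eq_bigr => j _; rewrite mulrA.
have EY x : \sum_(i < 1) b i * (s * x + 0) = b ord0 * s * x.
  by rewrite big_ord1 addr0 mulrA.
transitivity (\int[mu]_w cos (\sum_i (b ord0 * a i) * w i + c)).
  rewrite /Rintegral; congr fine; rewrite integral_distribution//.
    by apply: eq_integral => w _; rewrite /= EX.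
  rewrite (_ : _ \o _ = EFin \o (fun w : FS => cos (\sum_i (b ord0 * a i) * w i + c))).
    exact: (bounded_measurable_integrable mu mcosX (fun x => cos_max _)).
  by apply/funext => w /=; rewrite EX.
transitivity (\int[N01]_x cos (b ord0 * s * x + c)); last first.
  rewrite /Rintegral; congr fine; rewrite integral_distribution//.
    by apply: eq_integral => w _; rewrite /= EY.
  rewrite (_ : _ \o _ = EFin \o (fun x : R => cos (b ord0 * s * x + c))).
    exact: (bounded_measurable_integrable N01 mcosY (fun x => cos_max _)).
  by apply/funext => w /=; rewrite EY.
transitivity (cos c * expR (- (quad_form C (fun i => b ord0 * a i) / 2))).
  exact: gmu.
transitivity (cos c * expR (- ((b ord0 * s) ^+ 2 / 2))); last by rewrite normal_cos.
suff -> : quad_form C (fun i => b ord0 * a i) = (b ord0 * s) ^+ 2 by [].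
rewrite exprMn s2 /quad_form mulr_sumr; apply: eq_bigr => i _.
rewrite mulr_sumr; apply: eq_bigr => j _.
have h (x y z u : R) : x * y * (x * z) * u = x ^+ 2 * (y * z * u) by ring.
exact: h.
Qed.

Lemma quad_formD C a b : (forall i j, C i j = C j i) ->
  quad_form C (fun i => a i + b i) =
  quad_form C a + quad_form C b + 2 * \sum_i \sum_j a i * b j * C i j.
Proof.
move=> symC.
have -> : 2 * (\sum_i \sum_j a i * b j * C i j) =
    \sum_i \sum_j a i * b j * C i j + \sum_i \sum_j b i * a j * C i j.
  rewrite mulrDl mul1r; congr (_ + _); rewrite [RHS]exchange_big/=.
  by apply: eq_bigr => i _; apply: eq_bigr => j _; rewrite symC; ring.
rewrite /quad_form -!big_split/=; apply: eq_bigr => i _.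
rewrite -!big_split/=; apply: eq_bigr => j _; ring.
Qed.

Lemma quad_form_delta C i : quad_form C (fun k => (k == i)%:R) = C i i.
Proof.
rewrite /quad_form (bigD1 i)//= [X in _ + X]big1 ?addr0; last first.
  by move=> k /negbTE ->; rewrite big1// => j _; rewrite mul0r mul0r.
rewrite (bigD1 i)//= big1 ?addr0 ?eqxx ?mul1r ?mul1r// => k /negbTE ->.
by rewrite mulr0 mul0r.
Qed.

Let sum_delta (w : FS) i : \sum_k (k == i)%:R * w k = w i.
Proof.
rewrite (bigD1 i)//= eqxx mul1r big1 ?addr0// => k /negbTE ->.
by rewrite mul0r.
Qed.

Lemma gaussian_transform_normal_vector mu C : (forall i j, C i j = C j i) ->
  gaussian_transform mu C -> normal_vector mu C.
Proof.
move=> symC gmu.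
have mean0 a : (\int[mu]_w (\sum_i a i * w i)%:E = 0)%E.
  have := law_gaussian (measurable_linear_form a) (gaussian_transform_law a gmu).
  move=> /(_ EFin) ->; last exact/measurable_EFinP.
  exact: normal_affine_mean.
have second a : (\int[mu]_w ((\sum_i a i * w i) ^+ 2)%:E = (quad_form C a)%:E)%E.
  have := law_gaussian (measurable_linear_form a) (gaussian_transform_law a gmu).
  move=> /(_ (fun x => (x ^+ 2)%:E)) ->.
    by rewrite normal_scale_second_moment sqr_sqrtr// (gaussian_transform_quad_ge0 gmu).
  by apply/measurable_EFinP; exact: measurable_funX.
split.
(* [t] may repeat an index, so the coefficients of equal coordinates are added up. *)
- move=> n t a; pose b k := \sum_(i | t i == k) a i.
  exists 0, (Num.sqrt (quad_form C b)) => B mB.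
  rewrite -(gaussian_transform_law b gmu mB); congr (mu _).
  apply/funext => w /=; congr (B _).
  rewrite (partition_big t predT)//=; apply: eq_bigr => k _.
  by rewrite /b mulr_suml; apply: eq_bigr => i /eqP ->.
- move=> i; rewrite -(mean0 (fun k => (k == i)%:R)).
  by apply: eq_integral => w _; rewrite sum_delta.
- have isq a : mu.-integrable setT (EFin \o (fun w : FS => (\sum_i a i * w i) ^+ 2)).
    apply/integrableP; split.
      by apply/measurable_EFinP; apply: measurable_funX; exact: measurable_linear_form.
    under eq_integral do rewrite /= ger0_norm ?sqr_ge0//.
    by rewrite second ltry.
  move=> j k.
  pose e i : 'I_r -> R := fun l => (l == i)%:R.
  (* Polarization: the mixed moment is read off the second moments of three linear forms. *)
  pose f := fun w : FS => 2^-1 * ((\sum_i (e j i + e k i) * w i) ^+ 2 +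
     ((- 1) * (\sum_i e j i * w i) ^+ 2 + (- 1) * (\sum_i e k i * w i) ^+ 2)).
  have Ef w : w j * w k = f w.
    rewrite /f /e !sum_delta; under eq_bigr do rewrite mulrDl.
    by rewrite big_split/= !sum_delta; field.
  under eq_integral do rewrite Ef.
  have i1 := isq (fun i => e j i + e k i).
  have i2 := integrable_scale (-1) (isq (e j)).
  have i3 := integrable_scale (-1) (isq (e k)).
  rewrite -EFin_Rintegral; last first.
    exact/integrable_scale/(integrable_add i1)/(integrable_add i2).
  congr EFin; rewrite RintegralZl//; last exact/(integrable_add i1)/(integrable_add i2).
  rewrite RintegralD//; last exact/(integrable_add i2).
  rewrite RintegralD// !RintegralZl//.
  rewrite /Rintegral !second /= quad_formD// !quad_form_delta.
  have -> : \sum_i \sum_l e j i * e k l * C i l = C j k.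
    rewrite (bigD1 j)//= [X in _ + X]big1 ?addr0; last first.
      by move=> i /negbTE ij; rewrite big1// => l _; rewrite /e ij !mul0r.
    rewrite (bigD1 k)//= big1 ?addr0; last first.
      by move=> l /negbTE lk; rewrite /e lk mulr0 mul0r.
    by rewrite /e !eqxx !mul1r.
  by field.
Qed.

End gaussian_vectors.

(** * Gaussian vectors by Cholesky factorization *)

Section standard_normals.
Context (R : realType).
Local Notation FS := (fun_space nat R).
Local Notation N01 := (@normal_prob R 0 1).

Definition update (n : nat) (z : FS * measurableTypeR R) : FS :=
  fun k => if k == n then z.2 else z.1 k.

Lemma measurable_update n : measurable_fun setT (update n).
Proof.
apply: measurable_to_fun_space => k; rewrite /update.
case: eqP => _; first exact: measurable_snd.
exact: (measurableT_comp (@measurable_eval _ R k) measurable_fst).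
Qed.

(** The first [n] coordinates are independent standard normals and the others are 0. Working on
    R^nat keeps a single type for all [n], so that inductions only fill in one more coordinate. *)
Fixpoint standard_normals (n : nat) : probability FS R :=
  if n is m.+1 then
    distribution (standard_normals m \x N01)%E (to_mfun (measurable_update m))
  else \d_((fun=> 0) : FS).

Lemma ge0_integral_standard_normalsS n (F : FS -> \bar R) :
  measurable_fun setT F -> (forall w, 0 <= F w)%E ->
  (\int[standard_normals n.+1]_w F w =
   \int[standard_normals n]_w \int[N01]_x F (update n (w, x)))%E.
Proof.
move=> mF F0; rewrite /= ge0_integral_distribution//.
have mFu : measurable_fun setT (F \o update n).
  exact: measurableT_comp (measurable_update n).
by rewrite (@fubini_tonelli1 _ _ _ _ _ (standard_normals n) N01 _ mFu (fun z => F0 _)).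
Qed.

Lemma Rintegral_standard_normalsS n (f : FS -> R) (M : R) :
  measurable_fun setT f -> (forall w, `|f w| <= M) ->
  \int[standard_normals n.+1]_w f w =
  \int[standard_normals n]_w \int[N01]_x f (update n (w, x)).
Proof.
move=> mf fM.
have mfu : measurable_fun setT (f \o update n).
  exact: measurableT_comp (measurable_update n).
have intf : (standard_normals n \x N01)%E.-integrable setT (EFin \o (f \o update n)).
  by apply: (bounded_measurable_integrable_prod _ _ (M := M) mfu) => z; exact: fM.
rewrite /Rintegral; congr fine.
rewrite [LHS](integral_distribution (X := to_mfun (measurable_update n)))//; last first.
  exact/measurable_EFinP.
rewrite -integral12_prod_meas1//; apply: eq_integral => w _.
apply/esym/EFin_Rintegral.
apply: (@bounded_measurable_integrable _ _ _ N01 _ M) => //.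
exact: (measurableT_comp mfu (measurable_pair1 w)).
Qed.

(** Integrating out the last coordinate, with the rest of the sum as phase, contributes one factor
    by [normal_cos]. *)
Lemma standard_normals_cos n (b : nat -> R) c :
  \int[standard_normals n]_w cos (\sum_(k < n) b k * w k + c) =
  cos c * expR (- ((\sum_(k < n) b k ^+ 2) / 2)).
Proof.
have mcos m u : measurable_fun setT (fun w : FS => cos (\sum_(k < m) b k * w k + u)).
  apply: (measurableT_comp (continuous_measurable_fun (@continuous_cos R))).
  apply: measurable_funD => //; apply: measurable_sum => k.
  by apply: measurable_funM => //; exact: measurable_eval.
elim: n c => [|n IH] c.
  under eq_Rintegral do rewrite big_ord0 add0r.
  by rewrite Rintegral_probability_cst big_ord0 mul0r oppr0 expR0 mulr1.
rewrite (@Rintegral_standard_normalsS _ _ 1)//; last by move=> w; exact: cos_max.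
transitivity (\int[standard_normals n]_w
    (expR (- (b n ^+ 2 / 2)) * cos (\sum_(k < n) b k * w k + c))).
  apply: eq_Rintegral => w _; rewrite mulrC -normal_cos.
  apply: eq_Rintegral => x _; rewrite big_ord_recr/= /update/= eqxx.
  rewrite (eq_bigr (fun k : 'I_n => b k * w k)); last first.
    by move=> k _; rewrite ltn_eqF.
  by rewrite addrAC addrC addrA.
rewrite RintegralZl//; last first.
  exact: (bounded_measurable_integrable _ (mcos n c) (fun x => cos_max _)).
rewrite IH big_ord_recr/= mulrCA -expRD; congr (_ * expR _); lra.
Qed.

Lemma standard_normals_shift n (b : nat -> R) (F : FS -> \bar R) :
  measurable_fun setT F -> (forall w, 0 <= F w)%E ->
  (\int[standard_normals n]_w
     (F w * (expR (\sum_(k < n) b k * w k - (\sum_(k < n) b k ^+ 2) / 2))%:E) =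
   \int[standard_normals n]_w F (fun k => w k + (if (k < n)%N then b k else 0))%R)%E.
Proof.
elim: n F => [|n IH] F mF F0.
  apply: eq_integral => w _; rewrite !big_ord0 mul0r subr0 expR0 mule1.
  by congr F; apply/funext => k; rewrite addr0.
have mexp m : measurable_fun setT (fun w : FS =>
    (expR (\sum_(k < m) b k * w k - (\sum_(k < m) b k ^+ 2) / 2))%:E).
  apply/measurable_EFinP/measurableT_comp => //; apply: measurable_funB => //.
  by apply: measurable_sum => k; apply: measurable_funM => //; exact: measurable_eval.
rewrite ge0_integral_standard_normalsS; first last.
- by move=> w; rewrite mule_ge0// lee_fin expR_ge0.
- exact: emeasurable_funM.
have mFu : measurable_fun setT (fun z : FS * R => F (update n (z.1, z.2 + b n))).
  apply: (measurableT_comp mF); apply: (measurableT_comp (measurable_update n)).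
  apply/measurable_fun_pairP; split; first exact: measurable_fst.
  by apply: measurable_funD => //; exact: measurable_snd.
have mshift m : measurable_fun setT (fun w : FS =>
    (fun k => w k + (if (k < m)%N then b k else 0) : R) : FS).
  apply: measurable_to_fun_space => k; apply: measurable_funD => //.
  exact: measurable_eval.
(* [G] integrates out the last coordinate after its own shift; the induction hypothesis then shifts
   the first [n]. *)
pose G w := (\int[N01]_x F (update n (w, (x + b n)%R)))%E.
have mG : measurable_fun setT G.
  exact: (@measurable_fun_fubini_tonelli_F _ _ _ _ _ N01
    (fun z : FS * R => F (update n (z.1, z.2 + b n)))).
have G0 w : (0 <= G w)%E by exact: integral_ge0.
rewrite (@ge0_integral_standard_normalsS n (fun w => F _)
  (measurableT_comp mF (mshift n.+1)) (fun w => F0 _)).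
transitivity (\int[standard_normals n]_w
  (G w * (expR (\sum_(k < n) b k * w k - (\sum_(k < n) b k ^+ 2) / 2))%:E))%E.
  apply: eq_integral => w _; rewrite /G.
  have mFw : measurable_fun setT (fun x : R => F (update n (w, x))).
    apply: (measurableT_comp mF); apply: (measurableT_comp (measurable_update n)).
    exact: measurable_pair1.
  rewrite -(ge0_integral_normal_shift (b n) mFw (fun x => F0 _)).
  rewrite -ge0_integralZr//; last 2 first.
  - apply: emeasurable_funM => //; apply/measurable_EFinP/measurableT_comp => //.
    by apply: measurable_funB => //; exact: measurable_funM.
  - by move=> x _; rewrite mule_ge0// lee_fin expR_ge0.
  apply: eq_integral => x _; rewrite -muleA -EFinM -expRD !big_ord_recr/=.
  rewrite (eq_bigr (fun k : 'I_n => b k * w k)); last first.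
    by move=> k _; rewrite /update/= ltn_eqF.
  rewrite /update/= eqxx; congr (_ * (expR _)%:E)%E; lra.
rewrite (IH G mG G0); apply: eq_integral => w _; apply: eq_integral => x _; congr F.
apply/funext => k; rewrite /update/=; case: eqP => [->|/eqP kn].
  by rewrite ltnSn.
by have -> : (k < n.+1)%N = (k < n)%N by rewrite ltnS leq_eqVlt (negbTE kn).
Qed.

End standard_normals.

Section cholesky.
Context (R : realType) (r : nat).
Implicit Types (C : 'M[R]_r) (a : 'I_r -> R).

(** The Schur complement of pivot [k], kept at full size: for a positive semidefinite matrix, row
    and column [k] become zero instead of being removed. A zero pivot leaves the matrix
    unchanged. *)
Definition schur (k : 'I_r) C : 'M[R]_r :=
  \matrix_(i, j) (C i j - C i k * C j k / C k k).

Definition schur_iter C (n : nat) : 'M[R]_r :=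
  iteri n (fun k D => if insub k is Some k' then schur k' D else D) C.

(* Column [k] of the Cholesky factor; if the pivot vanishes, so does the whole
   column of a positive semidefinite matrix, in accordance with [0^-1 = 0]. *)
Definition cholesky C (i : 'I_r) (k : nat) : R :=
  if insub k is Some k' then
    schur_iter C k i k' / Num.sqrt (schur_iter C k k' k') else 0.

Definition psd C := (forall i j, C i j = C j i) /\ (forall a, 0 <= quad_form C a).

Lemma psd_diag_ge0 C i : psd C -> 0 <= C i i.
Proof. by move=> [_ /(_ (fun k => (k == i)%:R))]; rewrite quad_form_delta. Qed.

Lemma quad_formZ C t a : quad_form C (fun i => t * a i) = t ^+ 2 * quad_form C a.
Proof.
rewrite /quad_form mulr_sumr; apply: eq_bigr => i _.
by rewrite mulr_sumr; apply: eq_bigr => j _; ring.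
Qed.

Lemma quad_form_add_delta C a t k : (forall i j, C i j = C j i) ->
  quad_form C (fun i => a i + t * (i == k)%:R) =
  quad_form C a + t ^+ 2 * C k k + 2 * t * \sum_i a i * C i k.
Proof.
move=> symC; rewrite quad_formD// quad_formZ quad_form_delta; congr (_ + _).
rewrite -mulrA; congr (_ * _); rewrite mulr_sumr; apply: eq_bigr => i _.
rewrite (bigD1 k)//= big1 ?addr0 ?eqxx.
  by rewrite mulr1 mulrCA mulrA.
by move=> j /negbTE ->; rewrite mulr0 mulr0 mul0r.
Qed.

Lemma psd_pivot0 C k : psd C -> C k k = 0 -> forall i, C i k = 0.
Proof.
move=> psdC Ckk i; have [symC C0] := psdC.
apply: contrapT => /eqP Cik.
(* Chosen so that the form at e_i + t e_k, which is C_ii + 2 t C_ik, equals -1. *)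
pose t := - (C i i + 1) / (2 * C i k).
have := C0 (fun j => (j == i)%:R + t * (j == k)%:R).
rewrite quad_form_add_delta// quad_form_delta Ckk mulr0 addr0.
rewrite (bigD1 i)//= big1 ?addr0 ?eqxx ?mul1r; last first.
  by move=> j /negbTE ->; rewrite mul0r.
rewrite (_ : 2 * t * C i k = - (C i i + 1)); last by rewrite /t; field.
lra.
Qed.

Lemma psd_schur C k : psd C -> psd (schur k C).
Proof.
move=> psdC; have [symC C0] := psdC; split => [i j|a].
  by rewrite !mxE symC mulrAC (mulrC (C j k)) mulrAC.
have E : quad_form (schur k C) a =
    quad_form C a - (\sum_i a i * C i k) ^+ 2 / C k k.
  rewrite /quad_form expr2 !mulr_suml -sumrB; apply: eq_bigr => i _.
  rewrite mulr_sumr mulr_suml -sumrB; apply: eq_bigr => j _.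
  by rewrite mxE; ring.
have [Ckk|Ckk] := eqVneq (C k k) 0.
  by rewrite E Ckk invr0 mulr0 subr0.
(* This [t] minimizes the form along coordinate [k], and the minimum is the form of the Schur
   complement. *)
pose t := - (\sum_i a i * C i k) / C k k.
have := C0 (fun j => a j + t * (j == k)%:R).
rewrite quad_form_add_delta// E; set s := \sum_i _.
by rewrite (_ : _ + _ + _ = quad_form C a - s ^+ 2 / C k k) // /t -/s; field.
Qed.

Lemma schur_row C k : psd C -> forall i, schur k C i k = 0.
Proof.
move=> psdC i; rewrite mxE; have [Ckk|Ckk] := eqVneq (C k k) 0.
  by rewrite (psd_pivot0 psdC Ckk i) mul0r mul0r subrr.
by rewrite mulfK// subrr.
Qed.

Lemma schur_iterS C n (nr : (n < r)%N) :
  schur_iter C n.+1 = schur (Ordinal nr) (schur_iter C n).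
Proof. by rewrite /schur_iter iteriS insubT. Qed.

Lemma psd_schur_iter C n : (n <= r)%N -> psd C -> psd (schur_iter C n) /\
  forall i k : 'I_r, (k < n)%N -> schur_iter C n i k = 0.
Proof.
move=> + psdC; elim: n => [|n IH] nr; first by split.
have [psdn zn] := IH (ltnW nr).
rewrite (schur_iterS C nr); split; first exact: psd_schur.
move=> i k; rewrite ltnS leq_eqVlt => /orP[/eqP kn|kn].
  by rewrite (_ : k = Ordinal nr) ?schur_row//; exact: val_inj.
rewrite mxE zn// sub0r.
have [symn _] := psdn.
by rewrite (symn k) (zn _ k kn) mulr0 mul0r oppr0.
Qed.

(** Invariant of the elimination: each step moves one rank-one term out of the remaining Schur
    complement, which is 0 after [r] steps. *)
Lemma cholesky_partial C n : (n <= r)%N -> psd C -> forall i j,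
  C i j = \sum_(k < n) cholesky C i k * cholesky C j k + schur_iter C n i j.
Proof.
move=> + psdC; elim: n => [|n IH] nr i j; first by rewrite big_ord0 add0r.
rewrite IH ?(ltnW nr)// (schur_iterS C nr) big_ord_recr -addrA; congr (_ + _) => /=.
have [psdn _] := psd_schur_iter (ltnW nr) psdC.
rewrite mxE /cholesky insubT.
have d0 := psd_diag_ge0 (Ordinal nr) psdn.
have h (x y z : R) : 0 <= z -> x / Num.sqrt z * (y / Num.sqrt z) = x * y / z.
  by move=> z0; rewrite mulrACA -invfM -expr2 sqr_sqrtr.
by rewrite h// addrC subrK.
Qed.

Lemma choleskyE C : psd C ->
  forall i j, C i j = \sum_(k < r) cholesky C i k * cholesky C j k.
Proof.
move=> psdC i j; rewrite {1}(cholesky_partial (leqnn r) psdC).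
by have [_ ->] := psd_schur_iter (leqnn r) psdC; rewrite ?addr0.
Qed.

End cholesky.

Lemma exp_tail_integral (R : realType) (a : R) :
  (\int[lebesgue_measure]_(z in `[a, +oo[) (expR (- z))%:E = (expR (- a))%:E)%E.
Proof.
rewrite (@ge0_continuous_FTC2y _ _ (fun z => - expR (- z)) a 0).
- by rewrite EFinN oppeK add0e.
- by move=> x _; exact: expR_ge0.
- apply: continuous_subspaceT => x.
  by apply: (@continuous_comp _ _ _ -%R); [exact: opp_continuous|exact: continuous_expR].
- rewrite -oppr0; apply: cvgN; apply: cvgr_expR.
- by move=> x _; exact: ex_derive.
- apply: cvg_at_right_filter; apply: cvgN.
  by apply: (@continuous_comp _ _ _ -%R); [exact: opp_continuous|exact: continuous_expR].
- move=> x _; rewrite derive1E derive_val /GRing.scale/=; ring.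
Qed.

(** * Maximum and minima over increasing tuples *)

Section increasing_tuples.
Context (R : realType) (m k : nat).
Implicit Types (q : {ffun 'I_k -> 'I_m.+1}) (J : {set 'I_m.+1}).

Let of_set J : {ffun 'I_k -> 'I_m.+1} := [ffun i : 'I_k => nth ord0 (enum J) i].

Let sorted_enum J : sorted ltn (map val (enum J)).
Proof.
rewrite {1}/enum_mem -enumT; apply: (subseq_sorted ltn_trans (map_subseq val (filter_subseq _ _))).
by rewrite val_enum_ord; exact: iota_ltn_sorted.
Qed.

Lemma strictly_increasing_inj q : strictly_increasing q -> injective q.
Proof.
move=> /forallP incq i j qij; apply: contrapT => /eqP ij.
wlog : i j qij ij / (i < j)%N.
  move=> h; have [ltij|ltij] := ltnP i j; first exact: (h i j).
  by apply: (h j i) => //; rewrite 1?eq_sym// ltn_neqAle eq_sym ij.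
by move=> ltij; have /forallP/(_ j)/implyP/(_ ltij) := incq i; rewrite qij ltnn.
Qed.

Let enum_imset q : strictly_increasing q ->
  enum (q @: 'I_k) = map q (enum 'I_k).
Proof.
move=> incq; apply: (inj_map val_inj).
apply: (irr_sorted_eq ltn_trans ltnn) => //.
  rewrite -map_comp; have : sorted ltn (map val (enum 'I_k)).
    by rewrite val_enum_ord; exact: iota_ltn_sorted.
  rewrite !sorted_map; apply: sub_sorted => i j /= ij.
  by have /forallP/(_ i)/forallP/(_ j)/implyP := incq; exact.
move=> n; apply/mapP/mapP => -[i iJ ->].
  by exists i => //; move: iJ; rewrite mem_enum => /imsetP[j _ ->]; apply: map_f; rewrite mem_enum.
exists i => //; rewrite mem_enum; move: iJ => /mapP[j _ ->].
by rewrite imset_f ?inE.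
Qed.

(** Increasing tuples correspond to sets of size [k]: a tuple is sent to its image, a set to its
    sorted enumeration [of_set]. *)
Lemma sum_strictly_increasing (G : {set 'I_m.+1} -> R) :
  \sum_(J : {set 'I_m.+1} | #|J| == k) G J =
  \sum_(q : {ffun 'I_k -> 'I_m.+1} | strictly_increasing q) G (q @: 'I_k).
Proof.
rewrite (reindex_onto (fun q => q @: 'I_k) of_set)/=; last first.
  move=> J /eqP Jk; apply/setP => j; apply/imsetP/idP => [[i _ ->]|jJ].
    by rewrite ffunE -(mem_enum J) mem_nth// -cardE Jk.
  have jk : (index j (enum J) < k)%N by rewrite -Jk cardE index_mem mem_enum.
  by exists (Ordinal jk) => //; rewrite /of_set ffunE nth_index// mem_enum.
apply: eq_bigl => q; apply/andP/idP => [[/eqP qk /eqP <-]|incq].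
  apply/forallP => i; apply/forallP => j; apply/implyP => ij.
  rewrite !ffunE; have := sorted_enum (q @: 'I_k).
  set s := enum _ => ss; have sk : size s = k by rewrite -cardE.
  rewrite -(nth_map ord0 0%N val) ?sk// -(nth_map ord0 0%N val) ?sk//.
  by apply: (sorted_ltn_nth ltn_trans 0%N ss) => //; rewrite inE size_map sk.
split.
  by rewrite card_imset ?card_ord//; exact: strictly_increasing_inj.
apply/eqP/ffunP => i; rewrite ffunE enum_imset//.
by rewrite (nth_map i) ?size_enum_ord// nth_ord_enum.
Qed.

End increasing_tuples.

Section max_min.
Context (R : realType) (m : nat).
Variable a : 'I_m -> R.
Hypothesis a0 : forall j, 0 <= a j.

(** A sign-reversing involution: if [j1] attains the maximum, adding or removing [j1] changes the
    parity of a subset but not its minimum, so the alternating sum over all subsets vanishes. The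
    empty set accounts for the maximum. *)
Lemma max_min_identity :
  \sum_(r < m) (-1) ^+ r *
    \sum_(q : {ffun 'I_r.+1 -> 'I_m} | strictly_increasing q)
      \big[Num.min/a (q ord_max)]_(i < r.+1) a (q i) =
  \big[Num.max/0]_(j < m) a j.
Proof.
case: m a a0 => [|n] b b0; first by rewrite !big_ord0.
set M := \big[Num.max/0]_(j < n.+1) b j.
have [j1 _ Mj1] := @eq_bigmax _ _ _ 0 ord0 xpredT b isT (fun i _ => b0 i).
rewrite -/M in Mj1.
have bM j : b j <= M by exact: le_bigmax.
(* Starting from [M] gives the empty set the value [M] and does not affect nonempty sets. *)
pose g (J : {set 'I_n.+1}) := \big[Num.min/M]_(j in J) b j.
pose toggle (J : {set 'I_n.+1}) := if j1 \in J then J :\ j1 else j1 |: J.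
have toggleK : involutive toggle.
  move=> J; rewrite /toggle; have [j1J|j1J] := boolP (j1 \in J).
    by rewrite !inE eqxx/= finset.setD1K.
  by rewrite !inE eqxx/= finset.setU1K.
have gU J : g (j1 |: J) = g J.
  apply: le_anti; apply/andP; split; apply/bigmin_geP; split.
  - by apply: bigmin_le_id.
  - by move=> j jJ; apply: bigmin_le_cond; rewrite inE jJ orbT.
  - by apply: bigmin_le_id.
  - move=> j; rewrite !inE => /orP[/eqP ->|jJ]; last exact: bigmin_le_cond.
    by rewrite -Mj1; exact: bigmin_le_id.
have sum0 : \sum_(J : {set 'I_n.+1}) (-1) ^+ #|J| * g J = 0.
  have : \sum_(J : {set 'I_n.+1}) (-1) ^+ #|J| * g J = - \sum_(J : {set 'I_n.+1}) (-1) ^+ #|J| * g J.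
    rewrite {1}(reindex_inj (inv_inj toggleK))/= -sumrN; apply: eq_bigr => J _.
    rewrite /toggle; have [j1J|j1J] := boolP (j1 \in J).
      by rewrite -{3 4}(finset.setD1K j1J) gU cardsU1 !inE eqxx/= exprS mulN1r mulNr opprK.
    by rewrite gU cardsU1 j1J exprS mulN1r mulNr.
  by move/eqP; rewrite -addr_eq0 -mulr2n mulrn_eq0/= => /eqP.
have g0 : g finset.set0 = M by rewrite /g finset.big_set0.
have : \sum_(J : {set 'I_n.+1} | J != finset.set0) (-1) ^+ #|J| * g J = - M.
  move: sum0; rewrite (bigD1 finset.set0)//= cards0 expr0 mul1r g0 => /eqP.
  by rewrite addrC addr_eq0 => /eqP.
move=> /(congr1 -%R); rewrite opprK => <-.
(* Nonempty subsets are grouped by their cardinality minus one, to match the index [r]. *)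
rewrite (partition_big (fun J : {set 'I_n.+1} => inord #|J|.-1 : 'I_n.+1) predT)//=.
rewrite -sumrN; apply: eq_bigr => r _.
rewrite (eq_bigl (fun J : {set 'I_n.+1} => #|J| == r.+1)); last first.
  move=> J; rewrite -cards_eq0; have := max_card (mem J); rewrite card_ord.
  case E : #|J| => [|c] cn //=.
  apply/eqP/eqP => [<-|[->]]; last exact: inord_val.
  by rewrite inordK.
rewrite (eq_bigr (fun J : {set 'I_n.+1} => (-1) ^+ r.+1 * g J)); last by move=> J /eqP ->.
rewrite -mulr_sumr exprS mulN1r mulNr opprK; congr (_ * _).
rewrite sum_strictly_increasing; apply: eq_bigr => q incq.
apply: le_anti; apply/andP; split; apply/bigmin_geP; split.
- by apply: le_trans (bM (q ord_max)); exact: bigmin_le_id.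
- by move=> _ /imsetP[i _ ->]; exact: bigmin_le_cond.
- by apply: bigmin_le_cond; exact: imset_f.
- by move=> i _; apply: bigmin_le_cond; exact: imset_f.
Qed.

End max_min.

(** * Existence and shifts of Gaussian vectors *)

Section gaussian_existence.
Context (R : realType) (r : nat).
Local Notation FS := (fun_space 'I_r R).
Local Notation FSN := (fun_space nat R).
Implicit Types (mu : probability FS R) (C : 'M[R]_r).

Definition cholesky_map C (n : FSN) : FS :=
  fun i => \sum_(k < r) cholesky C i k * n k.

Lemma measurable_cholesky_map C : measurable_fun setT (cholesky_map C).
Proof.
apply: measurable_to_fun_space => i; apply: measurable_sum => k.
by apply: measurable_funM => //; exact: measurable_eval.
Qed.

Definition gaussian_measure C : probability FS R :=
  distribution (standard_normals R r) (to_mfun (measurable_cholesky_map C)).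

Lemma gaussian_measure_transform C : psd C -> gaussian_transform (gaussian_measure C) C.
Proof.
move=> psdC a c.
pose b k := \sum_i a i * cholesky C i k.
have E n : \sum_i a i * cholesky_map C n i = \sum_(k < r) b k * n k.
  rewrite /cholesky_map /b; under eq_bigr do rewrite mulr_sumr.
  rewrite exchange_big/=; apply: eq_bigr => k _; rewrite mulr_suml.
  by apply: eq_bigr => i _; rewrite mulrA.
have mcos : measurable_fun setT (fun w : FS => cos (\sum_i a i * w i + c)).
  apply: (measurableT_comp (continuous_measurable_fun (@continuous_cos R))).
  by apply: measurable_funD => //; exact: measurable_linear_form.
transitivity (\int[standard_normals R r]_n cos (\sum_(k < r) b k * n k + c)).
  rewrite /Rintegral; congr fine; rewrite integral_distribution/=.
  - by apply: eq_integral => n _; rewrite /= E.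
  - exact/measurable_EFinP.
  - apply: (@bounded_measurable_integrable _ _ _ _ _ 1).
      exact: (measurableT_comp mcos (measurable_cholesky_map C)).
    by move=> n; exact: cos_max.
rewrite standard_normals_cos.
suff -> : \sum_(k < r) b k ^+ 2 = quad_form C a by [].
under eq_bigr => k _.
  rewrite expr2 mulr_suml; under eq_bigr do rewrite mulr_sumr.
  over.
rewrite exchange_big/=; apply: eq_bigr => i _.
rewrite exchange_big/=; apply: eq_bigr => j _.
rewrite (choleskyE psdC) mulr_sumr; apply: eq_bigr => k _.
by rewrite mulrACA.
Qed.

(** By uniqueness, any law with this transform is the explicit image of independent normals, so
    Gaussian integrals reduce to product ones. *)
Lemma ge0_integral_gaussian mu C (F : FS -> \bar R) :
  (forall i j, C i j = C j i) -> gaussian_transform mu C ->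
  measurable_fun setT F -> (forall w, 0 <= F w)%E ->
  (\int[mu]_w F w = \int[standard_normals R r]_n F (cholesky_map C n))%E.
Proof.
move=> symC gmu mF F0.
have psdC : psd C by split=> //; exact: gaussian_transform_quad_ge0 gmu.
rewrite (@eq_measure_integral _ _ R setT (gaussian_measure C) mu); last first.
  move=> A mA _.
  exact: (gaussian_transform_unique gmu (gaussian_measure_transform psdC)).
by rewrite ge0_integral_distribution.
Qed.

(** The independent normals are shifted by row [l] of the Cholesky factor: coordinate [i] moves by
    the inner product of rows [i] and [l], which is [C i l], and the density exponent becomes
    [w l - C l l / 2]. *)
Lemma gaussian_girsanov mu C (l : 'I_r) (F : FS -> \bar R) :
  (forall i j, C i j = C j i) -> gaussian_transform mu C ->
  measurable_fun setT F -> (forall w, 0 <= F w)%E ->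
  (\int[mu]_w (F w * (expR (w l - C l l / 2))%:E) =
   \int[mu]_w F (fun i => w i + C i l)%R)%E.
Proof.
move=> symC gmu mF F0.
have psdC : psd C by split=> //; exact: gaussian_transform_quad_ge0 gmu.
have mshift : measurable_fun setT (fun w : FS => (fun i => w i + C i l : R) : FS).
  apply: measurable_to_fun_space => i; apply: measurable_funD => //.
  exact: measurable_eval.
rewrite (ge0_integral_gaussian symC gmu); first last.
- by move=> w; rewrite mule_ge0// lee_fin expR_ge0.
- apply: emeasurable_funM => //; apply/measurable_EFinP/measurableT_comp => //.
  by apply: measurable_funB => //; exact: measurable_eval.
rewrite (ge0_integral_gaussian (F := fun w => F (fun i => w i + C i l)%R) symC gmu)//;
  last exact: (measurableT_comp mF mshift).
have mFc : measurable_fun setT (F \o cholesky_map C).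
  exact: (measurableT_comp mF (measurable_cholesky_map C)).
transitivity (\int[standard_normals R r]_n ((F \o cholesky_map C) n *
  (expR (\sum_(k < r) cholesky C l k * n k -
    (\sum_(k < r) cholesky C l k ^+ 2) / 2))%:E))%E.
  apply: eq_integral => n _; rewrite /= (choleskyE psdC).
  by rewrite (eq_bigr (fun k : 'I_r => cholesky C l k ^+ 2)).
rewrite (standard_normals_shift r (cholesky C l) mFc (fun n => F0 _)).
apply: eq_integral => n _; rewrite /=; congr F; apply/funext => i.
rewrite /cholesky_map (choleskyE psdC) -big_split/=; apply: eq_bigr => k _.
by rewrite ltn_ord mulrDr.
Qed.

End gaussian_existence.

Lemma gaussian_transform_linear (R : realType) (r s : nat)
    (mu : probability (fun_space 'I_r R) R) (C : 'M[R]_r) (B : 'I_s -> 'I_r -> R)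
    (mB : measurable_fun setT
      (fun w : fun_space 'I_r R => (fun i => \sum_j B i j * w j) : fun_space 'I_s R)) :
  gaussian_transform mu C ->
  gaussian_transform (distribution mu (to_mfun mB))
    (\matrix_(i, j) \sum_k \sum_l B i k * B j l * C k l).
Proof.
move=> gmu a c.
pose b k := \sum_i a i * B i k.
have E (w : 'I_r -> R) : \sum_i a i * (\sum_j B i j * w j) = \sum_k b k * w k.
  under eq_bigr do rewrite mulr_sumr.
  rewrite exchange_big/=; apply: eq_bigr => k _; rewrite /b mulr_suml.
  by apply: eq_bigr => i _; rewrite mulrA.
have mcos : measurable_fun setT (fun w : fun_space 'I_s R => cos (\sum_i a i * w i + c)).
  apply: (measurableT_comp (continuous_measurable_fun (@continuous_cos R))).
  by apply: measurable_funD => //; exact: measurable_linear_form.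
transitivity (\int[mu]_w cos (\sum_k b k * w k + c)).
  rewrite /Rintegral; congr fine; rewrite integral_distribution/=.
  - by apply: eq_integral => n _; rewrite /= E.
  - exact/measurable_EFinP.
  - apply: (@bounded_measurable_integrable _ _ _ _ _ 1).
      exact: (measurableT_comp mcos mB).
    by move=> n; exact: cos_max.
rewrite gmu.
suff -> : quad_form C b =
  quad_form (\matrix_(i, j) \sum_k \sum_l B i k * B j l * C k l) a by [].
rewrite /quad_form /b.
transitivity (\sum_k \sum_l \sum_i \sum_j a i * B i k * (a j * B j l) * C k l).
  apply: eq_bigr => k _; apply: eq_bigr => l _; rewrite !mulr_suml.
  by apply: eq_bigr => i _; rewrite mulr_sumr mulr_suml.
under eq_bigr do rewrite exchange_big/=.
rewrite exchange_big/=; apply: eq_bigr => i _.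
under eq_bigr do rewrite exchange_big/=.
rewrite exchange_big/=; apply: eq_bigr => j _.
rewrite mxE mulr_sumr; apply: eq_bigr => k _.
by rewrite mulr_sumr; apply: eq_bigr => l _; ring.
Qed.

(** * The Huesler-Reiss exponent is an expected maximum *)

(** The domain lies between the open and the closed half-line starting at the maximum, and these
    have equal integrals. *)
Lemma exp_tail_integral_inter (R : realType) (r : nat) (c : R) (b : 'I_r -> R) :
  (\int[lebesgue_measure]_(z in [set z : R | (c <= z)%R /\ forall i, (b i < z)%R]) (expR (- z))%:E =
   (expR (- \big[Num.max/c]_(i < r) b i))%:E)%E.
Proof.
set B := \big[Num.max/c]_(i < r) b i; set D := (X in integral _ X).
have mexp (A : set R) : measurable_fun A (fun z : R => (expR (- z))%:E).
  by apply: measurable_funTS; apply/measurable_EFinP/measurableT_comp.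
have DE : D = `[c, +oo[ `&` \bigcap_(i in [set: 'I_r]) `]b i, +oo[%classic.
  apply/seteqP; split => z /=.
    by move=> [cz bz]; split; [|move=> i _]; rewrite /= in_itv/= andbT.
  move=> [+ bz]; rewrite in_itv/= andbT => cz; split => // i.
  by have := bz i I; rewrite /= in_itv/= andbT.
have mD : measurable (D : set R).
  rewrite DE; apply: measurableI; first exact: measurable_itv.
  by apply: fin_bigcap_measurable => // i _; exact: measurable_itv.
have e0 (A : set R) z : A z -> (0 <= (expR (- z))%:E)%E by rewrite lee_fin expR_ge0.
apply: le_anti; apply/andP; split.
- rewrite -exp_tail_integral; apply: ge0_subset_integral => //.
    exact: mexp.
  move=> z [cz bz]; rewrite /= in_itv/= andbT; apply/bigmax_leP; split => // i _.
  exact/ltW/bz.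
- rewrite -exp_tail_integral -integral_itv_obnd_cbnd//.
  apply: ge0_subset_integral => //.
    exact: mexp.
  move=> z; rewrite /= in_itv/= andbT => Bz; split.
    by rewrite ltW//; apply: le_lt_trans Bz; exact: bigmax_ge_id.
  by move=> i; apply: le_lt_trans Bz; exact: le_bigmax.
Qed.

(** The choice made by [xget] is forced: all normal vectors with covariance [Psi] give the orthant
    the same mass. *)
Lemma normal_survivalE (R : realType) (r : nat) (nu : probability (fun_space 'I_r R) R)
    (Psi : 'M[R]_r) (y : 'I_r -> R) : normal_vector nu Psi ->
  (normal_survival y Psi)%:E = nu [set w | forall i, y i < w i].
Proof.
move=> nuPsi; rewrite -[RHS]fineK ?fin_num_measure//; last exact: measurable_orthant.
congr EFin; apply: xget_unique.
  exists nu; split=> //; rewrite fineK// fin_num_measure//; exact: measurable_orthant.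
move=> p [mu [muPsi pE]].
have := gaussian_transform_unique (normal_vector_transform muPsi)
  (normal_vector_transform nuPsi) (measurable_orthant y).
by move=> <-; rewrite -pE.
Qed.

Lemma sum_delta_diff (R : realType) (I : finType) (f : I -> R) (a b : I) :
  \sum_k ((k == a)%:R - (k == b)%:R) * f k = f a - f b.
Proof.
have D c : \sum_k (k == c)%:R * f k = f c.
  rewrite (bigD1 c)//= eqxx mul1r big1 ?addr0// => k /negbTE ->.
  by rewrite mul0r.
under eq_bigr do rewrite mulrBl.
by rewrite sumrB !D.
Qed.

Lemma measurable_bigmaxr (R : realType) d (T : measurableType d) (n : nat) (c : R)
    (f : 'I_n -> T -> R) :
  (forall i, measurable_fun setT (f i)) ->
  measurable_fun setT (fun t => \big[Num.max/c]_(i < n) f i t).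
Proof.
move=> mf; elim: n f mf => [|n IH] f mf.
  by rewrite (_ : (fun _ => _) = cst c)//; apply/funext => t; rewrite big_ord0.
rewrite (_ : (fun _ => _) = (fun t =>
    Num.max (f ord0 t) (\big[Num.max/c]_(i < n) f (lift ord0 i) t))); last first.
  by apply/funext => t; rewrite big_ord_recl.
by apply: measurable_maxr => //; exact: IH.
Qed.

Lemma measurable_bigminr (R : realType) d (T : measurableType d) (n : nat)
    (g : T -> R) (f : 'I_n -> T -> R) :
  measurable_fun setT g -> (forall i, measurable_fun setT (f i)) ->
  measurable_fun setT (fun t => \big[Num.min/g t]_(i < n) f i t).
Proof.
move=> mg mf; elim: n f mf => [|n IH] f mf.
  by rewrite (_ : (fun _ => _) = g)//; apply/funext => t; rewrite big_ord0.
rewrite (_ : (fun _ => _) = (fun t =>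
    Num.min (f ord0 t) (\big[Num.min/g t]_(i < n) f (lift ord0 i) t))); last first.
  by apply/funext => t; rewrite big_ord_recl.
by apply: measurable_minr => //; exact: IH.
Qed.

Lemma Rintegral_bigsum d (T : measurableType d) (R : realType)
    (mu : {measure set T -> \bar R}) (I : Type) (s : seq I) (Q : pred I)
    (f : I -> T -> R) :
  (forall i, mu.-integrable setT (EFin \o f i)) ->
  mu.-integrable setT (EFin \o (fun x => \sum_(i <- s | Q i) f i x)) /\
  \int[mu]_x (\sum_(i <- s | Q i) f i x) = \sum_(i <- s | Q i) \int[mu]_x f i x.
Proof.
move=> intf; elim: s => [|i s [IH1 IH2]].
  under eq_fun do rewrite big_nil.
  by rewrite big_nil /Rintegral integral0; split => //; exact: integrable0.
under eq_fun do rewrite big_cons.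
rewrite big_cons; case: ifP => _ //; split; first exact: integrable_add.
by rewrite RintegralD// IH2.
Qed.

Section husler_reiss_gaussian.
Context (R : realType) (m : nat).
Local Notation FS := (fun_space 'I_m R).
Variables (mu : probability FS R) (C L : 'M[R]_m) (x : 'I_m -> R).
Hypotheses (symC : forall i j, C i j = C j i) (gmu : gaussian_transform mu C).
Hypothesis LC : forall i j, L i j ^+ 2 = (C i i + C j j - 2 * C i j) / 4.

(** The drift normalizes the exponential of the Gaussian coordinate to mean 1, before the factor
    [expR (- x j)]. *)
Definition drifted_exp (w : FS) (j : 'I_m) : R := expR (w j - C j j / 2 - x j).

Lemma measurable_drifted_exp j : measurable_fun setT (fun w => drifted_exp w j).
Proof.
apply: measurableT_comp => //; apply: measurable_funB => //.
by apply: measurable_funB => //; exact: measurable_eval.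
Qed.

Lemma integral_drifted_exp j : (\int[mu]_w (drifted_exp w j)%:E = (expR (- x j))%:E)%E.
Proof.
have := @gaussian_girsanov _ _ mu C j (fun=> (expR (- x j))%:E) symC gmu.
have -> : (\int[mu]__ (expR (- x j))%:E = (expR (- x j))%:E)%E.
  by rewrite integral_cst// [X in (_ * X)%E]probability_setT mule1.
move=> <-//.
  by apply: eq_integral => w _; rewrite /= -EFinM -expRD addrC.
Qed.

Lemma integrable_drifted_exp j : mu.-integrable setT (EFin \o (fun w => drifted_exp w j)).
Proof.
apply/integrableP; split.
  by apply/measurable_EFinP; exact: measurable_drifted_exp.
under eq_integral do rewrite /= ger0_norm ?expR_ge0//.
by rewrite integral_drifted_exp ltry.
Qed.

Section tuple.
Variables (r : nat) (q : 'I_r.+1 -> 'I_m).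
Let l := q ord_max.
Let qi (i : 'I_r) := q (lift ord_max i).
(** The survival condition in [HR_h] at level z reads [b i w < z] for all [i]; together with
    [x l <= z] it leaves, up to an endpoint, the half-line from [beta w]. *)
Let b (i : 'I_r) (w : FS) : R := x (qi i) + 2 * L (qi i) l ^+ 2 - (w (qi i) - w l).
Let beta (w : FS) : R := \big[Num.max/x l]_(i < r) b i w.

Let measurable_b i : measurable_fun setT (b i).
Proof.
apply: measurable_funB => //.
by apply: measurable_funB; exact: measurable_eval.
Qed.

Let measurable_beta : measurable_fun setT beta.
Proof. exact: measurable_bigmaxr. Qed.

Let diff (w : FS) : fun_space 'I_r R :=
  fun i => \sum_j ((j == qi i)%:R - (j == l)%:R) * w j.

Let measurable_diff : measurable_fun setT diff.
Proof.
apply: measurable_to_fun_space => i; apply: measurable_sum => j.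
by apply: measurable_funM => //; exact: measurable_eval.
Qed.

Let nu : probability (fun_space 'I_r R) R := distribution mu (to_mfun measurable_diff).

(** Under [LC], 4 L^2 is the variance of a difference of coordinates, and [HR_Gamma] is by
    polarization the covariance of the differences [w (qi i) - w l]. *)
Let normal_nu : normal_vector nu (HR_Gamma q L).
Proof.
have GE : HR_Gamma q L = \matrix_(i, j) \sum_k \sum_k'
    ((k == qi i)%:R - (k == l)%:R) * ((k' == qi j)%:R - (k' == l)%:R) * C k k'.
  apply/matrixP => i j; rewrite !mxE.
  under [RHS]eq_bigr do under eq_bigr do rewrite -mulrA.
  under [RHS]eq_bigr do rewrite -mulr_sumr sum_delta_diff.
  rewrite sum_delta_diff -/(qi i) -/(qi j) -/l !LC (symC l (qi j)); by field.
apply: gaussian_transform_normal_vector.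
  by move=> i j; rewrite !mxE !LC (symC (q (lift ord_max j)) (q (lift ord_max i))); by field.
by rewrite GE; exact: gaussian_transform_linear gmu.
Qed.

Let D : set (FS * R) := [set p | x l <= p.2 /\ forall i, b i p.1 < p.2].

Let measurable_D : measurable D.
Proof.
rewrite (_ : D = (fun p : FS * R => p.2 - x l) @^-1` `[0, +oo[ `&`
    \bigcap_(i in [set: 'I_r]) ((fun p : FS * R => p.2 - b i p.1) @^-1` `]0, +oo[)).
  apply: measurableI; last (apply: fin_bigcap_measurable => // i _).
  - rewrite -[X in measurable X]setTI.
    suff h : measurable_fun setT (fun p : FS * R => p.2 - x l).
      by apply: h => //; exact: measurable_itv.
    by apply: measurable_funB => //; exact: measurable_snd.
  - rewrite -[X in measurable X]setTI.
    suff h : measurable_fun setT (fun p : FS * R => p.2 - b i p.1).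
      by apply: h => //; exact: measurable_itv.
    apply: measurable_funB; first exact: measurable_snd.
    exact: measurableT_comp (measurable_b i) measurable_fst.
apply/seteqP; split => -[w z] /=.
  move=> [cz bz]; split; first by rewrite in_itv/= andbT subr_ge0.
  by move=> i _; rewrite /= in_itv/= andbT subr_gt0.
move=> [+ bz]; rewrite in_itv/= andbT subr_ge0 => cz; split => // i.
by have := bz i I; rewrite /= in_itv/= andbT subr_gt0.
Qed.

(** Tonelli on the region [D]: integrating over w first gives the survival function times
    [expR (- z)], integrating over z first gives [expR (- beta w)]. *)
Let HR_h_beta : (HR_h q L (x \o q))%:E = (\int[mu]_w (expR (- beta w))%:E)%E.
Proof.
rewrite /HR_h; have [r0|r0] := eqVneq r 0%N.
  rewrite (eq_integral (cst (expR (- x l))%:E)).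
    by rewrite integral_cst// [X in (_ * X)%E]probability_setT mule1.
  move=> w _; rewrite /beta /= big1_idem//= => [|i _]; first exact: maxxx.
  by have := ltn_ord i; rewrite {2}r0.
pose f (w : FS) (z : R) := (\1_D (w, z) * expR (- z))%:E.
have mf : measurable_fun setT (fun p : FS * R => f p.1 p.2).
  apply/measurable_EFinP; apply: measurable_funM.
    rewrite (_ : (fun p : FS * R => \1_D (p.1, p.2)) = \1_D :> (FS * R -> R)); last first.
      by apply/funext => -[].
    exact: measurable_indic.
  by apply: measurableT_comp => //; apply: measurableT_comp => //; exact: measurable_snd.
have f0 p : (0 <= f p.1 p.2)%E by rewrite lee_fin mulr_ge0 ?expR_ge0.
have intw w : (\int[lebesgue_measure]_z f w z = (expR (- beta w))%:E)%E.
  rewrite -exp_tail_integral_inter [RHS]integral_mkcond; apply: eq_integral => z _.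
  rewrite patchE /f indicE.
  rewrite (_ : ((w, z) \in D) = (z \in [set z : R | x l <= z /\ forall i, b i w < z])).
    by case: ifP; rewrite ?mul1r ?mul0r.
  by apply/idP/idP; rewrite !inE.
under [RHS]eq_integral do rewrite -intw.
rewrite (fubini_tonelli (m1 := mu) (m2 := lebesgue_measure) _ mf f0).
(* [HR_h] is a real-valued integral, so the extended one has to be finite; [expR (- x l)] bounds the
   integrand in w. *)
rewrite -[RHS]fineK; last first.
  rewrite -(fubini_tonelli (m1 := mu) (m2 := lebesgue_measure) _ mf f0).
  under eq_integral do rewrite /= intw.
  apply: (integrable_fin_num measurableT).
  apply: (@bounded_measurable_integrable _ _ _ _ _ (expR (- x l))).
    by do 2 apply: measurableT_comp => //.
  by move=> w; rewrite ger0_norm ?expR_ge0// ler_expR lerN2 bigmax_ge_id.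
rewrite /Rintegral; congr (fine _)%:E.
rewrite [LHS]integral_mkcond; apply: eq_integral => z _.
rewrite patchE; case: (boolP (z \in _)) => [|zl].
- rewrite inE/= in_itv/= andbT => lz.
  pose A := diff @^-1` [set y : 'I_r -> R |
    forall i, (x \o q) (lift ord_max i) - z + 2 * L (q (lift ord_max i)) (q ord_max) ^+ 2 < y i].
  have mA : measurable A.
    rewrite -[A]setTI; apply: measurable_diff => //; exact: measurable_orthant.
  have diffE w i : diff w i = w (qi i) - w l by rewrite /diff sum_delta_diff.
  rewrite EFinM (normal_survivalE _ normal_nu) muleC.
  transitivity (\int[mu]_w ((expR (- z))%:E * (\1_A w)%:E))%E.
    rewrite ge0_integralZl_EFin ?expR_ge0//; last first.
      exact/measurable_EFinP.
    by rewrite integral_indic// setIT.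
  apply: eq_integral => w _; rewrite /f -EFinM mulrC; congr (_ * _)%:E.
  rewrite !indicE; congr (_%:R); congr nat_of_bool; apply/idP/idP; rewrite !inE /A /D /=.
  + move=> h; split => // i; have := h i; rewrite diffE /b -/(qi i) -/l /=; lra.
  + move=> [_ h] i; have := h i; rewrite diffE /b -/(qi i) -/l /=; lra.
- move: zl; rewrite notin_setE/= in_itv/= andbT => lz.
  rewrite [RHS]integral0_eq// => w _; rewrite /f indicE memNset ?mul0r//.
  by move=> [+ _]; exact.
Qed.

(* Substituting the shift of [w] by column [l] of [C] (the Girsanov density is
   [expR (w l - C l l / 2)]) turns [expR (- beta)] into a minimum of drifted
   exponentials. *)
Lemma HR_h_min : (HR_h q L (x \o q))%:E =
  (\int[mu]_w (\big[Num.min/drifted_exp w (q ord_max)]_(i < r.+1) drifted_exp w (q i))%:E)%E.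
Proof.
pose F (u : FS) := (expR (- beta (fun i => u i - C i l)))%:E.
have mF : measurable_fun setT F.
  apply/measurable_EFinP; do 2 apply: measurableT_comp => //.
  apply: (measurableT_comp measurable_beta); apply: measurable_to_fun_space => i.
  by apply: measurable_funB => //; exact: measurable_eval.
have F0 u : (0 <= F u)%E by rewrite lee_fin expR_ge0.
rewrite HR_h_beta.
transitivity (\int[mu]_w F (fun i => w i + C i l)%R)%E.
  apply: eq_integral => w _; rewrite /F; congr (expR (- beta _))%:E.
  by apply/funext => i; rewrite addrK.
rewrite -(gaussian_girsanov l symC gmu mF F0); apply: eq_integral => w _.
rewrite /F -EFinM -expRD /beta; congr EFin.
set k := w l - C l l / 2.
have exp_max : {morph (fun v => expR (- v + k)) : u v / Num.max u v >-> Num.min u v}.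
  move=> u v; case: leP => uv.
    by rewrite min_r// ler_expR lerD2r lerN2.
  by rewrite min_l// ler_expR lerD2r lerN2 ltW.
have e_l : expR (- x l + k) = drifted_exp w l.
  by rewrite /drifted_exp /k; congr expR; ring.
rewrite (big_morph (fun v => expR (- v + k)) exp_max e_l).
have e_i i : expR (- b i (fun j => w j - C j l) + k) = drifted_exp w (qi i).
  by rewrite /b /drifted_exp LC /k; congr expR; field.
under eq_bigr do rewrite e_i.
apply: le_anti; apply/andP; split; apply/bigmin_geP; split.
- exact: bigmin_le_id.
- move=> i _; case: (unliftP ord_max i) => [j ->|->]; last exact: bigmin_le_id.
  exact: (bigmin_le _ _ (fun j => drifted_exp w (qi j))).
- exact: bigmin_le_id.
- by move=> j _; exact: (bigmin_le _ _ (fun j => drifted_exp w (q j))).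
Qed.

End tuple.

(** [max_min_identity] integrated term by term with [HR_h_min]; its signs are opposite to those in
    [husler_reiss], hence the minus. *)
Lemma ln_husler_reiss : ((ln (husler_reiss L x))%:E =
  - \int[mu]_w (\big[Num.max/0]_(j < m) drifted_exp w j)%:E)%E.
Proof.
pose e r (q : 'I_r.+1 -> 'I_m) w :=
  \big[Num.min/drifted_exp w (q ord_max)]_(i < r.+1) drifted_exp w (q i).
have ie r (q : 'I_r.+1 -> 'I_m) : mu.-integrable setT (EFin \o e r q).
  apply: (le_integrable measurableT _ _ (integrable_drifted_exp (q ord_max))).
    by apply/measurable_EFinP/measurable_bigminr => [|i]; exact: measurable_drifted_exp.
  move=> w _; rewrite /= lee_fin !ger0_norm ?expR_ge0//; first exact: bigmin_le_id.
  by apply/bigmin_geP; split=> [|i _]; exact: expR_ge0.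
rewrite /husler_reiss expRK.
have ide w : \big[Num.max/0]_(j < m) drifted_exp w j = \sum_(r < m) (-1) ^+ r *
    \sum_(q : {ffun 'I_r.+1 -> 'I_m} | strictly_increasing q) e r q w.
  by rewrite max_min_identity// => j; exact: expR_ge0.
under [X in (- X)%E]eq_integral do rewrite ide.
have [is1 s1] := Rintegral_bigsum (index_enum 'I_m) xpredT
  (fun r : 'I_m => integrable_scale ((-1) ^+ r)
  (Rintegral_bigsum (index_enum {ffun 'I_r.+1 -> 'I_m}) (@strictly_increasing m r.+1)
    (fun q => ie r q)).1).
rewrite -EFin_Rintegral// s1 -EFinN -sumrN; congr EFin; apply: eq_bigr => r _.
have [is2 s2] := Rintegral_bigsum (index_enum {ffun 'I_r.+1 -> 'I_m}) (@strictly_increasing m r.+1)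
    (fun q => ie r q).
rewrite RintegralZl// s2 exprS mulN1r mulNr; congr (- (_ * _)).
by apply: eq_bigr => q _; apply: EFin_inj; rewrite EFin_Rintegral// HR_h_min.
Qed.
End husler_reiss_gaussian.

(** * Independent marks on a Poisson process *)

Lemma Rintegral_indic d (T : measurableType d) (R : realType)
    (P : probability T R) (A : set T) : measurable A ->
  \int[P]_x (\1_A x : R) = fine (P A).
Proof. by move=> mA; rewrite /Rintegral integral_indic// setIT. Qed.

Lemma prodr_itv01 (R : realType) (I : Type) (s : seq I) (Q : pred I) (f : I -> R) :
  (forall i, 0 <= f i <= 1) -> 0 <= \prod_(i <- s | Q i) f i <= 1.
Proof.
move=> f01; elim/big_rec: _ => [|i x _ /andP[x0 x1]]; first by rewrite ler01 lexx.
by have /andP[f0 f1] := f01 i; rewrite mulr_ge0//= mulr_ile1.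
Qed.

Section thinning.
Context d (Omega : measurableType d) (R : realType) (P : probability Omega R).
Variables (U : nat -> {RV P >-> R}) (V : nat -> Omega -> R).
Hypothesis mV : forall i, measurable_fun setT (V i).
Hypothesis indepUV : forall N (A : set Omega) (D : 'I_N -> set R),
  <<s gen_family U >> A -> (forall i, measurable (D i)) ->
  P (A `&` \bigcap_(i in [set: 'I_N]) V i @^-1` D i) =
  (P A * \prod_(i < N) P (V 0%N @^-1` D i))%E.

Variables (K : nat) (B D : 'I_K -> set R).
Hypotheses (mB : forall k, measurable (B k)) (mD : forall k, measurable (D k)).
Hypothesis tB : trivIset setT B.

(** Disjointness makes the cell of a point unique; [None] is a point outside all cells, on whose
    mark nothing is imposed. *)
Let block (u : R) : option 'I_K := [pick k | `[< B k u >]].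
Let allowed (t : option 'I_K) : set R := if t is Some k then D k else setT.
Let c (t : option 'I_K) : R := fine (P (V 0%N @^-1` allowed t)).

Let blockE u k : (block u == Some k) = `[< B k u >].
Proof.
rewrite /block; case: pickP => [j /asboolP Bj|nB]; last by rewrite nB.
apply/eqP/asboolP => [[<-]//|Bk]; congr Some.
by apply: (tB (i := j) (j := k)) => //; exists u.
Qed.

Let block_none u : (block u == None) = `[< forall k, ~ B k u >].
Proof.
rewrite /block; case: pickP => [j /asboolP Bj|nB].
  by apply/esym/asboolP => /(_ j).
by apply/esym/asboolP => k Bk; have /asboolP := nB k.
Qed.

Let measurable_block t : measurable (block @^-1` [set t]).
Proof.
case: t => [k|].
  rewrite (_ : _ @^-1` _ = B k)//; apply/seteqP; split => u /=.
    by move=> /eqP; rewrite blockE => /asboolP.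
  by move=> Bu; apply/eqP; rewrite blockE; apply/asboolP.
rewrite (_ : _ @^-1` _ = \bigcap_(k in [set: 'I_K]) ~` B k).
  by apply: fin_bigcap_measurable => // k _; exact: measurableC.
apply/seteqP; split => u /=.
  by move=> /eqP; rewrite block_none => /asboolP Bu k _; exact: Bu.
by move=> Bu; apply/eqP; rewrite block_none; apply/asboolP => k; exact: Bu.
Qed.

Let measurable_allowed t : measurable (allowed t).
Proof. by case: t => [k|]; [exact: mD|exact: measurableT]. Qed.

Let respects N := [set w | forall i : 'I_N, allowed (block (U i w)) (V i w)].
Let types N (w : Omega) : {ffun 'I_N -> option 'I_K} := [ffun i : 'I_N => block (U i w)].
Let has_types N (f : {ffun 'I_N -> option 'I_K}) : set Omega := [set w | types N w = f].

Let gen_has_types N f : <<s gen_family U >> (@has_types N f).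
Proof.
have -> : has_types f =
    \bigcap_(i in [set: 'I_N]) U i @^-1` (block @^-1` [set f i]).
  apply/seteqP; split => w; rewrite /has_types /=.
    by move=> <- i _ /=; rewrite ffunE.
  by move=> h; apply/ffunP => i; rewrite ffunE; exact: h.
apply: (@fin_bigcap_measurable _ (g_sigma_algebraType (gen_family U))) => // i _.
apply: sub_sigma_algebra; exists (nat_of_ord i) => //.
by exists (block @^-1` [set f i]) => //; rewrite setTI.
Qed.

Let measurable_has_types N f : measurable (@has_types N f).
Proof.
apply: (smallest_sub _ _ (gen_has_types f)); first exact: sigma_algebra_measurable.
by move=> _ [i _ [C mC <-]]; exact: measurable_funP.
Qed.

Let types_sum N (F : {ffun 'I_N -> option 'I_K} -> R) w :
  F (types N w) = \sum_f F f * \1_(has_types f) w.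
Proof.
rewrite (bigD1 (types N w))//= indicE mem_set// mulr1 big1 ?addr0// => f /eqP nf.
by rewrite indicE memNset ?mulr0// => /esym.
Qed.

Let measurable_VD N (f : {ffun 'I_N -> option 'I_K}) :
  measurable (\bigcap_(i in [set: 'I_N]) V i @^-1` allowed (f i)).
Proof.
apply: fin_bigcap_measurable => // i _; rewrite -[X in measurable X]setTI.
by apply: (mV i measurableT); exact: measurable_allowed.
Qed.

Let measurable_respects N : measurable (respects N).
Proof.
rewrite (_ : respects N = \bigcup_(f in [set: {ffun 'I_N -> option 'I_K}])
    (has_types f `&` \bigcap_(i in [set: 'I_N]) V i @^-1` allowed (f i))).
  apply: fin_bigcup_measurable => // f _; apply: measurableI => //.
apply/seteqP; split => w.
  move=> Ew; exists (types N w) => //; split => // i _.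
  by rewrite /= ffunE; exact: Ew.
by move=> [f _ [<- Vw]] i; have := Vw i I; rewrite /= ffunE.
Qed.

(** Split by the cells of the first [N] points: on each event [has_types f] the marks are
    independent of the points, and every point contributes the probability that a mark is allowed in
    its cell. *)
Let thinning_finite N : \int[P]_w (\1_(respects N) w : R) =
  \int[P]_w (\prod_(i < N) c (block (U i w))).
Proof.
pose VD (f : {ffun 'I_N -> option 'I_K}) :=
  \bigcap_(i in [set: 'I_N]) V i @^-1` allowed (f i).
have fin_V t : P (V 0%N @^-1` allowed t) \is a fin_num.
  rewrite fin_num_measure// -[X in measurable X]setTI.
  by apply: (mV 0%N measurableT); exact: measurable_allowed.
have mVD f : measurable (VD f) by exact: measurable_VD.
have E1 w : (\1_(respects N) w : R) = \sum_f (\1_(VD f `&` has_types f) w : R).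
  under eq_bigr do rewrite indicI.
  rewrite -(types_sum (fun f => \1_(VD f) w) w) !indicE; congr (_%:R); congr nat_of_bool.
  apply/idP/idP; rewrite !inE => h i.
    by move=> _; rewrite /= ffunE; exact: h.
  by have := h i I; rewrite /= ffunE.
have E2 w : \prod_(i < N) c (block (U i w)) =
    \sum_(f : {ffun 'I_N -> option 'I_K}) (\prod_(i < N) c (f i)) * (\1_(has_types f) w : R).
  rewrite -(types_sum (fun f => \prod_(i < N) c (f i)) w).
  by apply: eq_bigr => i _; rewrite ffunE.
have i1 f : P.-integrable setT (EFin \o (fun w => \1_(VD f `&` has_types f) w : R)).
  apply: (@bounded_measurable_integrable _ _ _ _ _ 1).
    apply: measurable_indic; apply: measurableI; [exact: measurable_VD|exact: measurable_has_types].
  by move=> w; rewrite indicE; case: (_ \in _); rewrite ?normr1 ?normr0.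
have i2 (f : {ffun 'I_N -> option 'I_K}) :
    P.-integrable setT (EFin \o (fun w => \1_(has_types f) w : R)).
  apply: (@bounded_measurable_integrable _ _ _ _ _ 1).
    by apply: measurable_indic; exact: measurable_has_types.
  by move=> w; rewrite indicE; case: (_ \in _); rewrite ?normr1 ?normr0.
under [LHS]eq_Rintegral do rewrite E1.
under [RHS]eq_Rintegral do rewrite E2.
have [_ ->] := Rintegral_bigsum (index_enum _) xpredT i1.
have [_ ->] := Rintegral_bigsum (index_enum _) xpredT
  (fun f : {ffun 'I_N -> option 'I_K} => integrable_scale (\prod_(i < N) c (f i)) (i2 f)).
apply: eq_bigr => f _; rewrite RintegralZl// !Rintegral_indic//; last exact: measurableI.
rewrite setIC indepUV// fineM ?fin_num_measure//; last first.
  by apply: prode_fin_num => i _; exact: fin_V.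
rewrite mulrC; congr (_ * _); rewrite /c.
under [X in fine X]eq_bigr do rewrite -(fineK (fin_V _)).
by rewrite prodEFin.
Qed.

Hypothesis poisU : poisson_process P U (@exp_intensity R).
Hypothesis finB : forall k, (exp_intensity (B k) < +oo)%E.
Let l k := fine (exp_intensity (B k)).
Let cnt k w := point_count U (B k) w.
Let n_ k w : nat := Num.truncn (fine (cnt k w)).
Let at_ k (j : nat) : set Omega := [set w | cnt k w = j%:R%:E].

Let measurable_at k j : measurable (at_ k j).
Proof.
rewrite (_ : at_ k j = cnt k @^-1` [set j%:R%:E])// -[X in measurable X]setTI.
suff mc : measurable_fun setT (cnt k) by apply: mc => //; exact: emeasurable_set1.
rewrite (_ : cnt k = fun w => \sum_(0 <= i <oo) (\1_(U i @^-1` B k) w)%:E)%E.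
  apply: ge0_emeasurable_sum => // i _.
  apply/measurable_EFinP; apply: measurable_indic; rewrite -[X in measurable X]setTI.
  exact: measurable_funP.
by apply/funext => w; apply: eq_eseriesr => i _; rewrite [LHS]diracE indicE.
Qed.

Let at_n k j w : at_ k j w -> n_ k w = j.
Proof. by rewrite /at_ /n_ /= => ->; rewrite natrK. Qed.

(* The value is 0 when the count is infinite. *)
Let counted_power (p : 'I_K -> R) k w : R := p k ^+ n_ k w * \1_(at_ k (n_ k w)) w.

Section generating_function.
Variable p : 'I_K -> R.
Hypothesis p01 : forall k, 0 <= p k <= 1.

Local Notation y := (counted_power p).
Let y_ M k w : R := (n_ k w < M)%N%:R * y k w.

Let y_sum M k w : y_ M k w = \sum_(j < M) p k ^+ j * \1_(at_ k j) w.
Proof.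
rewrite /y_ /counted_power; case: (ltnP (n_ k w) M) => [nM|nM]; rewrite ?mul1r ?mul0r.
  rewrite (bigD1 (Ordinal nM))//= big1 ?addr0// => j /eqP jn.
  rewrite indicE memNset ?mulr0// => /at_n E; apply: jn; exact/val_inj/esym.
rewrite big1// => j _; rewrite indicE memNset ?mulr0// => /at_n E.
by have := ltn_ord j; rewrite -E ltnNge nM.
Qed.

Let y01 k w : 0 <= y k w <= 1.
Proof.
have /andP[p0 p1] := p01 k.
rewrite /counted_power indicE.
by case: (_ \in _); rewrite ?mulr1 ?mulr0 ?exprn_ge0 ?exprn_ile1 ?lexx ?ler01.
Qed.

Let y_01 M k w : 0 <= y_ M k w <= 1.
Proof. by rewrite /y_; case: ltnP => _; rewrite ?mul1r ?mul0r ?lexx ?ler01. Qed.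

Let measurable_y_ M : measurable_fun setT (fun w => \prod_k y_ M k w).
Proof.
apply: measurable_prod => k _.
rewrite (_ : y_ M k = fun w => \sum_(j < M) p k ^+ j * \1_(at_ k j) w); last first.
  by apply/funext => w; rewrite y_sum.
by apply: measurable_sum => j; apply: measurable_funM => //; exact: measurable_indic.
Qed.

Let cvg_truncated_y w : \prod_k y_ M k w @[M --> \oo] --> \prod_k y k w.
Proof.
apply: cvg_near_cst; exists (\max_k n_ k w).+1 => // M /= nM.
apply: eq_bigr => k _; rewrite /y_ (_ : (_ < _)%N) ?mul1r//.
by apply: leq_trans nM; rewrite ltnS; exact: (leq_bigmax k).
Qed.

(** Expanding the product of sums leaves one term per vector of counts, whose probability factors
    over the disjoint cells. *)
Let integral_truncated_y M : \int[P]_w (\prod_k y_ M k w) =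
  \prod_k \sum_(j < M) p k ^+ j * (expR (- l k) * l k ^+ j / j`!%:R).
Proof.
rewrite bigA_distr_bigA/=.
pose At (f : {ffun 'I_K -> 'I_M}) := \bigcap_(k in [set` enum 'I_K]) at_ k (f k).
have mAt f : measurable (At f) by apply: fin_bigcap_measurable => // k _; exact: measurable_at.
have E w : \prod_k y_ M k w = \sum_(f : {ffun 'I_K -> 'I_M}) \prod_k p k ^+ f k * (\1_(At f) w : R).
  under eq_bigr do rewrite y_sum.
  rewrite bigA_distr_bigA/=; apply: eq_bigr => f _; rewrite big_split/=; congr (_ * _).
  rewrite indicE; have [h|h] := boolP (w \in At f).
    rewrite big1// => k _; rewrite indicE mem_set//.
    by move: h; rewrite inE => /(_ k); apply; rewrite /= mem_enum.
  apply/eqP; rewrite prodf_seq_eq0; apply: contraR h => /hasPn h.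
  rewrite inE => k _; have := h k (mem_index_enum k); rewrite /= indicE.
  by case: (boolP (w \in _)); rewrite ?inE ?eqxx.
have i2 (f : {ffun 'I_K -> 'I_M}) : P.-integrable setT (EFin \o (fun w => \1_(At f) w : R)).
  apply: (@bounded_measurable_integrable _ _ _ _ _ 1); first exact: measurable_indic.
  by move=> w; rewrite indicE; case: (_ \in _); rewrite ?normr1 ?normr0.
under eq_Rintegral do rewrite E.
have [_ ->] := Rintegral_bigsum (index_enum _) xpredT
  (fun f : {ffun 'I_K -> 'I_M} => integrable_scale (\prod_k p k ^+ f k) (i2 f)).
apply: eq_bigr => f _; rewrite RintegralZl// Rintegral_indic// big_split/=; congr (_ * _).
have := (poisU.2 K B mB tB) (enum 'I_K) (fun k => at_ k (f k)) (enum_uniq _).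
rewrite /At => ->; last first.
  move=> k _; exists [set (f k)%:R%:E]; first exact: emeasurable_set1.
  by rewrite setTI.
rewrite big_enum/=.
under eq_bigr => k _ do rewrite (poisU.1 _ (mB k) (finB k)).
by rewrite prodEFin.
Qed.

(** Truncating the counts below [M] makes the expectation a product of finite sums, which become
    exponential series as [M] grows. *)
Lemma poisson_generating_function :
  \int[P]_w (\prod_k y k w) = \prod_k expR (- l k * (1 - p k)).
Proof.
have h1 : \int[P]_w (\prod_k y_ M k w) @[M --> \oo] --> \int[P]_w (\prod_k y k w).
  apply: (@Rintegral_bounded_cvg _ _ _ P _ _ 1) => // M w.
  have /andP[a b] := prodr_itv01 (index_enum 'I_K) xpredT (fun k => y_01 M k w).
  by rewrite ger0_norm.
have h2 : \int[P]_w (\prod_k y_ M k w) @[M --> \oo] --> \prod_k expR (- l k * (1 - p k)).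
  under eq_fun do rewrite integral_truncated_y.
  apply: cvg_big => [|k _]; first exact: mul_continuous.
  rewrite (_ : - l k * (1 - p k) = p k * l k + - l k); last by ring.
  rewrite expRD; under eq_fun => M.
    rewrite (eq_bigr (fun j : 'I_M => expR (- l k) * exp_coeff (p k * l k) j)) -?mulr_sumr; last first.
      by move=> j _; rewrite /exp_coeff /= exprMn; ring.
    rewrite mulrC; over.
  apply: cvgMl.
  rewrite (_ : (fun M => _) = series (exp_coeff (p k * l k))).
    exact: is_cvg_series_exp_coeff.
  by apply/funext => M; rewrite /series/= big_mkord.
by rewrite -(cvg_lim _ h1)// -(cvg_lim _ h2).
Qed.

End generating_function.

Let p k := c (Some k).
Let hits N k w : nat := \sum_(i < N) `[< B k (U i w) >].
Let Z N w : R := \prod_(i < N) c (block (U i w)).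

Let p01 t : 0 <= c t <= 1.
Proof.
have mVt : measurable (V 0%N @^-1` allowed t).
  by rewrite -[X in measurable X]setTI; exact: (mV 0%N measurableT (measurable_allowed t)).
by rewrite /c fine_ge0//= -lee_fin fineK ?probability_le1// fin_num_measure.
Qed.

(** The points are regrouped by cell; those outside all cells contribute the probability of [setT],
    which is 1. *)
Let ZE N w : Z N w = \prod_k p k ^+ hits N k w.
Proof.
under [RHS]eq_bigr do rewrite /hits -prodrXr.
rewrite exchange_big/=; apply: eq_bigr => i _.
case E : (block (U i w)) => [k|].
  rewrite (bigD1 k)//= big1 ?mulr1.
    by move: E => /eqP; rewrite blockE => ->; rewrite expr1.
  move=> j /eqP jk; case: (boolP `[< _ >]) => [|_]; last by rewrite expr0.
  by rewrite -blockE E => /eqP[] /esym.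
rewrite big1 => [|k _].
  by rewrite /c /= preimage_setT probability_setT.
case: (boolP `[< _ >]) => [|_]; last by rewrite expr0.
by rewrite -blockE E.
Qed.

(** Partial counts are integers, so converging to a finite total means being eventually equal to
    it. *)
Let hits_eventually k n w : at_ k n w -> \forall N \near \oo, hits N k w = n.
Proof.
rewrite /at_ /= /cnt /point_count /mseries => cn.
have : (hits N k w)%:R%:E @[N --> \oo] --> (n%:R%:E : \bar R).
  have -> : (fun N => (hits N k w)%:R%:E) =
      (fun N => \sum_(0 <= i < N) (\d_(U i w) (B k) : \bar R))%E.
    apply/funext => N; rewrite big_mkord /hits natr_sum -sumEFin; apply: eq_bigr => i _.
    have [h|h] := asboolP (B k (U i w)); rewrite [RHS]diracE.
      by rewrite mem_set.
    by rewrite memNset.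
  by rewrite -cn; apply: is_cvg_nneseries => i _ _; rewrite [X in (_ <= X)%E]diracE lee_fin.
move=> /fine_cvgP[_] /cvgrPdist_lt/(_ 1 ltr01); apply: filterS => N /=.
rewrite ltr_norml ltrBlDr => /andP[a b].
have : (hits N k w < n.+1)%N by rewrite -(ltr_nat R) -natr1; lra.
have : (n < (hits N k w).+1)%N by rewrite -(ltr_nat R) -natr1; lra.
by rewrite !ltnS => ? ?; apply/eqP; rewrite eqn_leq; apply/andP.
Qed.

(** The second factor is the indicator that all counts are finite. On that event partial counts
    stabilize; off it both sides are 0. *)
Let cvg_ZF w : Z N w * \prod_k counted_power (fun=> 1) k w @[N --> \oo] -->
  \prod_k counted_power p k w.
Proof.
have [h|h] := pselect (forall k, at_ k (n_ k w) w).
  apply: cvg_near_cst.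
  have : \forall N \near \oo, forall k, hits N k w = n_ k w.
    by apply: filter_forall => k; exact: hits_eventually.
  apply: filterS => N hN; rewrite ZE -big_split/=; apply: eq_bigr => k _.
  by rewrite hN /counted_power expr1n mul1r.
have [k hk] : exists k, ~ at_ k (n_ k w) w by apply/existsNP.
have z q : \prod_k counted_power q k w = 0.
  by rewrite (bigD1 k)//= {1}/counted_power indicE memNset// mulr0 mul0r.
by rewrite !z; under eq_fun do rewrite mulr0; exact: cvg_cst.
Qed.

(** Both sides are limits of the integral of [Z N]: by [thinning_finite] it is the probability that
    the first [N] points respect the rule, and by [cvg_ZF] it tends to the generating function at
    the probabilities of allowed marks. *)
Lemma thinning : \int[P]_w (\1_[set w | forall i k, B k (U i w) -> D k (V i w)] w : R) =
  \prod_k expR (- fine (exp_intensity (B k)) * (1 - fine (P (V 0%N @^-1` D k)))).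
Proof.
rewrite -[RHS]/(\prod_k expR (- l k * (1 - p k))).
set E := [set w | _].
pose F w : R := \prod_k counted_power (fun=> 1) k w.
pose fin_ k := \bigcup_j at_ k j.
have F01 w : 0 <= F w <= 1.
  apply: prodr_itv01 => k; rewrite /counted_power expr1n mul1r indicE.
  by case: (_ \in _); rewrite ?lexx ?ler01.
have Z01 N w : 0 <= Z N w <= 1 by apply: prodr_itv01 => i; exact: p01.
have mF : measurable_fun setT F.
  have -> : F = fun w => \prod_k \1_(fin_ k) w.
    apply/funext => w; apply: eq_bigr => k _; rewrite /counted_power expr1n mul1r !indicE.
    congr (_%:R); congr nat_of_bool; apply/idP/idP; rewrite !inE.
      by move=> h; exists (n_ k w).
    by move=> [j _ h]; rewrite (at_n h).
  apply: measurable_prod => k _; apply: measurable_indic.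
  by apply: bigcup_measurable => j _; exact: measurable_at.
have mZ N : measurable_fun setT (Z N).
  apply: measurable_prod => i _.
  have -> : (fun w => c (block (U i w))) =
      fun w => \sum_t c t * \1_(U i @^-1` (block @^-1` [set t])) w.
    apply/funext => w; rewrite (bigD1 (block (U i w)))//= indicE mem_set// mulr1 big1 ?addr0//.
    by move=> t /eqP tn; rewrite indicE memNset ?mulr0// => /esym.
  apply: measurable_sum => t; apply: measurable_funM => //; apply: measurable_indic.
  by rewrite -[X in measurable X]setTI; exact: (measurable_funP (U i)).
have iZ N : P.-integrable setT (EFin \o Z N).
  apply: (@bounded_measurable_integrable _ _ _ _ _ 1) => // w.
  by have /andP[a b] := Z01 N w; rewrite ger0_norm.
have iF : P.-integrable setT (EFin \o F).
  apply: (@bounded_measurable_integrable _ _ _ _ _ 1) => // w.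
  by have /andP[a b] := F01 w; rewrite ger0_norm.
have iZF N : P.-integrable setT (EFin \o (fun w => Z N w * F w)).
  apply: (@bounded_measurable_integrable _ _ _ _ _ 1); first exact: measurable_funM.
  move=> w; have /andP[a b] := F01 w; have /andP[a' b'] := Z01 N w.
  by rewrite ger0_norm ?mulr_ge0// mulr_ile1.
have i1 : P.-integrable setT (EFin \o (fun=> 1 : R)).
  by apply: (@bounded_measurable_integrable _ _ _ _ _ 1) => // w; rewrite normr1.
(* At p = 1 the generating function is 1: almost surely all counts are finite, so that inserting [F]
   does not change the integral of [Z N]. *)
have F1 : \int[P]_w F w = 1.
  rewrite poisson_generating_function => [|k]; last by rewrite ler01 lexx.
  by rewrite big1// => k _; rewrite subrr mulr0 expR0.
have ZF N : \int[P]_w Z N w = \int[P]_w (Z N w * F w).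
  apply: le_anti; apply/andP; split; last first.
    apply: le_Rintegral => // w _; have /andP[a b] := F01 w; have /andP[a' b'] := Z01 N w.
    by rewrite ler_piMr.
  rewrite -subr_le0 -RintegralB//.
  have <- : \int[P]_w (1 - F w) = 0.
    by rewrite RintegralB// F1 Rintegral_probability_cst subrr.
  apply: le_Rintegral => //; first exact: (integrableB measurableT (iZ N) (iZF N)).
    exact: (integrableB measurableT i1 iF).
  move=> w _; have /andP[a b] := F01 w; have /andP[a' b'] := Z01 N w.
  rewrite -[X in X - _]mulr1 -mulrBr ler_piMl// subr_ge0//.
have h1 : \int[P]_w Z N w @[N --> \oo] --> \prod_k expR (- l k * (1 - p k)).
  rewrite -poisson_generating_function; last by move=> k; exact: p01.
  under eq_fun do rewrite ZF.
  apply: (@Rintegral_bounded_cvg _ _ _ P _ _ 1) => [N|N w|w].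
  - exact: measurable_funM.
  - have /andP[a b] := F01 w; have /andP[a' b'] := Z01 N w.
    by rewrite ger0_norm ?mulr_ge0// mulr_ile1.
  - exact: cvg_ZF.
have h2 : \int[P]_w Z N w @[N --> \oo] --> \int[P]_w (\1_E w : R).
  under eq_fun do rewrite -thinning_finite.
  apply: (@Rintegral_bounded_cvg _ _ _ P _ _ 1) => [N|N w|w].
  - exact: measurable_indic.
  - by rewrite indicE; case: (_ \in _); rewrite ?normr1 ?normr0.
  - apply: cvg_near_cst; have [Ew|nEw] := pselect (E w).
      apply: nearW => N; rewrite !indicE !mem_set// => i /=.
      case b : (block _) => [k|//] /=; apply: Ew; apply/asboolP; rewrite -blockE; exact/eqP.
    have [i [k [Bk nDk]]] : exists i k, B k (U i w) /\ ~ D k (V i w).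
      by move: nEw => /existsNP[i /existsNP[k /not_implyP h]]; exists i, k.
    exists i.+1 => // N /= iN; rewrite !indicE !memNset// => /(_ (Ordinal iN)) /=.
    have -> : block (U i w) = Some k by apply/eqP; rewrite blockE; exact/asboolP.
    exact: nDk.
by rewrite -(cvg_lim _ h1)// -(cvg_lim _ h2).
Qed.
End thinning.

(** * Discretization on a grid and the void probability *)

Lemma exp_intensity_itv (R : realType) (a b : R) : a <= b ->
  exp_intensity `[a, b[ = (expR (- a) - expR (- b))%:E.
Proof.
move=> ab; rewrite /exp_intensity.
have mexp (A : set R) : measurable_fun A (fun z : R => (expR (- z))%:E).
  by apply: measurable_funTS; apply/measurable_EFinP/measurableT_comp.
have := exp_tail_integral a.
rewrite (@itv_bndbnd_setU _ _ (BLeft a) (BLeft b) +oo%O)//.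
rewrite ge0_integral_setU//=.
- rewrite exp_tail_integral => h; apply/eqP.
  by rewrite EFinB -h addeK.
- exact: mexp.
- apply/disj_setPS => z [] /=; rewrite !in_itv/= andbT => /andP[_ zb] bz.
  by move: zb; rewrite ltNge bz.
Qed.

Section grid.
Context (R : realType).
Implicit Types (n k : nat) (u v : R).

(** Mesh 1/(n+1) on the window from -(n+1) to n+1, hence 2 (n+1)^2 cells. *)
Definition grid n k : R := k%:R / n.+1%:R - n.+1%:R.
Definition grid_size n := (n.+1 * n.+1).*2.

Lemma gridS n k : grid n k.+1 = grid n k + n.+1%:R^-1.
Proof. by rewrite /grid -natr1 mulrDl mul1r addrAC. Qed.

Lemma grid0 n : grid n 0 = - n.+1%:R.
Proof. by rewrite /grid mul0r sub0r. Qed.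

Lemma grid_end n : grid n (grid_size n) = n.+1%:R.
Proof. rewrite /grid /grid_size -muln2 !natrM; by field; rewrite nat1r pnatr_eq0. Qed.

Lemma grid_le n k k' : (k <= k')%N -> grid n k <= grid n k'.
Proof. by move=> kk; rewrite /grid lerD2r ler_pM2r ?invr_gt0// ler_nat. Qed.

Lemma trivIset_grid n :
  trivIset setT (fun k : 'I_(grid_size n) => `[grid n k, grid n k.+1[%classic).
Proof.
move=> i j _ _ [u []] /=; rewrite !in_itv/= => /andP[iu ui] /andP[ju uj].
have [ij|ji|/val_inj//] := ltngtP i j.
- by have := le_lt_trans (grid_le n ij) (le_lt_trans ju ui); rewrite ltxx.
- by have := le_lt_trans (grid_le n ji) (le_lt_trans iu uj); rewrite ltxx.
Qed.

(** Once the mesh is below u - v and the window contains [u], the cell of [u] starts above [v]. Its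
    index is the integer part of (u + n + 1) (n + 1). *)
Lemma grid_separates v u : v < u -> \forall n \near \oo,
  exists k : 'I_(grid_size n), grid n k <= u < grid n k.+1 /\ v < grid n k.
Proof.
move=> vu; near=> n.
have n0 : (0 : R) < n.+1%:R by [].
have un : `|u| < n.+1%:R.
  near: n; exists (Num.truncn `|u|) => // n /= nu.
  by apply: lt_le_trans (truncnS_gt _) _; rewrite ler_nat.
have nvu : n.+1%:R^-1 < u - v.
  by near: n; apply: (near_infty_natSinv_lt (PosNum _)); rewrite subr_gt0.
have /andP[u1 u2] : - n.+1%:R < u < n.+1%:R by rewrite -ltr_norml.
have /truncn_itv/andP[] : 0 <= (u + n.+1%:R) * n.+1%:R by rewrite mulr_ge0// -lerBlDr sub0r ltW.
set k := Num.truncn _ => k1 k2.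
have kn : (k < grid_size n)%N.
  rewrite -(ltr_nat R); apply: le_lt_trans k1 _.
  by rewrite /grid_size -muln2 !natrM -mulrA [_ * 2]mulrC mulrA ltr_pM2r// mulr_natr mulr2n ltrD2r.
exists (Ordinal kn) => /=.
have ku : grid n k <= u by rewrite /grid lerBlDr ler_pdivrMr.
have uk : u < grid n k.+1 by rewrite /grid ltrBrDr ltr_pdivlMr.
split; first by rewrite ku.
move: uk; rewrite gridS -ltrBlDr; apply: lt_trans; rewrite ltrBrDl -ltrBrDr.
Unshelve. all: by end_near.
Qed.

(** The sum telescopes from the first grid point above [v]; the maximum with 0 covers the case of no
    such point. *)
Lemma grid_sum_le n K v : \sum_(k < K) (v < grid n k)%R%:R *
  (expR (- grid n k) - expR (- grid n k.+1)) <= Num.max 0 (expR (- v) - expR (- grid n K)).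
Proof.
elim: K => [|K IH]; first by rewrite big_ord0 le_max lexx.
rewrite big_ord_recr/=; case: (ltP v (grid n K)) => vK; rewrite ?mul1r ?mul0r ?addr0.
  rewrite le_max; apply/orP; right.
  rewrite -[leRHS](subrKA (expR (- grid n K))) lerD2r (le_trans IH)// ge_max lexx andbT.
  by rewrite subr_ge0 ler_expR lerN2 ltW.
apply: le_trans IH _; rewrite ge_max le_max lexx/= le_max; apply/orP; left.
by rewrite subr_le0 ler_expR lerN2.
Qed.

(** The same telescoping, where the first grid point above [v] is at most one mesh away. *)
Lemma grid_sum_ge n K v : grid n 0 <= v ->
  expR (- (v + n.+1%:R^-1)) - expR (- grid n K) <=
  \sum_(k < K) (v < grid n k)%R%:R * (expR (- grid n k) - expR (- grid n k.+1)).
Proof.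
have d0 : (0 : R) < n.+1%:R^-1 by rewrite invr_gt0.
move=> v0; elim: K => [|K IH].
  by rewrite big_ord0 subr_le0 ler_expR lerN2 (le_trans v0)// lerDl ltW.
rewrite big_ord_recr/=; case: (ltP v (grid n K)) => vK; rewrite ?mul1r ?mul0r ?addr0.
  by rewrite -[leLHS](subrKA (expR (- grid n K))) lerD2r.
apply: (@le_trans _ _ 0).
  by rewrite subr_le0 ler_expR lerN2 gridS lerD2r.
apply: sumr_ge0 => k _; rewrite mulr_ge0// subr_ge0 ler_expR lerN2; exact: grid_le.
Qed.

End grid.

Section poisson_void.
Context d (Omega : measurableType d) (R : realType) (P : probability Omega R).
Variables (U : nat -> {RV P >-> R}) (V : nat -> Omega -> R).
Hypothesis mV : forall i, measurable_fun setT (V i).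
Hypothesis indepUV : forall N (A : set Omega) (D : 'I_N -> set R),
  <<s gen_family U >> A -> (forall i, measurable (D i)) ->
  P (A `&` \bigcap_(i in [set: 'I_N]) V i @^-1` D i) =
  (P A * \prod_(i < N) P (V 0%N @^-1` D i))%E.
Hypothesis poisU : poisson_process P U (@exp_intensity R).
Hypothesis iV : P.-integrable setT (EFin \o (fun w => expR (- V 0%N w))).

Lemma poisson_void : P [set w | forall i, U i w <= V i w] =
  (expR (- \int[P]_w expR (- V 0%N w)))%:E.
Proof.
pose B n (k : 'I_(grid_size n)) : set R := `[grid R n k, grid R n k.+1[%classic.
pose D n (k : 'I_(grid_size n)) : set R := `[grid R n k, +oo[%classic.
(* [E n] asks the mark to reach only the left end of the cell of its point. It contains [E_], and by
   [grid_separates] a violation U_i > V_i is eventually detected, so the indicators converge. *)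
pose E n := [set w | forall i k, B n k (U i w) -> D n k (V i w)].
pose E_ := [set w | forall i, U i w <= V i w].
(* [G n v] is the intensity of the cells starting above [v]; it tends to [expR (- v)] and stays
   below it, which supplies the domination. *)
pose G n v := \sum_(k < grid_size n) (v < grid R n k)%R%:R *
   (expR (- grid R n k) - expR (- grid R n k.+1)).
have mE : measurable E_.
  rewrite (_ : E_ = \bigcap_i (fun w => V i w - U i w) @^-1` `[0, +oo[%classic).
    apply: bigcap_measurable => // i _; rewrite -[X in measurable X]setTI.
    suff h : measurable_fun setT (fun w => V i w - U i w) by apply: h => //.
    by apply: measurable_funB => //; exact: measurable_funP.
  apply/seteqP; split => w h i; first by move=> _; rewrite /= in_itv/= andbT subr_ge0; exact: h.
  by have := h i I; rewrite /= in_itv/= andbT subr_ge0.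
have GE n : \int[P]_w (\1_(E n) w : R) = expR (- \int[P]_w G n (V 0%N w)).
  have mB k : measurable (B n k) by exact: measurable_itv.
  have mD k : measurable (D n k) by exact: measurable_itv.
  have finB k : (exp_intensity (B n k) < +oo)%E.
    by rewrite /B exp_intensity_itv ?ltry// grid_le.
  rewrite (thinning mV indepUV mB mD (@trivIset_grid R n) poisU finB).
  rewrite -(big_morph expR (@expRD R) (@expR0 R)); congr expR.
  pose h k w : R := \1_(V 0%N @^-1` D n k) w.
  have mh k : measurable (V 0%N @^-1` D n k).
    by rewrite -[X in measurable X]setTI; apply: (mV 0%N measurableT); exact: measurable_itv.
  have ih k : P.-integrable setT (EFin \o h k).
    apply: (@bounded_measurable_integrable _ _ _ _ _ 1); first exact: measurable_indic.
    by move=> w; rewrite /h indicE; case: (_ \in _); rewrite ?normr1 ?normr0.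
  have i1 : P.-integrable setT (EFin \o (fun=> 1 : R)).
    by apply: (@bounded_measurable_integrable _ _ _ _ _ 1) => // w; rewrite normr1.
  have ih1 k : P.-integrable setT (EFin \o (fun w => 1 - h k w)).
    exact: (integrableB measurableT i1 (ih k)).
  have GhE w : G n (V 0%N w) = \sum_(k < grid_size n)
      (expR (- grid R n k) - expR (- grid R n k.+1)) * (1 - h k w).
    apply: eq_bigr => k _; rewrite mulrC; congr (_ * _).
    rewrite /h indicE; case: ltP => gV.
      by rewrite memNset ?subr0// /D /= in_itv/= andbT leNgt gV.
    by rewrite mem_set ?subrr// /D /= in_itv/= andbT.
  under eq_Rintegral do rewrite GhE.
  have [_ ->] := Rintegral_bigsum (index_enum 'I_(grid_size n)) xpredT
    (fun k => integrable_scale (expR (- grid R n k) - expR (- grid R n k.+1)) (ih1 k)).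
  rewrite -sumrN; apply: eq_bigr => k _.
  rewrite RintegralZl// RintegralB// Rintegral_probability_cst Rintegral_indic//.
  by rewrite exp_intensity_itv ?grid_le//= mulNr.
have cvgG : \int[P]_w G n (V 0%N w) @[n --> \oo] --> \int[P]_w expR (- V 0%N w).
  have n0 n : (0 : R) < n.+1%:R^-1 by rewrite invr_gt0.
  have G0 n v : 0 <= G n v.
    by apply: sumr_ge0 => k _; rewrite mulr_ge0// subr_ge0 ler_expR lerN2 grid_le.
  have Gle n v : G n v <= expR (- v).
    apply: le_trans (grid_sum_le _ _ _) _; rewrite ge_max expR_ge0/=.
    by rewrite lerBlDr lerDl expR_ge0.
  have mG n : measurable_fun setT (fun w => G n (V 0%N w)).
    apply: measurable_sum => k; apply: measurable_funM => //.
    rewrite (_ : (fun _ => _) = \1_(~` (V 0%N @^-1` D n k))); last first.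
      apply/funext => w; rewrite indicE; case: ltP => gV.
        by rewrite mem_set// /D /= in_itv/= andbT leNgt gV.
      by rewrite memNset// => /=; apply; rewrite /D /= in_itv/= andbT.
    apply/measurable_indic/measurableC; rewrite -[X in measurable X]setTI.
    by apply: (mV 0%N measurableT); exact: measurable_itv.
  have Gcvg v : G n v @[n --> \oo] --> expR (- v).
    apply: (@squeeze_cvgr _ _ _ _ (fun n => expR (- (v + n.+1%:R^-1)) - expR (- n.+1%:R)) (cst (expR (- v)))).
    - exists (Num.truncn `|v|) => // n /= nv; rewrite Gle andbT.
      rewrite -[X in _ - expR (- X)](@grid_end R n); apply: grid_sum_ge; rewrite grid0.
      have : `|v| <= n.+1%:R.
        by apply: le_trans (ltW (truncnS_gt _)) _; rewrite ler_nat.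
      by rewrite ler_norml => /andP[].
    - rewrite -[X in _ --> X]subr0 -[v in X in _ --> X]addr0; apply: cvgB.
        apply: continuous_cvg; first exact: continuous_expR.
        apply: cvgN; apply: cvgD; first exact: cvg_cst.
        exact: cvg_harmonic.
      by rewrite (cvg_shiftS (fun n => expR (- n%:R))); exact: cvgn_expR.
    - exact: cvg_cst.
  have i n : P.-integrable setT (EFin \o (fun w => G n (V 0%N w))).
    apply: (le_integrable measurableT _ _ iV); first exact/measurable_EFinP.
    by move=> w _ /=; rewrite !ger0_norm ?lee_fin.
  have [] := @dominated_convergence _ _ _ P setT measurableT
     (fun n w => (G n (V 0%N w))%:E) (fun w => (expR (- V 0%N w))%:E)
     (fun w => (expR (- V 0%N w))%:E).
  - by move=> n; exact/measurable_EFinP.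
  - exact: measurable_int iV.
  - by apply: aeW => w _; apply: cvg_EFin; [exact: nearW|exact: Gcvg].
  - exact: iV.
  - by apply: aeW => w n _; rewrite /= ger0_norm ?lee_fin.
  move=> _ _ h; apply: (fine_cvg _); rewrite EFin_Rintegral//.
have h1 : \int[P]_w (\1_(E n) w : R) @[n --> \oo] --> expR (- \int[P]_w expR (- V 0%N w)).
  under eq_fun do rewrite GE.
  by apply: continuous_cvg; [exact: continuous_expR|exact: cvgN].
have h2 : \int[P]_w (\1_(E n) w : R) @[n --> \oo] --> \int[P]_w (\1_E_ w : R).
  apply: (@Rintegral_bounded_cvg _ _ _ P _ _ 1) => [n|n w|w].
  - apply: measurable_indic.
    rewrite (_ : E n = \bigcap_i \bigcap_(k in [set: 'I_(grid_size n)])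
        (~` (U i @^-1` B n k) `|` V i @^-1` D n k)).
      apply: bigcap_measurable => // i _; apply: fin_bigcap_measurable => // k _.
      apply: measurableU; first apply: measurableC; rewrite -[X in measurable X]setTI.
        by apply: (measurable_funP (U i)) => //; exact: measurable_itv.
      by apply: (mV i measurableT); exact: measurable_itv.
    apply/seteqP; split => w h i.
      by move=> _ k _; have [b|b] := pselect (B n k (U i w)); [right; exact: h|left].
    by move=> k b; have [] := h i I k I.
  - by rewrite indicE; case: (_ \in _); rewrite ?normr1 ?normr0.
  - apply: cvg_near_cst; have [Ew|nEw] := pselect (E_ w).
      apply: nearW => n; rewrite !indicE !mem_set// => i k /=; rewrite /B /D /= !in_itv/= andbT.
      by move=> /andP[gU _]; apply: le_trans gU (Ew i).
    have [i /negP] : exists i, ~ (U i w <= V i w) by apply/existsNP.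
    rewrite -ltNge => /grid_separates; apply: filterS => n [k [gk Vk]].
    rewrite !indicE !memNset// => /(_ i k).
    by rewrite /B /D /= !in_itv/= andbT => /(_ gk); rewrite leNgt Vk.
rewrite -[LHS](@fineK R) ?fin_num_measure// -Rintegral_indic//.
by rewrite -(cvg_lim _ h1)// -(cvg_lim _ h2).
Qed.
End poisson_void.

(** * Disintegration, null sets and distribution functions *)

Lemma probability_unique d (T : measurableType d) (R : realType)
    (G : set (set T)) (mu nu : probability T R) :
  G `<=` measurable -> G setT -> setI_closed G ->
  (forall A, G A -> mu A = nu A) -> forall A, <<s G >> A -> mu A = nu A.
Proof.
move=> Gm GT GI munu.
apply: (g_sigma_algebra_measure_unique G Gm (fun=> setT)) => //.
- by rewrite bigcup_const//; exists 0%N.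
- by move=> _; rewrite [X in (X < _)%E]probability_setT ltry.
Qed.

Section disintegration.
Context d d' (X : measurableType d) (Y : measurableType d') (R : realType).
Variable k : R.-pker X ~> Y.

(** The law of (x, y) with y drawn from [k x]; the dummy [unit] gives the source the product form
    that kernel composition expects. *)
Definition graph_kernel (p : unit * X) : {measure set (X * Y) -> \bar R} :=
  image_measure (k p.2) (@measurable_pair1 _ _ X Y p.2).

Let measurable_graph_kernel A : measurable A ->
  measurable_fun setT (graph_kernel ^~ A).
Proof.
move=> mA; have h : measurable_fun setT (fun x => k x (xsection A x)).
  by apply: measurable_fun_xsection_finite_kernel; rewrite inE.
rewrite (_ : graph_kernel ^~ A = (fun x => k x (xsection A x)) \o snd).
  exact: (measurableT_comp h measurable_snd).
by apply/funext => -[? x]; rewrite /= xsectionE.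
Qed.

HB.instance Definition _ := isKernel.Build _ _ _ _ R graph_kernel measurable_graph_kernel.

Let graph_kernel_prob p : graph_kernel p setT = 1%E.
Proof. exact: prob_kernel. Qed.

HB.instance Definition _ :=
  Kernel_isProbability.Build _ _ _ _ R graph_kernel graph_kernel_prob.


Variables (Q : probability X R) (mu : probability (X * Y)%type R).
Hypothesis muE : forall A B, measurable A -> measurable B ->
  mu (A `*` B) = (\int[Q]_(x in A) k x B)%E.

(** [mu] and the composition of [Q] with [graph_kernel] agree on rectangles, hence everywhere, and
    an integral against a composition is an iterated one. *)
Lemma integral_disintegration (f : X * Y -> \bar R) :
  measurable_fun setT f -> (forall p, 0 <= f p)%E ->
  (\int[mu]_p f p = \int[Q]_x \int[k x]_y f (x, y))%E.
Proof.
move=> mf f0.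
pose l : R.-pker unit ~> X := kprobability (@measurable_cst _ _ unit (pprobability X R) setT Q).
pose nu := (l \; graph_kernel)%E tt.
have nuE A B : measurable A -> measurable B ->
    nu (A `*` B) = (\int[Q]_(x in A) k x B)%E.
  move=> mA mB; rewrite /nu /= /kcomp /= [RHS]integral_mkcond; apply: eq_integral => x _.
  rewrite /graph_kernel /= /pushforward patchE; case: ifPn => [|]; rewrite ?inE ?notin_setE => Ax.
    by congr (k x _); apply/seteqP; split => y //= [].
  by rewrite -[RHS](measure0 (k x)); congr (k x _); apply/seteqP; split => y //= [].
have nu_mu A : measurable A -> nu A = mu A.
  rewrite measurable_prod_measurableType.
  apply: (g_sigma_algebra_measure_unique _ _ (fun=> setT)).
  - by move=> _ [B mB [C mC <-]]; exact: measurableX.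
  - by move=> _; exists setT => //; exists setT => //; rewrite setXTT.
  - by rewrite bigcup_const//; exists 0%N.
  - move=> _ _ [B1 mB1 [C1 mC1 <-]] [B2 mB2 [C2 mC2 <-]].
    exists (B1 `&` B2); first exact: measurableI.
    by exists (C1 `&` C2); [exact: measurableI|rewrite setXI].
  - by move=> _ [B mB [C mC <-]]; rewrite nuE//; apply/esym/muE.
  - by move=> _; rewrite -setXTT nuE// -muE// setXTT [X in (X < _)%E]probability_setT ltry.
transitivity (\int[nu]_p f p)%E.
  by apply: eq_measure_integral => A mA _; rewrite nu_mu.
rewrite integral_kcomp//; apply: eq_integral => x _.
by rewrite ge0_integral_pushforward.
Qed.

End disintegration.

Section eq_integral_null.
Import HBNNSimple.

(* No measurability is required: [ln (husler_reiss L x)] is only known to be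
   measurable on a set of matrices of full measure. *)
Lemma eq_integral_null d (T : measurableType d) (R : realType)
    (mu : {measure set T -> \bar R}) (G : set T) (f g : T -> \bar R) :
  measurable G -> mu (~` G) = 0%E -> (forall x, G x -> f x = g x) ->
  (\int[mu]_x f x = \int[mu]_x g x)%E.
Proof.
move=> mG G0 fg.
have le_nn (u v : T -> \bar R) : (forall x, 0 <= u x)%E -> (forall x, 0 <= v x)%E ->
    (forall x, G x -> u x = v x) -> (\int[mu]_x u x <= \int[mu]_x v x)%E.
  move=> u0 v0 uv; rewrite !ge0_integralTE//.
  apply: ge_ereal_sup => _ [h /= hu <-].
  (* The integral is a supremum over simple functions lying below; cutting [h] off outside [G] keeps
     its integral and puts it below [v]. *)
  pose h' : {nnsfun T >-> R} := proj_nnsfun h mG.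
  have hh' : h \_ G = h' by exact: (mrestrict h mG).
  have <- : sintegral mu h' = sintegral mu h.
    rewrite -hh' -integral_nnsfun// -integralT_nnsfun.
    rewrite [RHS](@ge0_negligible_integral _ _ _ _ _ (~` G))//.
    - by rewrite setTD setCK.
    - exact: measurableC.
    - exact/measurable_EFinP.
    - by move=> x _; rewrite lee_fin.
  apply: ereal_sup_ubound; exists h' => // x.
  rewrite -hh' patchE; case: ifPn => [|_]; last exact: v0.
  by rewrite inE => Gx; rewrite -uv.
rewrite [LHS]integralE [RHS]integralE; congr (_ - _)%E; apply/eqP; rewrite eq_le; apply/andP.
  by split; apply: le_nn => // x Gx; rewrite !funeposE fg.
by split; apply: le_nn => // x Gx; rewrite !funenegE fg.
Qed.

End eq_integral_null.

Section distribution_functions.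
Context (R : realType) (E : zmodType).
Local Open Scope ereal_scope.

Section cylinders.
Variable m : nat.
Local Notation T := (m.-tuple (\bar R)).

(** The constrained coordinates are listed by an arbitrary [f], possibly with repetitions, so that
    intersecting two cylinders is concatenating their lists. *)
Definition cylinder k (f : 'I_k -> 'I_m) (x : 'I_k -> R) : set T :=
  [set a | forall i, tnth a (f i) <= (x i)%:E].

Definition cylinders : set (set T) :=
  [set A | exists k (f : 'I_k -> 'I_m) (x : 'I_k -> R), A = cylinder f x].

Lemma measurable_cylinder k (f : 'I_k -> 'I_m) (x : 'I_k -> R) :
  measurable (cylinder f x).
Proof.
rewrite (_ : cylinder f x = \bigcap_(i in [set: 'I_k])
    ((@tnth m (\bar R))^~ (f i) @^-1` `]-oo, (x i)%:E]%classic)).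
  apply: fin_bigcap_measurable => // i _; rewrite -[X in measurable X]setTI.
  by apply: measurable_tnth => //; exact: emeasurable_itv.
by apply/seteqP; split => a h i; have := h i; rewrite /= in_itv/=; [|apply].
Qed.

Lemma cylinders_setT : cylinders setT.
Proof.
exists 0%N, (fun i : 'I_0 => False_rect _ (notF (ltn_ord i))), (fun=> 0%R).
by apply/seteqP; split => // a _ [].
Qed.

Lemma setI_closed_cylinders : setI_closed cylinders.
Proof.
move=> _ _ [k [f [x ->]]] [k' [f' [x' ->]]].
exists (k + k')%N, (fun i => match fintype.split i with inl j => f j | inr j => f' j end),
  (fun i => match fintype.split i with inl j => x j | inr j => x' j end).
apply/seteqP; split => a /=.
  by move=> [h h'] i; case: (fintype.split i).
move=> h; split => i.
  by have := h (lshift k' i); rewrite (unsplitK (inl _ i)).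
by have := h (rshift k i); rewrite (unsplitK (inr _ i)).
Qed.

Lemma measurable_cylinders (A : set T) : measurable A -> <<s cylinders >> A.
Proof.
move=> mA.
have h : measurable_fun setT (idfun : g_sigma_algebraType cylinders -> T).
  apply/measurable_fun_tnthP => j.
  apply: (measurability _ (ErealGenOInfty.measurableE R)) => // _ [_ [r ->] <-].
  rewrite setTI (_ : _ @^-1` _ = ~` cylinder (fun _ : 'I_1 => j) (fun=> r)).
    apply: measurableC; apply: sub_sigma_algebra.
    by exists 1%N, (fun=> j), (fun=> r).
  apply/seteqP; split => a /=; rewrite in_itv/= andbT.
    by move=> ra /(_ ord0); rewrite leNgt ra.
  by move=> h; rewrite ltNge; apply/negP => ar; apply: h => i.
by have := h measurableT A mA; rewrite setTI.
Qed.

End cylinders.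

Context d (Omega : measurableType d) (P : probability Omega R).
Context d' (Omega' : measurableType d') (P' : probability Omega' R).
Variables (X : Omega -> E -> \bar R) (Y : Omega' -> E -> \bar R).
Hypothesis mX : forall t, measurable_fun setT (X ^~ t).
Hypothesis mY : forall t, measurable_fun setT (Y ^~ t).

(** Real thresholds suffice for values in the extended line, because cylinders generate the
    sigma-algebra and are stable under intersection. *)
Lemma eq_fdd_distribution_function :
  (forall m (t : 'I_m -> E) (x : 'I_m -> R),
    P [set w | forall j, X w (t j) <= (x j)%:E] =
    P' [set w | forall j, Y w (t j) <= (x j)%:E]) ->
  eq_fdd P X P' Y.
Proof.
move=> XY m t A /measurable_cylinders mA.
have mXt : measurable_fun setT (fun w => [tuple X w (t j) | j < m]).
  by apply/measurable_fun_tnthP => j; rewrite (_ : _ \o _ = X ^~ (t j))//;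
    apply/funext => w; rewrite /= tnth_mktuple.
have mYt : measurable_fun setT (fun w => [tuple Y w (t j) | j < m]).
  by apply/measurable_fun_tnthP => j; rewrite (_ : _ \o _ = Y ^~ (t j))//;
    apply/funext => w; rewrite /= tnth_mktuple.
pose mu := distribution P (to_mfun mXt).
pose nu := distribution P' (to_mfun mYt).
apply: (@probability_unique _ _ R (@cylinders m) mu nu _ _ _ _ A mA).
- by move=> _ [k [f [x ->]]]; exact: measurable_cylinder.
- exact: cylinders_setT.
- exact: setI_closed_cylinders.
- move=> _ [k [f [x ->]]]; have := XY k (t \o f) x.
  rewrite /mu /nu /distribution /= /pushforward /cylinder.
  have -> : [set w | forall j, X w ((t \o f) j) <= (x j)%:E] =
     (fun w => [tuple X w (t j) | j < m]) @^-1` cylinder f x.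
    by apply/seteqP; split => w h i; have := h i; rewrite /= tnth_mktuple.
  have -> : [set w | forall j, Y w ((t \o f) j) <= (x j)%:E] =
     (fun w => [tuple Y w (t j) | j < m]) @^-1` cylinder f x.
    by apply/seteqP; split => w h i; have := h i; rewrite /= tnth_mktuple.
  by [].
Qed.

End distribution_functions.

(** * Gaussian processes with stationary increments *)

Section variogram_facts.
Context (R : realType) (d : nat).
Implicit Types (v : variogram R d) (s t : 'rV[R]_d).

(** Conditional negative definiteness at the points [t] and 0 with weights 1 and -1 reads -2 v(t) <=
    0. *)
Lemma variogram_ge0 v t : 0 <= v t.
Proof.
have := @variogram_cnd _ _ v 2 (fun i => if i == ord0 then t else 0)
  (fun i => if i == ord0 then 1 else -1).
rewrite !big_ord_recl !big_ord0/= !addr0 subrr => /(_ erefl).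
by rewrite !subrr subr0 sub0r variogramN variogram0; lra.
Qed.

(** By polarization, the covariance of a centred process that vanishes at 0 and has variogram 4
    [v]. *)
Definition increment_covariance m (t : 'I_m -> 'rV[R]_d) v : 'M[R]_m :=
  \matrix_(j, k) (2 * (v (t j) + v (t k) - v (t j - t k))).

Lemma variogramC v s t : v (s - t) = v (t - s).
Proof. by rewrite -variogramN opprB. Qed.

Lemma increment_covariance_sym m (t : 'I_m -> 'rV[R]_d) v j k :
  increment_covariance t v j k = increment_covariance t v k j.
Proof. by rewrite !mxE variogramC [v (t j) + _]addrC. Qed.

Lemma sqrt_variogram_mx_sqr m (t : 'I_m -> 'rV[R]_d) v j k :
  sqrt_variogram_mx t v j k ^+ 2 = v (t j - t k).
Proof. by rewrite mxE sqr_sqrtr// variogram_ge0. Qed.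

Lemma sqrt_variogram_increment m (t : 'I_m -> 'rV[R]_d) v j k :
  sqrt_variogram_mx t v j k ^+ 2 =
  (increment_covariance t v j j + increment_covariance t v k k -
   2 * increment_covariance t v j k) / 4.
Proof. by rewrite sqrt_variogram_mx_sqr !mxE !subrr !variogram0; field. Qed.

End variogram_facts.

Section gaussian_increments.
Context (R : realType) (d : nat).
Local Notation FS := (fun_space 'rV[R]_d R).
Variables (mu : probability FS R) (v : variogram R d).
Hypothesis gmu : gaussian_with_variogram mu (fun t => 4 * v t).

Let mev (t : 'rV[R]_d) : measurable_fun setT (fun w : FS => w t).
Proof. exact: measurable_eval. Qed.

Let second_moment t : (\int[mu]_w ((w t) ^+ 2)%:E = (4 * v t)%:E)%E.
Proof.
case: gmu => _ _ _ hv w0.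
have := hv 0 t; rewrite subr0 => <-; apply: ae_eq_integral => //.
- apply/measurable_EFinP; exact: measurable_funX.
- by apply/measurable_EFinP/measurable_funX; exact: measurable_funB.
- case: w0 => N [mN N0 sub]; exists N; split => //; apply: subset_trans sub => w.
  by apply: contra_not => w0 _; rewrite /= w0 subr0.
Qed.

Let integrable_sqr (f : FS -> R) (c : R) : measurable_fun setT f ->
  (\int[mu]_w ((f w) ^+ 2)%:E = c%:E)%E ->
  mu.-integrable setT (EFin \o (fun w => f w ^+ 2)).
Proof.
move=> mf fc; apply/integrableP; split.
  by apply/measurable_EFinP; exact: measurable_funX.
under eq_integral do rewrite /= ger0_norm ?sqr_ge0//.
by rewrite fc ltry.
Qed.

Let covariance s t :
  (\int[mu]_w (w s * w t)%:E = (2 * (v s + v t - v (s - t)))%:E)%E.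
Proof.
case: gmu => _ _ _ hv _.
have is_ := integrable_sqr (mev s) (second_moment s).
have it := integrable_sqr (mev t) (second_moment t).
have ist := integrable_sqr (measurable_funB (mev s) (mev t)) (hv t s).
have E (w : FS) : w s * w t = 2^-1 * ((w s ^+ 2 + w t ^+ 2) - (w s - w t) ^+ 2).
  by field.
have ist2 := integrable_add is_ it.
have i3 : mu.-integrable setT (EFin \o (fun w : FS => (w s ^+ 2 + w t ^+ 2) - (w s - w t) ^+ 2)).
  exact: (integrableB measurableT ist2 ist).
under eq_integral do rewrite E.
rewrite -EFin_Rintegral; last exact: integrable_scale.
rewrite RintegralZl// RintegralB// RintegralD//.
have Rs : \int[mu]_w (w s ^+ 2) = 4 * v s by rewrite /Rintegral second_moment.
have Rt : \int[mu]_w (w t ^+ 2) = 4 * v t by rewrite /Rintegral second_moment.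
have Rst : \int[mu]_w ((w s - w t) ^+ 2) = 4 * v (s - t) by rewrite /Rintegral hv.
by rewrite Rs Rt Rst; congr EFin; field.
Qed.

Variables (m : nat) (t : 'I_m -> 'rV[R]_d).

Let at_t (w : FS) : fun_space 'I_m R := fun j => w (t j).

Let measurable_at_t : measurable_fun setT at_t.
Proof. by apply: measurable_to_fun_space => j; exact: mev. Qed.

Let nu : probability (fun_space 'I_m R) R := distribution mu (to_mfun measurable_at_t).

Let nu_integral (f : fun_space 'I_m R -> \bar R) : measurable_fun setT f ->
  (\int[nu]_w f w = \int[mu]_w f (at_t w))%E.
Proof.
move=> mf.
by apply: (@eq_law_integral _ _ _ _ _ _ _ nu mu id at_t) => //; exact: measurable_at_t.
Qed.

Let normal_nu : normal_vector nu (increment_covariance t v).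
Proof.
case: (gmu) => gp zm _ _ _; split.
- by move=> n s a; exact: (gp n (t \o s) a).
- move=> j; rewrite nu_integral; first exact: zm.
  by apply/measurable_EFinP; exact: measurable_eval.
- move=> j k; rewrite nu_integral ?mxE; first exact: covariance.
  by apply/measurable_EFinP/measurable_funM; exact: measurable_eval.
Qed.

Let drifted_expE (x : 'I_m -> R) w j :
  drifted_exp (increment_covariance t v) x (at_t w) j = expR (w (t j) - 2 * v (t j) - x j).
Proof.
by rewrite /drifted_exp mxE subrr variogram0 /at_t; congr expR; field.
Qed.

(** The maximum is at most the sum, whose terms have mean [expR (- x j)]; the bound is uniform in
    [v], which makes the mixture integrable. *)
Lemma integral_max_increments_le (x : 'I_m -> R) :
  (\int[mu]_w (\big[Num.max/0]_(j < m) expR (w (t j) - 2 * v (t j) - x j))%:E <=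
   (\sum_(j < m) expR (- x j))%:E)%E.
Proof.
pose e (j : 'I_m) (w : FS) := expR (w (t j) - 2 * v (t j) - x j).
have me j : measurable_fun setT (e j).
  apply: measurableT_comp => //; apply: measurable_funB => //; exact: measurable_funB.
apply: (@le_trans _ _ (\int[mu]_w (\sum_(j < m) (e j w)%:E))%E).
  apply: ge0_le_integral => //.
  - by move=> w _; rewrite lee_fin bigmax_ge_id.
  - by apply/measurable_EFinP; apply: measurable_bigmaxr => j; exact: me.
  - by apply: emeasurable_sum => j; apply/measurable_EFinP; exact: me.
  move=> w _; rewrite sumEFin lee_fin; apply/bigmax_leP; split.
    by apply: sumr_ge0 => j _; exact: expR_ge0.
  move=> j _; rewrite (bigD1 j)//= lerDl; apply: sumr_ge0 => k _; exact: expR_ge0.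
rewrite ge0_integral_sum//; last 2 first.
- by move=> j; apply/measurable_EFinP; exact: me.
- by move=> j w _; rewrite lee_fin expR_ge0.
rewrite -sumEFin; apply: lee_sum => j _.
rewrite -(integral_drifted_exp x (@increment_covariance_sym _ _ _ t v)
  (normal_vector_transform normal_nu)) nu_integral.
  by rewrite le_eqVlt; apply/orP; left; apply/eqP; apply: eq_integral => w _; rewrite drifted_expE.
by apply/measurable_EFinP; exact: measurable_drifted_exp.
Qed.

Lemma ln_husler_reiss_increments (x : 'I_m -> R) :
  (\int[mu]_w (\big[Num.max/0]_(j < m) expR (w (t j) - 2 * v (t j) - x j))%:E =
   - (ln (husler_reiss (sqrt_variogram_mx t v) x))%:E)%E.
Proof.
rewrite (ln_husler_reiss x (@increment_covariance_sym _ _ _ t v)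
  (normal_vector_transform normal_nu) (@sqrt_variogram_increment _ _ _ t v)) oppeK.
rewrite nu_integral; last first.
  apply/measurable_EFinP; apply: measurable_bigmaxr => j; exact: measurable_drifted_exp.
apply: eq_integral => w _; congr EFin; apply: eq_bigr => j _.
by rewrite drifted_expE.
Qed.

End gaussian_increments.

(** * Measurability in the matrix and the mixing integral *)

Section measurable_cholesky.
Context d (T : measurableType d) (R : realType) (r : nat).

(** 1/f equals f times the power -1 of f^2, also where f = 0 since both sides then vanish. *)
Lemma measurable_funVr (f : T -> R) :
  measurable_fun setT f -> measurable_fun setT (fun x => (f x)^-1).
Proof.
move=> mf; rewrite (_ : (fun _ => _) = (fun x => f x * (f x ^+ 2) `^ (-1))).
  apply: measurable_funM => //.
  by apply: (measurableT_comp (measurable_powR (-1))); exact: measurable_funX.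
apply/funext => x; rewrite powR_inv1 ?sqr_ge0//.
have [->|fx0] := eqVneq (f x) 0; first by rewrite invr0 mul0r.
by field.
Qed.

Variable C : T -> 'M[R]_r.
Hypothesis mC : forall i j, measurable_fun setT (fun x => C x i j).

Lemma measurable_schur_iter n i j :
  measurable_fun setT (fun x => schur_iter (C x) n i j).
Proof.
elim: n i j => [//|n IH] i j.
rewrite /schur_iter /=; case: (insub n) => [k|//].
under eq_fun do rewrite mxE.
apply: measurable_funB; first exact: IH.
by apply: measurable_funM; [apply: measurable_funM|apply: measurable_funVr]; exact: IH.
Qed.

Lemma measurable_cholesky i k : measurable_fun setT (fun x => cholesky (C x) i k).
Proof.
rewrite /cholesky; case: (insub k) => [k'|//].
apply: measurable_funM; first exact: measurable_schur_iter.
apply: measurable_funVr; apply: measurableT_comp; last exact: measurable_schur_iter.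
by apply: continuous_measurable_fun; exact: sqrt_continuous.
Qed.

End measurable_cholesky.

Lemma gram_psd (R : realType) r s (C : 'M[R]_r) (b : 'I_r -> 'I_s -> R) :
  (forall i j, C i j = \sum_k b i k * b j k) -> psd C.
Proof.
move=> CE; split => [i j|a].
  by rewrite !CE; apply: eq_bigr => k _; rewrite mulrC.
have -> : quad_form C a = \sum_k (\sum_i a i * b i k) ^+ 2.
  under [RHS]eq_bigr do rewrite expr2 mulr_suml.
  rewrite exchange_big/=; apply: eq_bigr => i _.
  under [RHS]eq_bigr do rewrite mulr_sumr.
  rewrite exchange_big/=; apply: eq_bigr => j _.
  by rewrite CE mulr_sumr; apply: eq_bigr => k _; rewrite mulrACA.
by apply: sumr_ge0 => k _; exact: sqr_ge0.
Qed.

Lemma measurable_eq_fun d (T : measurableType d) (R : realType) (f g : T -> R) :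
  measurable_fun setT f -> measurable_fun setT g -> measurable [set x | f x = g x].
Proof.
move=> mf mg; rewrite (_ : [set _ | _] = setT `&` (fun x => f x - g x) @^-1` [set 0]).
  by apply: measurable_funB.
rewrite setTI; apply/seteqP; split => x /=; first by move=> ->; rewrite subrr.
by move/eqP; rewrite subr_eq0 => /eqP.
Qed.

Section mixing_integral.
Context (R : realType) (m : nat) (x : 'I_m.+1 -> R).
Local Notation MX := (mx_space m.+1 R).
Local Notation FSN := (fun_space nat R).

(* The covariance of [W - W (t_0)] when [4 L ^ 2] is the matrix of pairwise
   variogram values; unlike [increment_covariance], it is a function of [L]. *)
Definition based_covariance (L : 'M[R]_m.+1) : 'M[R]_m.+1 :=
  \matrix_(j, k) (2 * (L j ord0 ^+ 2 + L k ord0 ^+ 2 - L j k ^+ 2)).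

(* The Cholesky identity is a visibly measurable form of the requirement that
   the based covariance be positive semidefinite. *)
Definition admissible : set MX := [set L : 'M[R]_m.+1 |
  [/\ forall j k, 0 <= L j k, forall j k, L j k = L k j, forall j, L j j = 0 &
      forall j k, based_covariance L j k =
        \sum_(i < m.+1) cholesky (based_covariance L) j i * cholesky (based_covariance L) k i]].

Let mev j k : measurable_fun setT (fun L : MX => L j k).
Proof.
move=> _ B mB; apply: sub_sigma_algebra.
by exists (j, k) => //; exists B.
Qed.

Let measurable_covariance j k : measurable_fun setT (fun L : MX => based_covariance L j k).
Proof.
rewrite (_ : (fun _ => _) = fun L : MX => 2 * (L j ord0 ^+ 2 + L k ord0 ^+ 2 - L j k ^+ 2)); last first.
  by apply/funext => L; rewrite mxE.
apply: measurable_funM => //; apply: measurable_funB; last exact: measurable_funX.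
by apply: measurable_funD; exact: measurable_funX.
Qed.

Lemma measurable_admissible : measurable admissible.
Proof.
pose A1 : set MX := \bigcap_(p in [set: 'I_m.+1 * 'I_m.+1]) [set L : MX | 0 <= L p.1 p.2].
pose A2 : set MX := \bigcap_(p in [set: 'I_m.+1 * 'I_m.+1]) [set L : MX | L p.1 p.2 = L p.2 p.1].
pose A3 : set MX := \bigcap_(j in [set: 'I_m.+1]) [set L : MX | L j j = 0].
pose A4 : set MX := \bigcap_(p in [set: 'I_m.+1 * 'I_m.+1])
  [set L : MX | based_covariance L p.1 p.2 = \sum_(i < m.+1)
     cholesky (based_covariance L) p.1 i * cholesky (based_covariance L) p.2 i].
rewrite (_ : admissible = A1 `&` A2 `&` A3 `&` A4); last first.
  apply/seteqP; split => L.
    by move=> [h1 h2 h3 h4]; (do 3?split) => //= -[j k] _ //=.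
  by move=> [[[h1 h2] h3] h4]; split => [j k|j k|j|j k];
    [exact: (h1 (j, k))|exact: (h2 (j, k))|exact: h3|exact: (h4 (j, k))].
apply: measurableI; first apply: measurableI; first apply: measurableI.
- apply: fin_bigcap_measurable => // -[j k] _ /=.
  rewrite (_ : [set _ | _] = setT `&` (fun L : MX => L j k) @^-1` `[0, +oo[%classic).
    by apply: mev => //; exact: measurable_itv.
  by rewrite setTI; apply/seteqP; split => L /=; rewrite in_itv/= andbT.
- by apply: fin_bigcap_measurable => // -[j k] _ /=; exact: measurable_eq_fun.
- by apply: fin_bigcap_measurable => // j _ /=; exact: measurable_eq_fun.
- apply: fin_bigcap_measurable => // -[j k] _ /=; apply: measurable_eq_fun => //.
  by apply: measurable_sum => i; apply: measurable_funM; exact: measurable_cholesky.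
Qed.

Let integrand (L : 'M[R]_m.+1) (n : FSN) : R := \big[Num.max/0]_(j < m.+1)
  drifted_exp (based_covariance L) x (cholesky_map (based_covariance L) n) j.

(** A measurable stand-in for [- ln (husler_reiss L x)], defined for every [L]: the noise has a
    fixed law and the matrix enters only through the Cholesky factor and the drift. *)
Definition exponent (L : MX) : \bar R := (\int[standard_normals R m.+1]_n (integrand L n)%:E)%E.

Let measurable_integrand : measurable_fun setT (fun p : MX * FSN => (integrand p.1 p.2)%:E).
Proof.
apply/measurable_EFinP; apply: measurable_bigmaxr => j; apply: measurableT_comp => //.
apply: measurable_funB => //; apply: measurable_funB; last first.
  apply: measurable_funM => //.
  exact: (measurableT_comp (measurable_covariance j j) measurable_fst).
apply: measurable_sum => k; apply: measurable_funM.
  exact: (measurableT_comp (measurable_cholesky measurable_covariance j k) measurable_fst).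
exact: (measurableT_comp (@measurable_eval _ _ (k : nat)) measurable_snd).
Qed.

Let integrand_ge0 p : (0 <= (integrand p.1 p.2)%:E)%E.
Proof. by rewrite lee_fin bigmax_ge_id. Qed.

Lemma measurable_exponent : measurable_fun setT exponent.
Proof.
exact: (@measurable_fun_fubini_tonelli_F _ _ _ _ _ (standard_normals R m.+1)
  (fun p : MX * FSN => (integrand p.1 p.2)%:E)).
Qed.

Lemma exponent_ge0 L : (0 <= exponent L)%E.
Proof. by apply: integral_ge0 => n _; exact: (integrand_ge0 (L, n)). Qed.

(** [ln_husler_reiss] accepts any covariance whose differences have variances 4 L^2, in particular
    the one based at index [ord0]. *)
Lemma exponentE L : admissible L -> (exponent L = - (ln (husler_reiss L x))%:E)%E.
Proof.
move=> [L0 symL diagL CE].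
have psdC := gram_psd CE.
have LC j k : L j k ^+ 2 = (based_covariance L j j + based_covariance L k k -
    2 * based_covariance L j k) / 4.
  by rewrite !mxE !diagL; field.
rewrite (ln_husler_reiss x psdC.1 (gaussian_measure_transform psdC) LC) oppeK.
rewrite (ge0_integral_gaussian psdC.1 (gaussian_measure_transform psdC))//.
  apply/measurable_EFinP; apply: measurable_bigmaxr => j; exact: measurable_drifted_exp.
by move=> w; rewrite lee_fin bigmax_ge_id.
Qed.

Context (d : nat) (t : 'I_m.+1 -> 'rV[R]_d).

(** Schoenberg's argument: subtracting the total weight [s] at the base point turns [a] into weights
    of sum 0, at which the conditionally negative definite form is minus half the based covariance
    form at [a]. *)
Lemma admissible_sqrt_variogram (v : variogram R d) : admissible (sqrt_variogram_mx t v).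
Proof.
split => [j k|j k|j|]; first by rewrite mxE sqrtr_ge0.
- by rewrite !mxE variogramC.
- by rewrite mxE subrr variogram0 sqrtr0.
apply: choleskyE; split => [j k|a].
  rewrite !mxE !sqr_sqrtr ?variogram_ge0// (variogramC v (t j) (t k)).
  by rewrite [v (t j - _) + _]addrC.
pose s := \sum_j a j.
pose g : 'M[R]_m.+1 := \matrix_(j, k) v (t j - t k).
have g0 : \sum_j (a j + - s * (j == ord0)%:R) = 0.
  have d1 : \sum_(j < m.+1) (j == ord0)%:R = 1 :> R.
    by rewrite (bigD1 ord0)//= big1 ?addr0// => j /negbTE ->.
  by rewrite big_split/= -mulr_sumr d1 mulr1 subrr.
have : quad_form g (fun j => a j + - s * (j == ord0)%:R) <= 0.
  rewrite /quad_form; under eq_bigr do under eq_bigr do rewrite mxE.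
  exact: (variogram_cnd v t g0).
have symg j k : g j k = g k j by rewrite !mxE variogramC.
rewrite quad_form_add_delta// [g ord0 ord0]mxE subrr variogram0 mulr0 addr0.
set c := \sum_i _; suff -> : quad_form (based_covariance (sqrt_variogram_mx t v)) a =
  2 * (2 * s * c - quad_form g a) by lra.
have E i j : a i * a j * based_covariance (sqrt_variogram_mx t v) i j =
    2 * (a i * g i ord0) * a j + 2 * a i * (a j * g j ord0) - 2 * (a i * a j * g i j).
  by rewrite [based_covariance _ _ _]mxE !sqrt_variogram_mx_sqr !mxE; ring.
rewrite /quad_form; under eq_bigr do under eq_bigr do rewrite E.
under eq_bigr => i _.
  rewrite sumrB big_split/= -!mulr_sumr -/s -/c; over.
rewrite sumrB big_split/= -!mulr_suml -!mulr_sumr -/s -/c.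
ring.
Qed.

(** The image measure is carried by [admissible], where the integrand equals the measurable
    [- exponent]; that integral is pulled back to [Q] and [exponent] is rewritten as the logarithm
    again. *)
Lemma mixing_integral (Q : probability (variogram_space R d) R) :
  (\int[distribution Q (sqrt_variogram_mx t)]_(L in @nonneg_mx R m.+1)
     (ln (husler_reiss L x))%:E =
   - \int[Q]_v (- (ln (husler_reiss (sqrt_variogram_mx t v) x))%:E))%E.
Proof.
rewrite integral_mkcond.
rewrite (@eq_integral_null _ _ _ _ admissible _ (fun L => - exponent L)%E measurable_admissible).
- rewrite integral_ge0N; last by move=> L _; exact: exponent_ge0.
  congr (- _)%E; rewrite ge0_integral_distribution//.
  + by apply: eq_integral => v _; rewrite /= exponentE//; exact: admissible_sqrt_variogram.
  + exact: measurable_exponent.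
  + exact: exponent_ge0.
- rewrite -[RHS](measure0 Q) -[LHS]/(Q (sqrt_variogram_mx t @^-1` (~` admissible))).
  by congr (Q _); apply/seteqP; split => // v /=; apply; exact: admissible_sqrt_variogram.
- move=> L AL; rewrite patchE mem_set; last by case: AL.
  by rewrite exponentE// oppeK.
Qed.

End mixing_integral.

Section as_probability.
Context d (T : measurableType d) (R : realType) (mu : {measure set T -> \bar R}).

(** Repackages a measure of mass 1, such as [kappa v], as a [probability], over which the Gaussian
    lemmas are stated. *)
Definition as_probability of mu setT = 1%E : set T -> \bar R := mu.

Variable mu1 : mu setT = 1%E.
HB.instance Definition _ := Measure.copy (as_probability mu1) (mu : set T -> \bar R).
HB.instance Definition _ := Measure_isProbability.Build _ _ _ (as_probability mu1) mu1.
End as_probability.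

Lemma measurable_bigmaxe (R : realType) d (T : measurableType d) (n : nat)
    (f : 'I_n -> T -> \bar R) :
  (forall i, measurable_fun setT (f i)) ->
  measurable_fun setT (fun t => \big[maxe/-oo%E]_(i < n) f i t).
Proof.
move=> mf; elim: n f mf => [|n IH] f mf.
  by rewrite (_ : (fun _ => _) = cst -oo%E)//; apply/funext => t; rewrite big_ord0.
rewrite (_ : (fun _ => _) = (fun t =>
    maxe (f ord0 t) (\big[maxe/-oo%E]_(i < n) f (lift ord0 i) t))); last first.
  by apply/funext => t; rewrite big_ord_recl.
by apply: measurable_maxe => //; exact: IH.
Qed.

(** * The max-mixture process *)

Section mixture.
Context (R : realType) (d : nat) (dO : measure_display).
Context (Omega : measurableType dO) (P : probability Omega R).
Variable Q : probability (variogram_space R d) R.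
Variables (g : nat -> {RV P >-> variogram_space R d})
  (W : nat -> {RV P >-> fun_space 'rV[R]_d R}) (U : nat -> {RV P >-> R}).
Hypothesis data : max_mixture_data Q g W U.
Local Notation VS := (variogram_space R d).
Local Notation FS := (fun_space 'rV[R]_d R).
Local Notation xi := (max_mixture g W U).

Let mev t : measurable_fun setT (fun v : VS => v t).
Proof.
move=> _ B mB; apply: sub_sigma_algebra.
by exists t => //; exists B.
Qed.

Let measurable_mark i : measurable_fun setT (mark g W i).
Proof. by apply: measurable_fun_pair; exact: measurable_funP. Qed.

Lemma max_mixture_leE w t (x : R) :
  ((xi w t <= x%:E)%E <-> forall i, U i w + W i w t - 2 * g i w t <= x).
Proof.
split => [h i|h].
  by rewrite -lee_fin; apply: le_trans h; apply: ereal_sup_ubound; exists i.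
by apply: ge_ereal_sup => _ [i _ <-]; rewrite lee_fin.
Qed.

Lemma measurable_max_mixture t : measurable_fun setT (xi ^~ t).
Proof.
apply: (measurability _ (ErealGenOInfty.measurableE R)) => // _ [_ [r ->] <-].
rewrite setTI (_ : _ @^-1` _ = ~` \bigcap_i
    (fun w => U i w + W i w t - 2 * g i w t) @^-1` `]-oo, r]%classic).
  apply: measurableC; apply: bigcap_measurable => // i _; rewrite -[X in measurable X]setTI.
  suff h : measurable_fun setT (fun w => U i w + W i w t - 2 * g i w t).
    by apply: h => //; exact: measurable_itv.
  apply: measurable_funB; first apply: measurable_funD; first exact: measurable_funP.
    exact: (measurableT_comp (measurable_eval t) (measurable_funP (W i))).
  apply: measurable_funM => //.
  exact: (measurableT_comp (mev t) (measurable_funP (g i))).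
apply/seteqP; split => w /=; rewrite in_itv/= andbT ltNge.
  move=> /negP nx h; apply: nx; apply/max_mixture_leE => i.
  by have := h i I; rewrite /= in_itv.
by move=> nx; apply/negP => /max_mixture_leE h; apply: nx => i _; rewrite /= in_itv/=.
Qed.

Section finite_dimensional.
Variables (m : nat) (t : 'I_m -> 'rV[R]_d) (x : 'I_m -> R).

Definition mark_max (p : VS * FS) : R :=
  \big[Num.max/0]_(j < m) expR (p.2 (t j) - 2 * p.1 (t j) - x j).

Lemma measurable_mark_max : measurable_fun setT mark_max.
Proof.
apply: measurable_bigmaxr => j; apply: measurableT_comp => //.
apply: measurable_funB => //; apply: measurable_funB.
  exact: (measurableT_comp (measurable_eval (t j)) measurable_snd).
by apply: measurable_funM => //; exact: (measurableT_comp (mev (t j)) measurable_fst).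
Qed.

Let V (p : VS * FS) := - ln (mark_max p).

Let measurable_V : measurable_fun setT V.
Proof.
by apply: measurable_funN; apply: (measurableT_comp _ measurable_mark_max).
Qed.

Let indep_UV N (A : set Omega) (D : 'I_N -> set R) :
  <<s gen_family U >> A -> (forall i, measurable (D i)) ->
  P (A `&` \bigcap_(i in [set: 'I_N]) (V \o mark g W i) @^-1` D i) =
  (P A * \prod_(i < N) P ((V \o mark g W 0%N) @^-1` D i))%E.
Proof.
move=> UA mD.
have mVD i : measurable (V @^-1` D i) by rewrite -[X in measurable X]setTI; exact: measurable_V.
rewrite (U_indep data UA); last first.
  apply: (@fin_bigcap_measurable _ (g_sigma_algebraType (gen_family (mark g W)))) => // i _.
  apply: sub_sigma_algebra; exists (nat_of_ord i) => //.
  by exists (V @^-1` D i) => //; rewrite setTI.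
congr (_ * _)%E.
case: N D mD mVD => [|N] D mD mVD.
  by rewrite big_ord0 (_ : \bigcap_(_ in _) _ = setT) ?probability_setT//;
    apply/seteqP; split => // w _ [].
(* [mark_indep] takes sets indexed by all naturals, so [D] is extended through [inord], which is
   faithful below [N.+1]. *)
pose A' (i : nat) := mark g W i @^-1` (V @^-1` D (inord i)).
have -> : \bigcap_(i in [set: 'I_N.+1]) (V \o mark g W i) @^-1` D i =
    \bigcap_(i in [set` iota 0 N.+1]) A' i.
  apply/seteqP; split => w h i.
    rewrite /= -[i \in _]/(i \in iota 0 N.+1) mem_iota => /= iN.
    by have := h (inord i) I; rewrite /A' /= inordK.
  move=> _; have := h i.
  rewrite -[[set` _] _]/(is_true (nat_of_ord i \in iota 0 N.+1)) mem_iota/= ltn_ord.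
  by rewrite /A' /= inord_val; apply.
rewrite (mark_indep data); first last.
- move=> i _; exists (V @^-1` D (inord i)); first exact: mVD.
  by rewrite setTI.
- exact: iota_uniq.
rewrite -[iota 0 N.+1]/(index_iota 0 N.+1) big_mkord; apply: eq_bigr => i _.
rewrite /A' inord_val (mark_ident data)//; exact: mVD.
Qed.

(** The law of the mark is disintegrated along the variogram; outside a null set the conditional law
    is Gaussian, and there the inner integral is both known and bounded. *)
Lemma integral_mark_max : (0 < m)%N -> 
  (\int[P]_w (mark_max (mark g W 0%N w))%:E =
   \int[Q]_v (- (ln (husler_reiss (sqrt_variogram_mx t v) x))%:E) /\
   \int[P]_w (mark_max (mark g W 0%N w))%:E <= (\sum_(j < m) expR (- x j))%:E)%E.
Proof.
move=> m0.
have [kappa [joint gauss]] := mark_gaussian data 0.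
pose mu := distribution P (to_mfun (measurable_mark 0)).
have mM : measurable_fun setT (EFin \o mark_max) by apply/measurable_EFinP; exact: measurable_mark_max.
have M0 p : (0 <= (EFin \o mark_max) p)%E by rewrite lee_fin bigmax_ge_id.
have -> : (\int[P]_w (mark_max (mark g W 0%N w))%:E =
    \int[Q]_v \int[kappa v]_w (mark_max (v, w))%:E)%E.
  rewrite -(@integral_disintegration _ _ _ _ _ kappa Q mu _ (EFin \o mark_max) mM M0) //.
  by rewrite ge0_integral_distribution.
case: gauss => N [mN N0 sub].
have gv v : (~` N) v -> gaussian_with_variogram (kappa v) (fun t => 4 * v t).
  by move=> nN; apply: contrapT => /sub.
have N0' : Q (~` ~` N) = 0%E by rewrite setCK.
split.
  apply: (eq_integral_null (measurableC mN) N0') => v Nv.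
  have h := (@ln_husler_reiss_increments _ _ (as_probability (prob_kernel v)) v (gv v Nv) m t x).
  exact: h.
apply: (@le_trans _ _ (\int[Q]_v (\sum_(j < m) expR (- x j))%:E)%E).
  have m1 : measurable_fun setT (fun v => \int[kappa v]_w (mark_max (v, w))%:E)%E.
    exact: (@measurable_fun_integral_finite_kernel _ _ _ _ _ (EFin \o mark_max) kappa M0 mM).
  apply: ae_ge0_le_integral => //.
  - by move=> v _; apply: integral_ge0 => w _; exact: M0.
  - by move=> v _; rewrite lee_fin sumr_ge0// => j _; exact: expR_ge0.
  - exists N; split => //; apply: subset_trans sub => v; apply: contra_not => h _.
    exact: (@integral_max_increments_le _ _ (as_probability (prob_kernel v)) v h m t x).
by rewrite integral_cst// [X in (_ * X)%E]probability_setT mule1.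
Qed.

Let mark_max_gt0 p : (0 < m)%N -> 0 < mark_max p.
Proof.
by move=> m0; exact: (lt_le_trans (expR_gt0 _) (le_bigmax _ _ (Ordinal m0))).
Qed.

Lemma max_mixture_distribution :
  P [set w | forall j, (xi w (t j) <= (x j)%:E)%E] =
  (expR (- \int[P]_w mark_max (mark g W 0%N w)))%:E.
Proof.
(* For m = 0 [mark_max] is 0, hence not of the form [expR (- V)]; the event is then certain. *)
have [m0|m0] := posnP m.
  rewrite (_ : [set w | _] = setT); last first.
    by apply/seteqP; split => // w _ j; have := ltn_ord j; rewrite {2}m0.
  have M0 p : mark_max p = 0.
    by rewrite /mark_max big1_idem// => [|j]; [exact: maxxx|have := ltn_ord j; rewrite {2}m0].
  rewrite (_ : \int[P]_w _ = 0); first by rewrite oppr0 expR0 probability_setT.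
  by under eq_Rintegral do rewrite M0; exact: Rintegral_probability_cst.
have VM p : expR (- V p) = mark_max p by rewrite opprK lnK// posrE mark_max_gt0.
have mVm i : measurable_fun setT (V \o mark g W i) by apply: measurableT_comp.
have iV : P.-integrable setT (EFin \o (fun w => expR (- (V \o mark g W 0%N) w))).
  apply/integrableP; split.
    by apply/measurable_EFinP; apply: measurableT_comp => //; exact: measurable_funN.
  under eq_integral do rewrite /= ger0_norm ?expR_ge0// VM.
  by apply: le_lt_trans (integral_mark_max m0).2 _; rewrite ltry.
have := @poisson_void _ _ _ P U (fun i => V \o mark g W i) mVm indep_UV (U_poisson data) iV.
under eq_Rintegral do rewrite /= VM.
move=> <-; congr (P _); apply/seteqP; split => w /= h.
  move=> i; rewrite /V lerNr -[leRHS]expRK ler_ln ?posrE ?expR_gt0 ?mark_max_gt0//.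
  apply/bigmax_leP; split => [|j _]; first exact: expR_ge0.
  by rewrite ler_expR /=; have /max_mixture_leE/(_ i) := h j; lra.
move=> j; apply/max_mixture_leE => i.
have := h i; rewrite /V lerNr -[leRHS]expRK ler_ln ?posrE ?expR_gt0 ?mark_max_gt0//.
by move=> /bigmax_leP[_ /(_ j isT)]; rewrite ler_expR /=; lra.
Qed.


End finite_dimensional.

Lemma integrable_mark_max m (t : 'I_m -> 'rV[R]_d) (x : 'I_m -> R) :
  P.-integrable setT (EFin \o (fun w => mark_max t x (mark g W 0%N w))).
Proof.
have M0 p : 0 <= mark_max t x p by exact: bigmax_ge_id.
apply/integrableP; split.
  by apply/measurable_EFinP/(measurableT_comp (measurable_mark_max t x)).
under eq_integral do rewrite /= ger0_norm//.
have [m0|m0] := posnP m; last first.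
  by apply: le_lt_trans (integral_mark_max t x m0).2 _; rewrite ltry.
rewrite integral0_eq// => w _; rewrite /mark_max big1_idem// => [|j].
  exact: maxxx.
by have := ltn_ord j; rewrite {2}m0.
Qed.

Lemma max_mixture_husler_reiss (m : nat) (t : 'I_m -> 'rV[R]_d) (x : 'I_m -> R) :
  (P [set w | forall j, xi w (t j) <= (x j)%:E] =
   expeR (\int[distribution Q (sqrt_variogram_mx t)]_(L in @nonneg_mx R m)
            (ln (husler_reiss L x))%:E))%E.
Proof.
rewrite max_mixture_distribution.
case: m t x => [|m] t x.
  rewrite integral0_eq => [|L _]; last by rewrite /husler_reiss big_ord0 expR0 ln1.
  rewrite /= expR0 (_ : \int[P]_w _ = 0) ?oppr0 ?expR0//.
  under eq_Rintegral do rewrite /mark_max big_ord0.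
  exact: Rintegral_probability_cst.
rewrite mixing_integral -(integral_mark_max t x (ltn0Sn m)).1.
(* Integrability makes the exponent finite, so that [expeR] reduces to [expR]. *)
by rewrite -EFin_Rintegral//; exact: integrable_mark_max.
Qed.

Lemma stationary_max_mixture : stationary P xi.
Proof.
move=> h; apply: eq_fdd_distribution_function => [t|t|m t x].
- exact: measurable_max_mixture.
- exact: measurable_max_mixture.
rewrite -[RHS]/(P [set w | forall j, (xi w (t j + h) <= (x j)%:E)%E]).
rewrite !max_mixture_distribution; congr (expR (- _))%:E.
case: m t x => [|m] t x.
  by apply: eq_Rintegral => w _; rewrite /mark_max !big_ord0.
rewrite /Rintegral; congr fine.
apply: (etrans (integral_mark_max t x (ltn0Sn m)).1).
apply: (etrans _ (esym (integral_mark_max (fun j => t j + h) x (ltn0Sn m)).1)).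
apply: eq_integral => v _; congr (- (ln (husler_reiss _ x))%:E)%E.
by apply/matrixP => j k; rewrite !mxE opprD addrACA subrr addr0.
Qed.

Lemma mark_max_shift m (t : 'I_m -> 'rV[R]_d) (x : 'I_m -> R) n : (0 < n)%N -> forall p,
  mark_max t (fun j => x j + ln n%:R) p = mark_max t x p / n%:R.
Proof.
move=> n0 p; rewrite /mark_max.
have ni : 0 <= n%:R^-1 :> R by rewrite invr_ge0.
rewrite (big_morph (fun y => y / n%:R) (op1 := Num.max) (op2 := Num.max) (id1 := 0) (id2 := 0)).
- apply: eq_bigr => j _; by rewrite opprD addrA [LHS]expRD expRN lnK// posrE ltr0n.
- by move=> y z; rewrite maxr_pMl.
- by rewrite mul0r.
Qed.

Lemma max_stable_max_mixture : max_stable P xi.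
Proof.
move=> n n0 d' Omega' P' Y mY indY eqY.
pose Z w t := ((\big[maxe/-oo]_(i < n) Y i w t) - (ln n%:R)%:E)%E.
have mZ t : measurable_fun setT (Z ^~ t).
  apply: emeasurable_funB => //.
  by apply: measurable_bigmaxe => i; exact: mY.
apply: (@eq_fdd_distribution_function _ _ _ _ _ _ _ _ Z) => // [t|m t x].
  exact: measurable_max_mixture.
pose A (i : 'I_n) := [set w | forall j, (Y i w (t j) <= (x j + ln n%:R)%:E)%E].
have ZA : [set w | forall j, (Z w (t j) <= (x j)%:E)%E] = \bigcap_(i in [set` enum 'I_n]) A i.
  apply/seteqP; split => w h.
    move=> i _ j; have := h j; rewrite /Z leeBlDr// => hj.
    rewrite EFinD; apply: le_trans hj; exact: le_bigmax.
  move=> j; rewrite /Z leeBlDr//; apply/bigmax_leP; split => [|i _]; first exact: leNye.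
  by have := h i; rewrite /= mem_enum => /(_ isT j); rewrite EFinD.
(* Equality of finite-dimensional laws is tested on the closed orthant, the cylinder over all
   coordinates. *)
have PA i : P' (A i) = P [set w | forall j, (xi w (t j) <= (x j + ln n%:R)%:E)%E].
  have := eqY i m t _ (measurable_cylinder id (fun j => x j + ln n%:R)).
  rewrite /fdd /pushforward => e.
  rewrite (_ : A i = (fun w => [tuple Y i w (t j) | j < m]) @^-1`
      cylinder id (fun j => x j + ln n%:R)).
    rewrite e; congr (P _).
    by apply/seteqP; split => w h j; have := h j; rewrite /= tnth_mktuple.
  by apply/seteqP; split => w h j; have := h j; rewrite /= tnth_mktuple.
rewrite ZA indY ?enum_uniq//; last first.
  move=> i _.
  rewrite (_ : A i = \bigcap_(j in [set: 'I_m]) (fun w => Y i w (t j)) @^-1`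
      `]-oo, (x j + ln n%:R)%:E]%classic).
    apply: (@fin_bigcap_measurable _ (g_sigma_algebraType
      (gen_family (fun t w => Y i w t)))) => // j _.
    apply: sub_sigma_algebra; exists (t j) => //.
    by exists `]-oo, (x j + ln n%:R)%:E]%classic; [exact: emeasurable_itv|rewrite setTI].
  by apply/seteqP; split => w h j; have := h j; rewrite /= in_itv/=; [|apply].
rewrite big_enum/=; under eq_bigr do rewrite PA max_mixture_distribution.
rewrite prodEFin big_const_ord iter_mulr_1 -expRM_natl max_mixture_distribution; congr (expR _)%:E.
under eq_Rintegral do rewrite mark_max_shift//.
have iM : P.-integrable setT (EFin \o (fun w => mark_max t x (mark g W 0%N w))).
  exact: integrable_mark_max.
by rewrite RintegralZr// mulrN mulrC divfK// pnatr_eq0 -lt0n.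
Qed.

End mixture.

Theorem proposition4p2 (R : realType) (d : nat)
    (Q : probability (variogram_space R d) R)
    (dO : measure_display) (Omega : measurableType dO) (P : probability Omega R)
    (g : nat -> {RV P >-> variogram_space R d})
    (W : nat -> {RV P >-> fun_space 'rV[R]_d R})
    (U : nat -> {RV P >-> R})
    (data : max_mixture_data Q g W U) :
  [/\ max_stable P (max_mixture g W U),
      stationary P (max_mixture g W U) &
      forall (m : nat) (t : 'I_m -> 'rV[R]_d) (x : 'I_m -> R),
        (P [set omega | forall j, max_mixture g W U omega (t j) <= (x j)%:E] =
         expeR (\int[distribution Q (sqrt_variogram_mx t)]_(L in @nonneg_mx R m)
                  (ln (husler_reiss L x))%:E))%E].
Proof.
split; first exact: (max_stable_max_mixture data).
  exact: (stationary_max_mixture data).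
by move=> m t x; exact: (max_mixture_husler_reiss data).
Qed.
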